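(* Let $(M,g)$ be a closed Riemannian manifold of dimension $N\ge6$, let $P_g$ be its Paneitz–Branson operator (the GJMS operator with $m=2$), $Q_g$ its $Q$-curvature and $R_g$ its scalar curvature. If $Q_g>0$ and $R_g>0$, then $P_g$ is coercive.
   Context: $\Delta_g=\mathrm{div}_g\nabla_g$. $P_gu=\Delta_g^2u-\mathrm{div}_g\big((a_NR_gg-b_N\mathrm{Ric}_g)du\big)+\frac{N-4}2Q_gu$ with $a_N=\frac{(N-2)^2+4}{2(N-1)(N-2)}$, $b_N=\frac4{N-2}$, and $Q_g=\frac2{N-4}P_g(1)=-\frac1{2(N-1)}\Delta_gR_g+\frac{N^3-4N^2+16N-16}{8(N-1)^2(N-2)^2}R_g^2-\frac2{(N-2)^2}|\mathrm{Ric}_g|_g^2$. $P_g$ is coercive if there is $C>0$ such that $\int_MuP_gu\,dV_g\ge C\|u\|_{H^2}^2$ for every $u\in\mathcal C^\infty(M)$, where $\|u\|_{H^2}=\big(\sum_{i=0}^2\int_M|\nabla^iu|_g^2dV_g\big)^{1/2}$. *)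

(* Defs.v *)
From HB Require Import structures.
From mathcomp Require Import all_boot all_order all_algebra.
From mathcomp Require Import all_classical all_reals all_analysis.

Set Implicit Arguments.
Unset Strict Implicit.
Unset Printing Implicit Defensive.

Import Order.TTheory GRing.Theory Num.Theory.
Import numFieldNormedType.Exports.

Local Open Scope classical_set_scope.
Local Open Scope ring_scope.

Section Calculus.
Context {R : realType}.

Definition partial {n : nat} (i : 'I_n) (f : 'rV[R]_n -> R) : 'rV[R]_n -> R :=
  fun x => 'D_(delta_mx ord0 i) f x.

(* Only meaningful on an open set [O]: the values of [partial i f] on [O] then
   depend on [f] only through its restriction to [O]. *)
Fixpoint Ck_on {n : nat} (k : nat) (O : set 'rV[R]_n) (f : 'rV[R]_n -> R) : Prop :=
  match k with
  | 0 => forall x, O x -> {for x, continuous f}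
  | k'.+1 => forall i : 'I_n,
      (forall x, O x -> derivable f x (delta_mx ord0 i)) /\
      Ck_on k' O (partial i f)
  end.

Definition smooth_on {n : nat} (O : set 'rV[R]_n) (f : 'rV[R]_n -> R) : Prop :=
  forall k, Ck_on k O f.

(* Lebesgue integral over R^n of a continuous compactly supported function,
   as an iterated integral (Fubini). *)
Fixpoint integral_rV (n : nat) : ('rV[R]_n -> R) -> R :=
  match n with
  | 0 => fun f => f 0
  | m.+1 => fun f =>
      \int[lebesgue_measure]_t
        integral_rV (fun x : 'rV[R]_m => f (row_mx (t%:M : 'rV[R]_1) x))
  end.

End Calculus.

Record smooth_atlas (R : realType) (n : nat) (M : ptopologicalType) :=
  SmoothAtlas {
  chart : Type;
  dom : chart -> set M;
  coord : chart -> M -> 'rV[R]_n;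
  param : chart -> 'rV[R]_n -> M;
  dom_open : forall i, open (dom i);
  codom_open : forall i, open (coord i @` dom i);
  dom_cover : forall p, exists i, dom i p;
  coordK : forall i p, dom i p -> param i (coord i p) = p;
  coord_continuous : forall i p, dom i p -> {for p, continuous (coord i)};
  param_continuous : forall i x,
    (coord i @` dom i) x -> {for x, continuous (param i)};
  transition_smooth : forall i j (a : 'I_n),
    smooth_on (coord i @` (dom i `&` dom j))
              (fun x => coord j (param i x) ord0 a) }.

Arguments chart {R n M} _.
Arguments dom {R n M} _ _.
Arguments coord {R n M} _ _ _.
Arguments param {R n M} _ _ _.
Arguments dom_cover {R n M} _ _.

(* A metric is given by its matrix of coefficients g_ab in each chart, subject
   to the transformation law of covariant 2-tensors. *)
Record riemannian_metric (R : realType) (n : nat) (M : ptopologicalType)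
    (A : smooth_atlas R n M) := RiemannianMetric {
  coeff : chart A -> 'rV[R]_n -> 'M[R]_n;
  coeff_smooth : forall i a b,
    smooth_on (coord A i @` dom A i) (fun x => coeff i x a b);
  coeff_sym : forall i p, dom A i p ->
    (coeff i (coord A i p))^T = coeff i (coord A i p);
  coeff_posdef : forall i p (v : 'rV[R]_n), dom A i p -> v != 0 ->
    0 < (v *m coeff i (coord A i p) *m v^T) ord0 ord0;
  coeff_transition : forall i j p a b, dom A i p -> dom A j p ->
    coeff i (coord A i p) a b =
    \sum_c \sum_d
      partial a (fun x => coord A j (param A i x) ord0 c) (coord A i p) *
      partial b (fun x => coord A j (param A i x) ord0 d) (coord A i p) *
      coeff j (coord A j p) c d }.

Arguments coeff {R n M A} _ _ _.

(* Coordinate expressions, for a metric [G] on (an open subset of) R^n.  Tensor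
   fields are covariant and given by their components; a vector field is
   identified with the 1-form dual to it, so that the gradient of v is dv. *)
Section LocalGeometry.
Context {R : realType} {n : nat}.
Implicit Types (G : 'rV[R]_n -> 'M[R]_n) (v : 'rV[R]_n -> R)
  (w : 'I_n -> 'rV[R]_n -> R) (T : 'I_n -> 'I_n -> 'rV[R]_n -> R).

(* g^{ij} *)
Definition cometric G (i j : 'I_n) : 'rV[R]_n -> R := fun x => invmx (G x) i j.

(* Gamma^k_{ij} *)
Definition christoffel G (k i j : 'I_n) : 'rV[R]_n -> R := fun x =>
  2^-1 * \sum_l cometric G k l x *
    (partial i (fun y => G y j l) x + partial j (fun y => G y i l) x
     - partial l (fun y => G y i j) x).

(* R^l_{kij}, with R(d_i, d_j) d_k = R^l_{kij} d_l *)
Definition riemann G (l k i j : 'I_n) : 'rV[R]_n -> R := fun x =>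
  partial i (christoffel G l j k) x - partial j (christoffel G l i k) x
  + \sum_s (christoffel G l i s x * christoffel G s j k x
            - christoffel G l j s x * christoffel G s i k x).

Definition ricci G (j k : 'I_n) : 'rV[R]_n -> R :=
  fun x => \sum_i riemann G i k i j x.

Definition scalar_curv G : 'rV[R]_n -> R :=
  fun x => \sum_i \sum_j cometric G i j x * ricci G i j x.

Definition differential v : 'I_n -> 'rV[R]_n -> R := fun i => partial i v.

(* (nabla w)_{ij} = nabla_i w_j *)
Definition nabla G w (i j : 'I_n) : 'rV[R]_n -> R := fun x =>
  partial i (w j) x - \sum_k christoffel G k i j x * w k x.

Definition divergence G w : 'rV[R]_n -> R :=
  fun x => \sum_i \sum_j cometric G i j x * nabla G w i j x.

Definition laplacian G v : 'rV[R]_n -> R := divergence G (differential v).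

(* (T w)_i = T_{ij} g^{jk} w_k *)
Definition contract G T w (i : 'I_n) : 'rV[R]_n -> R :=
  fun x => \sum_j \sum_k T i j x * cometric G j k x * w k x.

Definition sqnorm1 G w : 'rV[R]_n -> R :=
  fun x => \sum_i \sum_j cometric G i j x * w i x * w j x.

Definition sqnorm2 G T : 'rV[R]_n -> R := fun x =>
  \sum_i \sum_j \sum_k \sum_l
    cometric G i k x * cometric G j l x * T i j x * T k l x.

Let N : R := n%:R.

Definition paneitz_a : R := ((N - 2) ^+ 2 + 4) / (2 * (N - 1) * (N - 2)).
Definition paneitz_b : R := 4 / (N - 2).

Definition local_Q G : 'rV[R]_n -> R := fun x =>
  - (2 * (N - 1))^-1 * laplacian G (scalar_curv G) x
  + (N ^+ 3 - 4 * N ^+ 2 + 16 * N - 16) / (8 * (N - 1) ^+ 2 * (N - 2) ^+ 2)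
    * scalar_curv G x ^+ 2
  - 2 / (N - 2) ^+ 2 * sqnorm2 G (ricci G) x.

Definition local_paneitz G v : 'rV[R]_n -> R := fun x =>
  laplacian G (laplacian G v) x
  - divergence G
      (contract G
        (fun i j y => paneitz_a * scalar_curv G y * G y i j - paneitz_b * ricci G i j y)
        (differential v)) x
  + (N - 4) / 2 * local_Q G x * v x.

End LocalGeometry.

(* The Borel sigma-algebra. *)
Notation borel M := (g_sigma_algebraType (@open M)).

Section Manifold.
Context {R : realType} {n : nat} {M : ptopologicalType}.
Context {A : smooth_atlas R n M}.
Implicit Types (g : riemannian_metric A) (u : M -> R).

Definition smooth_fun (A : smooth_atlas R n M) u : Prop :=
  forall i, smooth_on (coord A i @` dom A i) (u \o param A i).

Definition chart_at (p : M) : chart A := projT1 (cid (dom_cover A p)).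

(* The function on M equal at p to the value at p of the coordinate expression
   [F i] in a chart [i] around p.  It is used for expressions that do not
   depend on the chart, so the choice made by [chart_at] is immaterial. *)
Definition from_charts (F : chart A -> 'rV[R]_n -> R) : M -> R :=
  fun p => F (chart_at p) (coord A (chart_at p) p).

Definition scalar_curvature g : M -> R :=
  from_charts (fun i => scalar_curv (coeff g i)).

Definition Q_curvature g : M -> R :=
  from_charts (fun i => local_Q (coeff g i)).

Definition paneitz g u : M -> R :=
  from_charts (fun i => local_paneitz (coeff g i) (u \o param A i)).

Definition grad_sqnorm g u : M -> R :=
  from_charts (fun i =>
    sqnorm1 (coeff g i) (differential (u \o param A i))).

Definition hess_sqnorm g u : M -> R :=
  from_charts (fun i =>
    sqnorm2 (coeff g i) (nabla (coeff g i) (differential (u \o param A i)))).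

(* [mu] is the Riemannian volume measure dV_g: in each chart it is
   sqrt (det g) dx.  By the Riesz representation theorem this characterizes
   [mu] on a compact Hausdorff manifold.  The equality is between extended
   reals: it includes the finiteness of the left-hand side. *)
Definition is_volume_measure g (mu : {measure set (borel M) -> \bar R}) : Prop :=
  forall (i : chart A) (f : M -> R) (K : set M),
    continuous f -> compact K -> K `<=` dom A i ->
    (forall p, ~ K p -> f p = 0) ->
    (\int[mu]_p (f p)%:E =
     (integral_rV
        (patch (fun=> 0) (coord A i @` dom A i)
           (fun x => f (param A i x) * Num.sqrt (\det (coeff g i x)))))%:E)%E.

Definition H2_norm g (mu : {measure set (borel M) -> \bar R}) u : R :=
  Num.sqrt ((\int[mu]_p (`|u p| ^+ 2)) + (\int[mu]_p grad_sqnorm g u p)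
            + (\int[mu]_p hess_sqnorm g u p)).

Definition coercive g (mu : {measure set (borel M) -> \bar R})
    (P : (M -> R) -> (M -> R)) : Prop :=
  exists2 C : R, 0 < C & forall u, smooth_fun A u ->
    C * H2_norm g mu u ^+ 2 <= \int[mu]_p (u p * P u p).

End Manifold.

(* Main.v *)
(* Write b = 4/(N-2) and a = a_N.  Bochner's formula turns the term - b Ric(du,du) of
   u P u into b |Hess u|^2 - b (Lap u)^2 up to a divergence, so that, up to a divergence,
     u P u = (1 - b) (Lap u)^2 + b |Hess u|^2 + a R |du|^2 + (N-4)/2 Q u^2.
   For N >= 6 one has 0 < b <= 1 and a > 0, and R and Q are bounded below by positive
   constants by compactness, so the integral of u P u controls the H^2 norm.
   The integral of a divergence vanishes: cut the 1-form off by a C^1 partition of unity,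
   and use sqrt(det g) div w = sum_i d_i (sqrt(det g) w^i) in each chart. *)
From HB Require Import structures.
Require Import Defs.
From mathcomp Require Import all_boot all_order all_algebra.
From mathcomp Require Import all_classical all_reals all_analysis.
From mathcomp Require Import measurable_realfun finmap perm ring lra.

Set Implicit Arguments.
Unset Strict Implicit.
Unset Printing Implicit Defensive.

Import Order.TTheory GRing.Theory Num.Theory.
Import numFieldNormedType.Exports.

Local Open Scope classical_set_scope.
Local Open Scope ring_scope.

(** * Calculus on open subsets of R^n *)

(** The obstacle is invariance. Every geometric quantity is a coordinate formula evaluated in an
    arbitrarily chosen chart around each point, so its continuity and its integral are out of reach
    until the formula is known to agree in all charts. The connection is transported through its
    uniqueness, and the law for the Ricci tensor is read off from Bochner's formula, which thus
    serves twice: for invariance and for trading Ric(du,du). A second constraint is that dV is known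
    only through its integrals of continuous functions supported in a compact subset of one chart.
    Finite volume and the divergence theorem both pass through the partition of unity, and the
    derivatives of the cutoffs cancel because the cutoffs sum to 1. The dimension enters sharply
    through 1 - b = (N-6)/(N-2), the coefficient of (Lap u)^2. The coercivity constant is the least
    of the coefficients of |Hess u|^2, |du|^2 and u^2, once R and Q are replaced by their minima. *)

Lemma cvg_sumr (R : realType) (T I : Type) (F : set_system T) {FF : Filter F}
    (r : seq I) (f : I -> T -> R) (a : I -> R) :
  (forall i, f i @ F --> a i) ->
  (fun x => \sum_(i <- r) f i x) @ F --> \sum_(i <- r) a i.
Proof.
move=> fa; elim: r => [|i r IH].
  by rewrite big_nil; under eq_fun do rewrite big_nil; exact: cvg_cst.
by rewrite big_cons; under eq_fun do rewrite big_cons; exact: cvgD.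
Qed.

Section PartialDerivatives.
Context {R : realType} {n : nat}.
Notation V := 'rV[R]_n.
Implicit Types (O : set V) (f g : V -> R) (x v : V) (i j : 'I_n).

Lemma open_near_eq O f g x : open O -> O x -> (forall y, O y -> f y = g y) ->
  \forall y \near x, f y = g y.
Proof. by move=> oO Ox fg; apply: filterS fg _; exact: open_nbhs_nbhs. Qed.

Lemma partial_ext O f g i x : open O -> (forall y, O y -> f y = g y) -> O x ->
  partial i f x = partial i g x.
Proof. by move=> oO fg Ox; apply: near_eq_derive; exact: open_near_eq oO Ox fg. Qed.

Lemma Ck_on_ext k O f g : open O -> (forall y, O y -> f y = g y) ->
  Ck_on k O f -> Ck_on k O g.
Proof.
move=> oO; elim: k f g => [|k IH] f g fg /= Hf.
  move=> x Ox; rewrite /prop_for /continuous_at -(fg _ Ox).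
  exact: cvg_trans (near_eq_cvg (open_near_eq oO Ox fg)) (Hf x Ox).
move=> i; have [df pf] := Hf i; split.
  by move=> x Ox; apply: near_eq_derivable (df x Ox); exact: open_near_eq oO Ox fg.
by apply: IH pf => y Oy; exact: partial_ext oO fg Oy.
Qed.

Lemma Ck_on_sub k O O' f : O' `<=` O -> Ck_on k O f -> Ck_on k O' f.
Proof.
move=> OO'; elim: k f => [|k IH] f /= Hf; first by move=> x /OO'; exact: Hf.
move=> i; have [df pf] := Hf i; split; first by move=> x /OO'; exact: df.
exact: IH.
Qed.

Lemma is_derive_line f (x v : V) (s : R) : derivable f (x + s *: v) v ->
  is_derive s 1 (fun t => f (x + t *: v)) ('D_v f (x + s *: v)).
Proof.
move=> df.
have E : (fun h : R => h^-1 *: (((fun t : R => f (x + t *: v)) \o shift s) (h *: (1 : R))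
    - f (x + s *: v))) = (fun h : R => h^-1 *: ((f \o shift (x + s *: v)) (h *: v) - f (x + s *: v))).
  apply/funext => h /=; congr (_ *: (f _ - _)).
  by rewrite [h *: _]mulr1 scalerDl addrCA.
split; first by rewrite /derivable E.
by rewrite /derive E.
Qed.

(** The bound on s by absolute values covers both signs of c, so that callers need not orient the
    segment. *)
Lemma MVT_line f x v (c : R) :
  (forall s : R, `|s| <= `|c| -> derivable f (x + s *: v) v) ->
  exists2 s : R, `|s| <= `|c| & f (x + c *: v) - f x = c * 'D_v f (x + s *: v).
Proof.
move=> df.
pose g t := f (x + t *: v).
have dg (s : R) : `|s| <= `|c| -> is_derive s (1 : R) g ('D_v f (x + s *: v)).
  by move=> sc; apply: is_derive_line; exact: df.
have cg a b : (forall s, a <= s <= b -> `|s| <= `|c|) -> {within `[a, b], continuous g}.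
  move=> H; apply: derivable_within_continuous => s; rewrite in_itv/= => /H /dg.
  by case.
have -> : f x = g 0 by rewrite /g scale0r addr0.
case: (leP 0 c) => c0.
  have bd s : 0 <= s <= c -> `|s| <= `|c| by move=> /andP[s0 sc]; rewrite !ger0_norm.
  have [s|s sI E] := MVT_segment (f := g) (df := fun s => 'D_v f (x + s *: v)) c0 _ (cg _ _ bd).
    by rewrite in_itv/= => /andP[/ltW s0 /ltW sc]; apply: dg; apply: bd; rewrite s0.
  exists s; first by apply: bd; rewrite in_itv/= in sI.
  by rewrite E subr0 mulrC.
have c0' := ltW c0.
have bd s : c <= s <= 0 -> `|s| <= `|c|.
  by move=> /andP[s0 sc]; rewrite !ler0_norm // lerN2.
have [s|s sI E] := MVT_segment (f := g) (df := fun s => 'D_v f (x + s *: v)) c0' _ (cg _ _ bd).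
  by rewrite in_itv/= => /andP[/ltW s0 /ltW sc]; apply: dg; apply: bd; rewrite s0.
exists s; first by apply: bd; rewrite in_itv/= in sI.
by rewrite -[LHS]opprB E sub0r; ring.
Qed.

Lemma normr_rV_le (h : V) j : `|h ord0 j| <= `|h|.
Proof.
rewrite [leRHS]/Num.Def.normr/= mx_normrE.
exact: (le_bigmax _ (fun ij : 'I_1 * 'I_n => `|h ij.1 ij.2|) (ord0, j)).
Qed.

Lemma rV_norm_le (h : V) (c : R) : 0 <= c -> (forall j, `|h ord0 j| <= c) -> `|h| <= c.
Proof.
move=> c0 H; rewrite [leLHS]/Num.Def.normr/= mx_normrE.
by apply: bigmax_le => // -[i j] _ /=; rewrite ord1; exact: H.
Qed.

Lemma delta_rV_norm i : `|delta_mx ord0 i : V| <= 1.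
Proof.
apply: rV_norm_le => // j; rewrite mxE eqxx /=.
by case: eqP => _; rewrite ?normr1 ?normr0.
Qed.

(** Walk from x to x + h along the axes, one coordinate at a time. The mean value theorem turns each
    step into a partial derivative at a nearby point, and continuity compares it with its value at
    x. *)
Lemma Ck1_differentiable O f x : open O -> Ck_on 1 O f -> O x -> differentiable f x.
Proof.
move=> oO Hf Ox.
pose L (h : V) : R := \sum_i h ord0 i * partial i f x.
have linL : linear L.
  move=> a u w; rewrite /L /= scaler_sumr -big_split /=; apply: eq_bigr => i _.
  by rewrite !mxE /GRing.scale /=; ring.
pose HL := GRing.isLinear.Build _ _ _ _ _ linL.
pose LL : {linear V -> R} := HB.pack L HL.
have cL : continuous LL.
  move=> y; rewrite /LL /= /L.
  by apply: (@cvg_sumr _ _ _ (nbhs y)) => i; apply: cvgMr_tmp; exact: coord_continuous.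
(* It suffices that L is a first-order approximation: [diff_unique] then identifies the differential
   with it. *)
suff : f \o shift x = cst (f x) + LL +o_ (nbhs (0 : V)) id.
  by move=> H; apply/diff_locallyP; have E := diff_unique cL H; rewrite E.
apply/eqaddoP => _/posnumP[e].
have nO : nbhs x O by exact: open_nbhs_nbhs.
(* There are n steps, each with error at most d |h|; the added 1 keeps the denominator positive when
   n = 0. *)
pose d := e%:num / (n%:R + 1).
have d0 : 0 < d by rewrite divr_gt0 // ltr_wpDl.
have nP i : \forall y \near x, `|partial i f x - partial i f y| < d.
  have [_ /(_ x Ox)] := Hf i.
  by move=> /cvgrPdist_lt /(_ _ d0).
have /nbhs_ballP[r /= r0 Hr] : \forall y \near x, O y /\ forall i, `|partial i f x - partial i f y| < d.
  have nQ := filter_forall (@nbhs_filter _ x) nP.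
  exact: (filterI nO nQ).
apply/nbhs_ballP; exists r => //= h.
rewrite -ball_normE /= sub0r normrN => hr.
(* [p k] has the first k coordinates of x + h and the remaining ones of x. In the max norm these
   points, and the segments joining consecutive ones, stay within |h| of x. *)
pose p k : V := x + \row_j (if (j < k)%N then h ord0 j else 0).
have pn : p n = h + x.
  by rewrite addrC /p; congr (_ + _); apply/rowP => j; rewrite mxE ltn_ord.
have p0 : p 0%N = x by rewrite /p -[RHS]addr0; congr (_ + _); apply/rowP => j; rewrite !mxE.
have step (k : 'I_n) : `|f (p k.+1) - f (p k) - h ord0 k * partial k f x| <= d * `|h|.
  have pS : p k.+1 = p k + h ord0 k *: delta_mx ord0 k.
    rewrite /p -addrA; congr (_ + _); apply/rowP => j; rewrite !mxE eqxx /= ltnS.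
    rewrite leq_eqVlt -val_eqE /=.
    by case: eqP => [/val_inj ->|_] /=; rewrite ?ltnn ?mulr1 ?add0r ?mulr0 ?addr0.
  have inb s : `|s| <= `|h ord0 k| -> ball x r (p k + s *: delta_mx ord0 k).
    move=> sh; rewrite -ball_normE /=; apply: le_lt_trans hr.
    apply: rV_norm_le => // j; rewrite !mxE eqxx /= -val_eqE /=.
    rewrite opprD opprD addrA addrA subrr sub0r.
    have [jk|kj|jk] := ltngtP (j : nat) k; rewrite /= ?(val_inj jk).
    - by rewrite mulr0 subr0 normrN normr_rV_le.
    - by rewrite mulr0 subr0 normrN normr0.
    - by rewrite oppr0 sub0r mulr1 normrN (le_trans sh) // normr_rV_le.
  have [s sh E] : exists2 s, `|s| <= `|h ord0 k| & f (p k + h ord0 k *: delta_mx ord0 k) - f (p k) = h ord0 k * 'D_(delta_mx ord0 k) f (p k + s *: delta_mx ord0 k).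
    apply: MVT_line => s sh; have [df _] := Hf k; apply: df.
    by have [] := Hr _ (inb _ sh).
  rewrite pS E -mulrBr normrM mulrC ler_pM //; last exact: normr_rV_le.
  have [_ /(_ k)] := Hr _ (inb _ sh).
  by rewrite distrC => /ltW.
suff : `|f (h + x) - (f x + L h)| <= e%:num * `|h| by [].
rewrite opprD addrA -pn -{1}p0.
have -> : f (p n) - f (p 0%N) = \sum_(k < n) (f (p k.+1) - f (p k)).
  by rewrite -(big_mkord predT (fun k => f (p k.+1) - f (p k))) telescope_sumr.
rewrite /L -sumrB (le_trans (ler_norm_sum _ _ _)) //.
apply: le_trans (ler_sum _ (fun k _ => step k)) _.
rewrite sumr_const card_ord -[_ *+ n]mulr_natl /d.
rewrite mulrA ler_wpM2r ?normr_ge0 // mulrCA ger_pMr //.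
by rewrite ler_pdivrMr ?ltr_wpDl // mul1r lerDl.
Qed.

Lemma Ck1_continuous O f x : open O -> Ck_on 1 O f -> O x -> {for x, continuous f}.
Proof. by move=> oO Hf Ox; exact/differentiable_continuous/(Ck1_differentiable oO Hf Ox). Qed.

(** [Ck_on] asks for continuity of the derivatives of order k only, and for mere existence of the
    lower ones; descending one order therefore rests on the continuity of C^1 functions. *)
Lemma Ck_on_pred k O f : open O -> Ck_on k.+1 O f -> Ck_on k O f.
Proof.
move=> oO; elim: k f => [|k IH] f Hf.
  by move=> x Ox; exact: Ck1_continuous oO Hf Ox.
by move=> i; have [df pf] := Hf i; split => //; exact: IH.
Qed.

Lemma partial_derivable O k f i x : Ck_on k.+1 O f -> O x -> derivable f x (delta_mx ord0 i).
Proof. by move=> Hf Ox; have [df _] := Hf i; exact: df. Qed.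

Lemma Ck_on_partial O k f i : Ck_on k.+1 O f -> Ck_on k O (partial i f).
Proof. by move=> Hf; have [] := Hf i. Qed.

Lemma Ck_on_cst k O (c : R) : Ck_on k O (fun=> c).
Proof.
elim: k c => [|k IH] c /=; first by move=> x _; exact: cst_continuous.
move=> i; split; first by move=> x _; exact: derivable_cst.
suff -> : partial i (fun=> c) = (fun=> 0) :> (V -> R) by exact: IH.
by apply/funext => x; rewrite /partial (derive_cst c).
Qed.

Lemma Ck_onD k O f g : open O -> Ck_on k O f -> Ck_on k O g -> Ck_on k O (fun x => f x + g x).
Proof.
move=> oO; elim: k f g => [|k IH] f g Hf Hg.
  by move=> x Ox; apply: continuousD; [exact: Hf|exact: Hg].
move=> i; have [df pf] := Hf i; have [dg pg] := Hg i; split.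
  by move=> x Ox; apply: derivableD; [exact: df|exact: dg].
apply: Ck_on_ext oO _ (IH _ _ pf pg) => x Ox.
by rewrite /partial; apply/esym/deriveD; [exact: df|exact: dg].
Qed.

Lemma Ck_onM k O f g : open O -> Ck_on k O f -> Ck_on k O g -> Ck_on k O (fun x => f x * g x).
Proof.
move=> oO; elim: k f g => [|k IH] f g Hf Hg.
  by move=> x Ox; apply: continuousM; [exact: Hf|exact: Hg].
have Hf' := Ck_on_pred oO Hf; have Hg' := Ck_on_pred oO Hg.
move=> i; have [df pf] := Hf i; have [dg pg] := Hg i; split.
  by move=> x Ox; apply: derivableM; [exact: df|exact: dg].
apply: Ck_on_ext oO _ (Ck_onD oO (IH _ _ Hf' pg) (IH _ _ Hg' pf)) => x Ox.
by rewrite /partial; apply/esym/deriveM; [exact: df|exact: dg].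
Qed.

Lemma Ck_onN k O f : open O -> Ck_on k O f -> Ck_on k O (fun x => - f x).
Proof.
move=> oO Hf; apply: Ck_on_ext oO _ (Ck_onM oO (Ck_on_cst k O (-1)) Hf) => x _.
by rewrite mulN1r.
Qed.

Lemma Ck_onB k O f g : open O -> Ck_on k O f -> Ck_on k O g -> Ck_on k O (fun x => f x - g x).
Proof. by move=> oO Hf Hg; apply: Ck_onD => //; exact: Ck_onN. Qed.

Lemma Ck_on_sum k O (I : Type) (r : seq I) (F : I -> V -> R) : open O ->
  (forall l : I, Ck_on k O (F l)) -> Ck_on k O (fun x => \sum_(i <- r) F i x).
Proof.
move=> oO HF; elim: r => [|l r IH].
  by under eq_fun do rewrite big_nil; exact: Ck_on_cst.
by under eq_fun do rewrite big_cons; exact: Ck_onD.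
Qed.

Lemma Ck_on_prod k O (I : Type) (r : seq I) (F : I -> V -> R) : open O ->
  (forall l : I, Ck_on k O (F l)) -> Ck_on k O (fun x => \prod_(i <- r) F i x).
Proof.
move=> oO HF; elim: r => [|l r IH].
  by under eq_fun do rewrite big_nil; exact: Ck_on_cst.
by under eq_fun do rewrite big_cons; exact: Ck_onM.
Qed.

(** The derivative of 1/f is - f' (1/f)^2, which involves 1/f only one order lower. *)
Lemma Ck_onV k O f : open O -> (forall x, O x -> f x != 0) ->
  Ck_on k O f -> Ck_on k O (fun x => (f x)^-1).
Proof.
move=> oO f0; elim: k => [|k IH] Hf.
  by move=> x Ox; exact: (cvgV (f0 x Ox) (Hf x Ox)).
have Hf' := IH (Ck_on_pred oO Hf).
move=> i; have [df pf] := Hf i; split.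
  by move=> x Ox; exact: (derivableV (f0 x Ox) (df x Ox)).
apply: Ck_on_ext oO _ (Ck_onM oO (Ck_onN oO pf) (Ck_onM oO Hf' Hf')) => x Ox.
rewrite /partial; apply/esym; rewrite (deriveV (f0 x Ox) (df x Ox)).
by rewrite /GRing.scale /= expr2 invfM; ring.
Qed.

End PartialDerivatives.

(** * Chain rule in several variables *)

Section ChainRule.
Context {R : realType} {n m : nat}.
Implicit Types (f : 'rV[R]_m -> R) (phi : 'rV[R]_n -> 'rV[R]_m).

Lemma is_derive_of_line (g : 'rV[R]_n -> R) x v (d : R) :
  is_derive (0 : R) (1 : R) (fun t => g (x + t *: v)) d -> is_derive x v g d.
Proof.
move=> [dg <-].
have E : (fun h : R => h^-1 *: (((fun t : R => g (x + t *: v)) \o shift 0) (h *: (1 : R))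
    - g (x + 0 *: v))) = (fun h : R => h^-1 *: ((g \o shift x) (h *: v) - g x)).
  apply/funext => h /=; rewrite scale0r addr0; congr (_ *: (g _ - g _)).
    by rewrite [h%:A]mulr1 addrC.
  by rewrite addr0.
split; first by move: dg; rewrite /derivable E.
by rewrite /derive E.
Qed.

(** On the line through x in direction v, phi becomes a curve, which is differentiable as soon as
    its components are derivable along v; only f has to be differentiable in the full sense. *)
Lemma is_derive_comp f phi x v :
  (forall k, derivable (fun y => phi y ord0 k) x v) -> differentiable f (phi x) ->
  is_derive x v (f \o phi)
    (\sum_k 'D_v (fun y => phi y ord0 k) x * partial k f (phi x)).
Proof.
move=> dphi df; apply: is_derive_of_line.
pose c (t : R) := phi (x + t *: v).
have c0 : c 0 = phi x by rewrite /c scale0r addr0.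
have dck k : is_derive (0 : R) (1 : R) (fun t => c t ord0 k) ('D_v (fun y => phi y ord0 k) x).
  have := @is_derive_line _ _ (fun y => phi y ord0 k) x v 0.
  by rewrite scale0r addr0; apply.
have dc : derivable c 0 1.
  by apply/derivable_mxP => i j; rewrite ord1; case: (dck j).
have dc' := dc; move/derivable1_diffP in dc'.
have dfc : differentiable f (c 0) by rewrite c0.
have Efc : (fun t => (f \o phi) (x + t *: v)) = f \o c by [].
rewrite Efc; split.
  by apply/derivable1_diffP; exact: differentiable_comp.
rewrite deriveE; last exact: differentiable_comp.
rewrite diff_comp //= -[X in 'd f _ X]deriveE // (derive_mx dc).
rewrite [X in 'd f _ X]row_sum_delta linear_sum c0; apply: eq_bigr => k _.
rewrite linearZ /= mxE -(deriveE _ df); congr (_ * _).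
by case: (dck k).
Qed.

End ChainRule.

Section ChainRuleCk.
Context {R : realType} {n m : nat}.
Implicit Types (f : 'rV[R]_m -> R) (phi : 'rV[R]_n -> 'rV[R]_m).

Lemma partial_comp (O' : set 'rV[R]_m) f phi x i : open O' -> Ck_on 1 O' f -> O' (phi x) ->
  (forall k, derivable (fun y => phi y ord0 k) x (delta_mx ord0 i)) ->
  partial i (f \o phi) x = \sum_k partial i (fun y => phi y ord0 k) x * partial k f (phi x).
Proof.
move=> oO' Hf O'x dphi; apply: derive_val.
by apply: is_derive_comp => //; exact: Ck1_differentiable Hf O'x.
Qed.

Lemma Ck_on_comp k (O : set 'rV[R]_n) (O' : set 'rV[R]_m) f phi :
  open O -> open O' -> (forall x, O x -> O' (phi x)) ->
  (forall l, Ck_on k O (fun y => phi y ord0 l)) -> (forall x, O x -> {for x, continuous phi}) ->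
  Ck_on k O' f -> Ck_on k O (f \o phi).
Proof.
move=> oO oO' OO' Hphi cphi; elim: k f Hphi => [|k IH] f Hphi Hf.
  by move=> x Ox; apply: continuous_comp; [exact: cphi|apply: Hf; exact: OO'].
have Hf1 : Ck_on 1 O' f.
  by elim: (k) Hf => // l IHl Hl; apply: IHl; exact: Ck_on_pred Hl.
have dphi x i l : O x -> derivable (fun y => phi y ord0 l) x (delta_mx ord0 i).
  by move=> Ox; have [+ _] := Hphi l i; exact.
move=> i; split.
  move=> x Ox; apply: ex_derive; apply: is_derive_comp => [l|]; first exact: dphi.
  by apply: Ck1_differentiable Hf1 _ => //; exact: OO'.
apply: (@Ck_on_ext _ _ _ _ (fun x => \sum_l partial i (fun y => phi y ord0 l) x * partial l f (phi x))) => //.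
  by move=> x Ox; rewrite (partial_comp oO' Hf1) // => [|l]; [exact: OO'|exact: dphi].
apply: Ck_on_sum => // l; apply: Ck_onM => //; first by have [] := Hphi l i.
apply: (IH (partial l f)) => [l'|]; first exact: Ck_on_pred.
by have [] := Hf l.
Qed.

End ChainRuleCk.

(** * Equality of mixed partial derivatives *)

Section Schwarz.
Context {R : realType} {n : nat}.
Notation V := 'rV[R]_n.

(** The mean value theorem is applied in direction i to y |-> f (y + r e_j) - f y, then in direction
    j to the partial derivative. The square of side r lies within 2r of x, so the ball of radius 3r
    contains it with room to spare. *)
Lemma second_difference (O : set V) (f : V -> R) (x : V) (i j : 'I_n) (r : R) :
  Ck_on 2 O f -> 0 < r -> ball x (r + r + r) `<=` O ->
  exists2 y, ball x (r + r + r) y &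
   f (x + r *: delta_mx ord0 i + r *: delta_mx ord0 j) - f (x + r *: delta_mx ord0 i)
   - f (x + r *: delta_mx ord0 j) + f x = r * r * partial j (partial i f) y.
Proof.
move=> Hf r0 rO.
set ei := delta_mx ord0 i : V; set ej := delta_mx ord0 j : V.
have rr : `|r| = r by rewrite gtr0_norm.
have inb s t : `|s| <= r -> `|t| <= r -> ball x (r + r + r) (x + s *: ei + t *: ej).
  move=> sr tr; rewrite -ball_normE /= !opprD !addrA subrr sub0r -opprD normrN.
  apply: (@le_lt_trans _ _ (r + r)); last by rewrite ltrDl.
  rewrite (le_trans (ler_normD _ _)) // lerD // normrZ -[r]mulr1 ler_pM ?normr_ge0 //;
    exact: delta_rV_norm.
have inb0 s : `|s| <= r -> ball x (r + r + r) (x + s *: ei).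
  by move=> sr; have := inb s 0 sr; rewrite normr0 scale0r addr0; apply; exact: ltW.
have Hi y : ball x (r + r + r) y -> derivable f y ei.
  by move=> /rO; exact: partial_derivable Hf.
have Hij y : ball x (r + r + r) y -> derivable (partial i f) y ej.
  by move=> /rO; apply: (partial_derivable (k := 0)); exact: Ck_on_partial.
pose g y := f (y + r *: ej) - f y.
have dsh y : derivable f (y + r *: ej) ei ->
    is_derive y ei (fun z => f (z + r *: ej)) (partial i f (y + r *: ej)).
  move=> d; have E : (fun h : R => h^-1 *: (((fun z => f (z + r *: ej)) \o shift y) (h *: ei) -
       f (y + r *: ej))) = (fun h : R => h^-1 *: ((f \o shift (y + r *: ej)) (h *: ei) - f (y + r *: ej))).
    by apply/funext => h /=; rewrite addrA.
  by split; [rewrite /derivable E|rewrite /partial /derive E].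
have dg y : derivable f (y + r *: ej) ei -> derivable f y ei ->
   is_derive y ei g (partial i f (y + r *: ej) - partial i f y).
  move=> d1 d2; have H1 := dsh y d1; have H2 := derivableP d2.
  exact: is_deriveB.
have [s sr E] : exists2 s : R, `|s| <= `|r| & g (x + r *: ei) - g x = r * 'D_ei g (x + s *: ei).
  apply: MVT_line => s; rewrite rr => sr; apply: ex_derive; apply: dg; apply: Hi.
    by apply: inb => //; rewrite rr.
  exact: inb0.
rewrite rr in sr.
have E2 : 'D_ei g (x + s *: ei) = partial i f (x + s *: ei + r *: ej) - partial i f (x + s *: ei).
  apply: derive_val; apply: dg; apply: Hi; last exact: inb0.
  by apply: inb => //; rewrite rr.
have [t tr E3] : exists2 t : R, `|t| <= `|r| & partial i f (x + s *: ei + r *: ej) - partial i f (x + s *: ei) = r * 'D_ej (partial i f) (x + s *: ei + t *: ej).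
  by apply: MVT_line => t; rewrite rr => tr; apply: Hij; exact: inb.
rewrite rr in tr.
exists (x + s *: ei + t *: ej); first exact: inb.
by rewrite -mulrA -E3 -E2 -E /g; ring.
Qed.

(** The second difference is symmetric in i and j, so the two mixed derivatives take the same value
    at two points near x, possibly distinct; continuity at x brings both values as close as desired
    to those at x. *)
Lemma partialC (O : set V) (f : V -> R) (x : V) (i j : 'I_n) :
  open O -> Ck_on 2 O f -> O x -> partial i (partial j f) x = partial j (partial i f) x.
Proof.
move=> oO Hf Ox.
have cont a b : {for x, continuous (partial a (partial b f))}.
  by apply: (Ck_on_partial a (Ck_on_partial b Hf)).
apply/eqP; rewrite -subr_eq0 -normr_le0; apply/ler_addgt0Pl => e e0; rewrite addr0.
have nO : nbhs x O by exact: open_nbhs_nbhs.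
have e2 : 0 < e / 2 by rewrite divr_gt0.
have n1 : \forall y \near x, `|partial i (partial j f) x - partial i (partial j f) y| < e / 2.
  by have /cvgrPdist_lt /(_ _ e2) := cont i j.
have n2 : \forall y \near x, `|partial j (partial i f) x - partial j (partial i f) y| < e / 2.
  by have /cvgrPdist_lt /(_ _ e2) := cont j i.
have [r /= r0 Hr] := (nbhs_ballP _ _).1 (filterI nO (filterI n1 n2)).
pose q := r / 3.
have q0 : 0 < q by rewrite divr_gt0.
have qr : q + q + q = r by rewrite /q; field.
have qO : ball x (q + q + q) `<=` O by rewrite qr => y /Hr [].
have [y By Ey] := second_difference i j Hf q0 qO.
have [z Bz Ez] := second_difference j i Hf q0 qO.
have : q * q * partial j (partial i f) y = q * q * partial i (partial j f) z.
  apply: (etrans (esym Ey)); apply: (etrans _ Ez).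
  have ex := addrAC x (q *: delta_mx ord0 i) (q *: delta_mx ord0 j).
  by rewrite ex; congr (_ + _); exact: addrAC.
have qq : q * q != 0 by rewrite mulf_neq0 // gt_eqF.
move/(mulfI qq) => Eyz.
rewrite qr in By Bz.
have [_ [_ /ltW Hy]] := Hr _ By; have [_ [/ltW Hz _]] := Hr _ Bz.
rewrite Eyz in Hy.
rewrite distrC in Hy.
apply: le_trans (ler_distD (partial i (partial j f) z) _ _) _.
by rewrite [e]splitr; exact: (lerD Hz Hy).
Qed.

End Schwarz.

Section PartialRules.
Context {R : realType} {n : nat} (O : set 'rV[R]_n) (oO : open O).
Implicit Types (f g : 'rV[R]_n -> R) (x : 'rV[R]_n) (i : 'I_n).

Lemma partialD f g i x : Ck_on 1 O f -> Ck_on 1 O g -> O x ->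
  partial i (fun y => f y + g y) x = partial i f x + partial i g x.
Proof. by move=> Hf Hg Ox; rewrite /partial; apply: deriveD; exact: partial_derivable Ox. Qed.

Lemma partialM f g i x : Ck_on 1 O f -> Ck_on 1 O g -> O x ->
  partial i (fun y => f y * g y) x = partial i f x * g x + f x * partial i g x.
Proof.
move=> Hf Hg Ox; rewrite /partial [LHS]deriveM; try exact: partial_derivable Ox.
by rewrite /GRing.scale /= addrC; congr (_ + _); exact: mulrC.
Qed.

Lemma partial_cst (c : R) i x : partial i (fun=> c) x = 0.
Proof. exact: derive_cst. Qed.

Lemma partialZ (c : R) f i x : Ck_on 1 O f -> O x ->
  partial i (fun y => c * f y) x = c * partial i f x.
Proof.
by move=> Hf Ox; rewrite (partialM i (Ck_on_cst 1 O c) Hf Ox) partial_cst mul0r add0r.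
Qed.

Lemma partial_sum (I : Type) (r : seq I) (F : I -> 'rV[R]_n -> R) i x :
  (forall l, Ck_on 1 O (F l)) -> O x ->
  partial i (fun y => \sum_(l <- r) F l y) x = \sum_(l <- r) partial i (F l) x.
Proof.
move=> HF Ox; elim: r => [|l r IH].
  by rewrite big_nil; under eq_fun do rewrite big_nil; exact: partial_cst.
rewrite big_cons; under eq_fun do rewrite big_cons.
by rewrite partialD // ?IH //; exact: Ck_on_sum.
Qed.

Lemma smooth_on_partial f i : smooth_on O f -> smooth_on O (partial i f).
Proof. by move=> Hf k; exact: Ck_on_partial (Hf k.+1). Qed.

Lemma smooth_on_cst (c : R) : smooth_on O (fun=> c).
Proof. by move=> k; exact: Ck_on_cst. Qed.

Lemma smooth_onD f g : smooth_on O f -> smooth_on O g -> smooth_on O (fun x => f x + g x).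
Proof. by move=> Hf Hg k; exact: Ck_onD. Qed.

Lemma smooth_onM f g : smooth_on O f -> smooth_on O g -> smooth_on O (fun x => f x * g x).
Proof. by move=> Hf Hg k; exact: Ck_onM. Qed.

Lemma smooth_onB f g : smooth_on O f -> smooth_on O g -> smooth_on O (fun x => f x - g x).
Proof. by move=> Hf Hg k; exact: Ck_onB. Qed.

Lemma smooth_on_sum (I : Type) (r : seq I) (F : I -> 'rV[R]_n -> R) :
  (forall l, smooth_on O (F l)) -> smooth_on O (fun x => \sum_(l <- r) F l x).
Proof. by move=> HF k; apply: Ck_on_sum => // l; exact: HF. Qed.

End PartialRules.

(** * Matrix-valued functions: products, inverse and determinant *)

Section MatrixFields.
Context {R : realType} {n : nat} (O : set 'rV[R]_n) (oO : open O).
Implicit Types (x : 'rV[R]_n) (i : 'I_n).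

Definition Ck_mx (k : nat) p q (T : 'rV[R]_n -> 'M[R]_(p, q)) :=
  forall a b, Ck_on k O (fun x => T x a b).

Definition partial_mx p q i (T : 'rV[R]_n -> 'M[R]_(p, q)) x : 'M[R]_(p, q) :=
  \matrix_(a, b) partial i (fun y => T y a b) x.

Lemma Ck_mx_ext k p q (T S : 'rV[R]_n -> 'M[R]_(p, q)) :
  (forall y, O y -> T y = S y) -> Ck_mx k T -> Ck_mx k S.
Proof. by move=> TS HT a b; apply: Ck_on_ext oO _ (HT a b) => y Oy; rewrite TS. Qed.

Lemma partial_mx_ext p q i (T S : 'rV[R]_n -> 'M[R]_(p, q)) x :
  (forall y, O y -> T y = S y) -> O x -> partial_mx i T x = partial_mx i S x.
Proof.
move=> TS Ox; apply/matrixP => a b; rewrite !mxE.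
by apply: partial_ext oO _ Ox => y Oy; rewrite TS.
Qed.

Lemma Ck_mx_mul k p q r (T : 'rV[R]_n -> 'M[R]_(p, q)) (S : 'rV[R]_n -> 'M[R]_(q, r)) :
  Ck_mx k T -> Ck_mx k S -> Ck_mx k (fun x => T x *m S x).
Proof.
move=> HT HS a b; under eq_fun do rewrite mxE.
by apply: Ck_on_sum => // c; apply: Ck_onM.
Qed.

Lemma Ck_mxD k p q (T S : 'rV[R]_n -> 'M[R]_(p, q)) :
  Ck_mx k T -> Ck_mx k S -> Ck_mx k (fun x => T x + S x).
Proof. by move=> HT HS a b; under eq_fun do rewrite mxE; exact: Ck_onD. Qed.

Lemma Ck_mx_tr k p q (T : 'rV[R]_n -> 'M[R]_(p, q)) :
  Ck_mx k T -> Ck_mx k (fun x => (T x)^T).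
Proof. by move=> HT a b; under eq_fun do rewrite mxE; exact: HT. Qed.

Lemma Ck_partial_mx k p q i (T : 'rV[R]_n -> 'M[R]_(p, q)) :
  Ck_mx k.+1 T -> Ck_mx k (partial_mx i T).
Proof. by move=> HT a b; under eq_fun do rewrite mxE; exact: Ck_on_partial. Qed.

Lemma Ck_det k p (T : 'rV[R]_n -> 'M[R]_p) : Ck_mx k T -> Ck_on k O (fun x => \det (T x)).
Proof.
move=> HT; rewrite /determinant; apply: Ck_on_sum => // s; apply: Ck_onM => //.
  exact: Ck_on_cst.
by apply: Ck_on_prod => // c; exact: HT.
Qed.

(** Cramer's rule: each entry of the inverse is a cofactor divided by the determinant. *)
Lemma Ck_invmx k p (T : 'rV[R]_n -> 'M[R]_p) : (forall x, O x -> T x \in unitmx) ->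
  Ck_mx k T -> Ck_mx k (fun x => invmx (T x)).
Proof.
move=> uT HT a b.
apply: (@Ck_on_ext _ _ _ _ (fun x => (\det (T x))^-1 * cofactor (T x) b a)) => //.
  by move=> y Oy; rewrite /invmx uT // !mxE.
apply: Ck_onM => //.
  apply: Ck_onV => //; last exact: Ck_det.
  by move=> x /uT; rewrite unitmxE unitfE.
apply: Ck_onM => //; first exact: Ck_on_cst.
apply: Ck_det => c d; under eq_fun do rewrite !mxE; exact: HT.
Qed.

Lemma partial_mxM p q r i (T : 'rV[R]_n -> 'M[R]_(p, q)) (S : 'rV[R]_n -> 'M[R]_(q, r)) x :
  Ck_mx 1 T -> Ck_mx 1 S -> O x ->
  partial_mx i (fun y => T y *m S y) x = partial_mx i T x *m S x + T x *m partial_mx i S x.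
Proof.
move=> HT HS Ox; apply/matrixP => a b; rewrite !mxE -big_split /=.
under [X in partial i X]eq_fun do rewrite mxE.
rewrite (partial_sum oO) // => [|c]; last exact: Ck_onM.
by apply: eq_bigr => c _; rewrite !mxE (partialM i (HT a c) (HS c b) Ox).
Qed.

Lemma partial_mxD p q i (T S : 'rV[R]_n -> 'M[R]_(p, q)) x :
  Ck_mx 1 T -> Ck_mx 1 S -> O x ->
  partial_mx i (fun y => T y + S y) x = partial_mx i T x + partial_mx i S x.
Proof.
move=> HT HS Ox; apply/matrixP => a b; rewrite !mxE.
under [X in partial i X]eq_fun do rewrite mxE.
by rewrite (partialD i (HT a b) (HS a b) Ox).
Qed.

Lemma partial_mx_tr p q i (T : 'rV[R]_n -> 'M[R]_(p, q)) x :
  partial_mx i (fun y => (T y)^T) x = (partial_mx i T x)^T.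
Proof. by apply/matrixP => a b; rewrite !mxE; under [X in partial i X]eq_fun do rewrite mxE. Qed.

Lemma partial_mx_cst p q i (T : 'M[R]_(p, q)) x : partial_mx i (fun=> T) x = 0.
Proof. by apply/matrixP => a b; rewrite !mxE partial_cst. Qed.

(** Differentiate the identity T^-1 T = 1. *)
Lemma partial_mx_inv p i (T : 'rV[R]_n -> 'M[R]_p) x : (forall y, O y -> T y \in unitmx) ->
  Ck_mx 1 T -> O x ->
  partial_mx i (fun y => invmx (T y)) x = - (invmx (T x) *m partial_mx i T x *m invmx (T x)).
Proof.
move=> uT HT Ox.
have HA := Ck_invmx uT HT.
have := partial_mxM i HA HT Ox.
rewrite (@partial_mx_ext _ _ _ _ (fun=> 1%:M)) //; last by move=> y /uT uy; rewrite mulVmx.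
rewrite partial_mx_cst => /esym/eqP; rewrite addr_eq0 => /eqP E.
by rewrite -mulNmx -E -mulmxA mulmxV ?mulmx1 //; exact: uT.
Qed.

(* Jacobi's formula, by multilinearity of the determinant in the rows. *)
Lemma partial_det p i (T : 'rV[R]_n -> 'M[R]_p) x : Ck_mx 1 T -> O x ->
  partial i (fun y => \det (T y)) x = \tr (\adj (T x) *m partial_mx i T x).
Proof.
move=> HT Ox.
have HP (s : 'S_p) (r : seq 'I_p) : Ck_on 1 O (fun y => \prod_(c <- r) T y c (s c)).
  by apply: Ck_on_prod => // c; exact: HT.
have DP (s : 'S_p) (r : seq 'I_p) : uniq r ->
    partial i (fun y => \prod_(c <- r) T y c (s c)) x =
    \sum_(d <- r) \prod_(c <- r) (if c == d then partial i (fun y => T y c (s c)) x else T x c (s c)).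
  elim: r => [_|c r IH /= /andP[cr ur]].
    by rewrite big_nil; under [X in partial i X]eq_fun do rewrite big_nil; exact: partial_cst.
  under [X in partial i X]eq_fun do rewrite big_cons.
  rewrite (partialM i (HT _ _) (HP _ _) Ox) IH // big_cons big_cons eqxx; congr (_ * _ + _).
    apply: eq_big_seq => d dr; case: eqP => // dc; by rewrite -dc dr in cr.
  rewrite big_distrr /=; apply: eq_big_seq => d dr; rewrite big_cons.
  by case: eqP => // cd; rewrite cd dr in cr.
rewrite /determinant (partial_sum oO) //; last first.
  by move=> s; apply: Ck_onM => //; exact: Ck_on_cst.
under eq_bigr => s _ do rewrite (partialZ _ _ (HP s _) Ox) DP ?index_enum_uniq // mulr_sumr.
rewrite exchange_big /=.
have -> : \tr (\adj (T x) *m partial_mx i T x) =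
    \sum_d \det (\matrix_(a, b) (if a == d then partial i (fun y => T y a b) x else T x a b)).
  rewrite mxtrace_mulC /mxtrace; apply: eq_bigr => d _.
  rewrite mxE (expand_det_row _ d); apply: eq_bigr => b _; rewrite !mxE eqxx; congr (_ * _).
  rewrite /cofactor; congr (_ * \det _); apply/matrixP => a c; rewrite !mxE.
  by rewrite eq_sym (negbTE (neq_lift _ _)).
apply: eq_bigr => d _; apply: eq_bigr => s _; congr (_ * _).
by apply: eq_bigr => c _; rewrite mxE.
Qed.

End MatrixFields.

(** * Levi-Civita connection and curvature in coordinates *)

Section MatrixForm.
Context {R : realType} {n : nat}.
Implicit Types (G : 'rV[R]_n -> 'M[R]_n) (w z : 'I_n -> 'rV[R]_n -> R)
  (T S : 'I_n -> 'I_n -> 'rV[R]_n -> R) (x : 'rV[R]_n) (i j k l : 'I_n).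

Definition form_col w x : 'cV[R]_n := \col_i w i x.
Definition tensor_mx T x : 'M[R]_n := \matrix_(i, j) T i j x.
(** The connection 1-form evaluated on d_i. On vector fields nabla_i is d_i plus this matrix; on
    1-forms it is d_i minus its transpose. *)
Definition connection_mx G i x : 'M[R]_n := \matrix_(k, j) christoffel G k i j x.
(** The Christoffel symbols of the first kind, Gamma_{l,ij}. *)
Definition lowered_connection_mx G i x : 'M[R]_n := \matrix_(l, j)
  (2^-1 * (partial i (fun y => G y j l) x + partial j (fun y => G y i l) x
     - partial l (fun y => G y i j) x)).
Definition raise G w x : 'cV[R]_n := invmx (G x) *m form_col w x.
Definition inner1 G w z : 'rV[R]_n -> R :=
  fun x => \sum_i \sum_j cometric G i j x * w i x * z j x.
Definition inner2 G T S : 'rV[R]_n -> R := fun x =>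
  \sum_i \sum_j \sum_k \sum_l
    cometric G i k x * cometric G j l x * T i j x * S k l x.

Lemma connection_mxE G i x :
  connection_mx G i x = invmx (G x) *m lowered_connection_mx G i x.
Proof.
apply/matrixP => k j; rewrite !mxE /christoffel mulr_sumr; apply: eq_bigr => l _.
by rewrite !mxE /cometric mulrCA.
Qed.

Lemma inner1E G w z x :
  inner1 G w z x = ((form_col w x)^T *m invmx (G x) *m form_col z x) 0 0.
Proof.
rewrite mxE /inner1 exchange_big; apply: eq_bigr => j _ /=; rewrite mxE mulr_suml.
by apply: eq_bigr => i _; rewrite !mxE /cometric; ring.
Qed.

Lemma inner2E G T S x :
  inner2 G T S x =
  \tr (invmx (G x) *m tensor_mx S x *m (invmx (G x))^T *m (tensor_mx T x)^T).
Proof.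
rewrite /mxtrace /inner2; apply: eq_bigr => i _; rewrite mxE; apply: eq_bigr => j _.
rewrite !mxE mulr_suml exchange_big; apply: eq_bigr => l _ /=.
rewrite !mxE !mulr_suml; apply: eq_bigr => k _; rewrite !mxE /cometric; ring.
Qed.

Lemma contractE G T w x : form_col (Defs.contract G T w) x = tensor_mx T x *m raise G w x.
Proof.
apply/matrixP => i c; rewrite !mxE /Defs.contract; apply: eq_bigr => j _.
by rewrite !mxE mulr_sumr; apply: eq_bigr => k _; rewrite !mxE /cometric mulrA.
Qed.

Lemma nablaE G w i j x :
  nabla G w i j x = (partial_mx i (form_col w) x - (connection_mx G i x)^T *m form_col w x) j 0.
Proof.
rewrite !mxE /nabla; congr (_ - _).
  by congr (partial i _ x); apply/funext => y; rewrite mxE.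
by apply: eq_bigr => k _; rewrite !mxE.
Qed.

(** The curvature is the commutator of the operators d_i + Gamma_i and d_j + Gamma_j acting on
    vector fields. *)
Lemma riemannE G l k i j x :
  riemann G l k i j x =
  (partial_mx i (connection_mx G j) x - partial_mx j (connection_mx G i) x
   + connection_mx G i x *m connection_mx G j x
   - connection_mx G j x *m connection_mx G i x) l k.
Proof.
have E a b : partial_mx a (connection_mx G b) x l k = partial a (christoffel G l b k) x.
  by rewrite mxE; congr (partial a _ x); apply/funext => y; rewrite mxE.
have D (P Q S U : 'M[R]_n) : (P - Q + S - U) l k = P l k - Q l k + S l k - U l k.
  by rewrite !mxE.
apply: (etrans _ (esym (D _ _ _ _))).
rewrite /riemann sumrB addrA.
congr (_ - _ + _ - _); [exact: esym (E i j)|exact: esym (E j i)| |];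
  by rewrite mxE; apply: eq_bigr => s _; congr (_ * _); rewrite [RHS]mxE.
Qed.

End MatrixForm.

Section LeviCivita.
Context {R : realType} {n : nat} (O : set 'rV[R]_n) (oO : open O).
Variable G : 'rV[R]_n -> 'M[R]_n.
Hypothesis HG : forall k, Ck_mx O k G.
Hypothesis symG : forall x, O x -> (G x)^T = G x.
Hypothesis uG : forall x, O x -> G x \in unitmx.
Implicit Types (w z : 'I_n -> 'rV[R]_n -> R)
  (T : 'I_n -> 'I_n -> 'rV[R]_n -> R) (x : 'rV[R]_n) (i j l : 'I_n).

Let A x := invmx (G x).
Let Gam := connection_mx G.

Lemma Ck_cometric k : Ck_mx O k A.
Proof. exact: Ck_invmx. Qed.

Lemma sym_cometric x : O x -> (A x)^T = A x.
Proof. by move=> Ox; rewrite /A trmx_inv symG. Qed.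

Lemma Ck_lowered_connection k i : Ck_mx O k (lowered_connection_mx G i).
Proof.
move=> a b; under eq_fun do rewrite mxE.
apply: Ck_onM => //; first exact: Ck_on_cst.
by apply: Ck_onB => //; [apply: Ck_onD => //|]; apply: Ck_on_partial; exact: HG.
Qed.

Lemma Ck_connection k i : Ck_mx O k (Gam i).
Proof.
apply: (@Ck_mx_ext _ _ _ oO _ _ _ (fun x => A x *m lowered_connection_mx G i x)).
  by move=> y _; rewrite /Gam connection_mxE.
by apply: Ck_mx_mul => //; [exact: Ck_cometric|exact: Ck_lowered_connection].
Qed.

Lemma Gsym_partial i a b x : O x ->
  partial i (fun y => G y a b) x = partial i (fun y => G y b a) x.
Proof.
by move=> Ox; apply: partial_ext oO _ Ox => y Oy; rewrite -{1}(symG Oy) mxE.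
Qed.

Lemma lowered_connection_torsion i j l x : O x ->
  lowered_connection_mx G i x l j = lowered_connection_mx G j x l i.
Proof. by move=> Ox; rewrite !mxE (Gsym_partial l i j Ox) [partial i _ x + _]addrC. Qed.

Lemma lowered_connection_compat i x : O x ->
  lowered_connection_mx G i x + (lowered_connection_mx G i x)^T = partial_mx i G x.
Proof.
move=> Ox; apply/matrixP => a b; rewrite !mxE.
by rewrite (Gsym_partial i b a Ox); lra.
Qed.

Lemma connection_torsion i j l x : O x -> Gam i x l j = Gam j x l i.
Proof.
move=> Ox; rewrite /Gam !connection_mxE !mxE; apply: eq_bigr => k _.
by rewrite lowered_connection_torsion.
Qed.

Lemma lowered_connectionE i x : O x -> lowered_connection_mx G i x = G x *m Gam i x.
Proof. by move=> Ox; rewrite /Gam connection_mxE mulKVmx //; exact: uG. Qed.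

Lemma metric_compat i x : O x ->
  partial_mx i G x = G x *m Gam i x + (Gam i x)^T *m G x.
Proof.
by move=> Ox; rewrite -lowered_connection_compat // lowered_connectionE // trmx_mul symG.
Qed.

Lemma cometric_compat i x : O x ->
  partial_mx i A x = - (Gam i x *m A x) - A x *m (Gam i x)^T.
Proof.
move=> Ox; rewrite (partial_mx_inv oO i uG) // metric_compat // /A.
rewrite mulmxDr mulmxDl !mulmxA mulVmx ?uG // mul1mx opprD.
by congr (_ - _); rewrite -!mulmxA mulmxV ?uG // mulmx1.
Qed.

Lemma Ck_form_col k w : (forall i, Ck_on k O (w i)) -> Ck_mx O k (form_col w).
Proof. by move=> Hw a b; under eq_fun do rewrite mxE; exact: Hw. Qed.

Lemma Ck_raise k w : (forall i, Ck_on k O (w i)) -> Ck_mx O k (raise G w).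
Proof. by move=> Hw; apply: Ck_mx_mul => //; [exact: Ck_cometric|exact: Ck_form_col]. Qed.

(** The cometric is parallel, so raising an index commutes with covariant differentiation. This lets
    the divergence and Bochner computations be done on vector fields. *)
Lemma covariant_derivative_raise i w x : (forall j, Ck_on 1 O (w j)) -> O x ->
  partial_mx i (raise G w) x + Gam i x *m raise G w x
  = A x *m (\col_j nabla G w i j x).
Proof.
move=> Hw Ox.
have -> : \col_j nabla G w i j x = partial_mx i (form_col w) x - (Gam i x)^T *m form_col w x.
  by apply/matrixP => j c; rewrite ord1 !mxE nablaE !mxE.
rewrite {1}/raise (partial_mxM oO i (Ck_cometric 1) (Ck_form_col Hw) Ox) cometric_compat //.
rewrite /raise -/(A x) mulmxBr mulmxBl mulNmx !mulmxA.
move: (Gam i x *m A x *m form_col w x) (A x *m (Gam i x)^T *m form_col w x)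
  (A x *m partial_mx i (form_col w) x) => X Y Z.
by apply/matrixP => a b; rewrite !mxE; ring.
Qed.

Lemma divergence_raise w x : (forall j, Ck_on 1 O (w j)) -> O x ->
  divergence G w x =
  \sum_i (partial_mx i (raise G w) x + Gam i x *m raise G w x) i 0.
Proof.
move=> Hw Ox; apply: eq_bigr => i _; rewrite covariant_derivative_raise //.
by rewrite mxE; apply: eq_bigr => j _; rewrite !mxE.
Qed.

End LeviCivita.

Definition paneitz_tensor (R : realType) (n : nat) (G : 'rV[R]_n -> 'M[R]_n) (i j : 'I_n)
    (x : 'rV[R]_n) : R :=
  @paneitz_a R n * scalar_curv G x * G x i j - @paneitz_b R n * ricci G i j x.

(** * The contracted Ricci identity and Bochner's formula *)

Section Bochner.
Context {R : realType} {n : nat} (O : set 'rV[R]_n) (oO : open O).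
Variable G : 'rV[R]_n -> 'M[R]_n.
Hypothesis HG : forall k, Ck_mx O k G.
Hypothesis symG : forall x, O x -> (G x)^T = G x.
Hypothesis uG : forall x, O x -> G x \in unitmx.
Implicit Types (w z : 'I_n -> 'rV[R]_n -> R)
  (T : 'I_n -> 'I_n -> 'rV[R]_n -> R) (x : 'rV[R]_n) (i j l : 'I_n).

Let A x := invmx (G x).
Let Gam := connection_mx G.
Let CA k := Ck_cometric oO HG uG k.
Let CGam k i := Ck_connection oO HG uG k i.

Lemma Ck_nabla k w i j : (forall a, Ck_on k.+1 O (w a)) -> Ck_on k O (nabla G w i j).
Proof.
move=> Hw; apply: Ck_onB => //; first exact: Ck_on_partial.
apply: Ck_on_sum => // l; apply: Ck_onM => //; last by apply: Ck_on_pred.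
by have := CGam k i l j; under eq_fun do rewrite mxE.
Qed.

Lemma Ck_inner1 k w z : (forall i, Ck_on k O (w i)) -> (forall i, Ck_on k O (z i)) ->
  Ck_on k O (inner1 G w z).
Proof.
move=> Hw Hz; apply: Ck_on_sum => // i; apply: Ck_on_sum => // j.
by do 2?apply: Ck_onM => //; exact: CA.
Qed.

Lemma Ck_inner2 k T (S : 'I_n -> 'I_n -> 'rV[R]_n -> R) :
  (forall i j, Ck_on k O (T i j)) -> (forall i j, Ck_on k O (S i j)) ->
  Ck_on k O (inner2 G T S).
Proof.
move=> HT HS; do 4!(apply: Ck_on_sum => // ?).
by do 3?apply: Ck_onM => //; exact: CA.
Qed.

Lemma Ck_contract k T w i : (forall i j, Ck_on k O (T i j)) -> (forall i, Ck_on k O (w i)) ->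
  Ck_on k O (Defs.contract G T w i).
Proof.
move=> HT Hw; do 2!(apply: Ck_on_sum => // ?).
by do 2?apply: Ck_onM => //; exact: CA.
Qed.

Lemma Ck_divergence k w : (forall a, Ck_on k.+1 O (w a)) -> Ck_on k O (divergence G w).
Proof.
move=> Hw; do 2!(apply: Ck_on_sum => // ?).
by apply: Ck_onM => //; [exact: CA|exact: Ck_nabla].
Qed.

Lemma smooth_laplacian u : smooth_on O u -> smooth_on O (laplacian G u).
Proof. by move=> Hu k; apply: Ck_divergence => a; exact: (Ck_on_partial a (Hu k.+2)). Qed.

Lemma smooth_christoffel l i j : smooth_on O (christoffel G l i j).
Proof. by move=> k; have := CGam k i l j; under eq_fun do rewrite mxE. Qed.

Lemma smooth_ricci i j : smooth_on O (ricci G i j).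
Proof.
apply: smooth_on_sum => // l; apply: smooth_onD => //.
  by apply: smooth_onB => //; apply: smooth_on_partial; exact: smooth_christoffel.
apply: smooth_on_sum => // s.
by apply: smooth_onB => //; apply: smooth_onM => //; exact: smooth_christoffel.
Qed.

Lemma smooth_scalar_curv : smooth_on O (scalar_curv G).
Proof.
move=> k; do 2!(apply: Ck_on_sum => // ?).
by apply: Ck_onM => //; [exact: CA|exact: smooth_ricci].
Qed.

Lemma smooth_paneitz_tensor i j : smooth_on O (paneitz_tensor G i j).
Proof.
have sc := smooth_scalar_curv; have sr := smooth_ricci i j.
move=> k; apply: Ck_onB => //; apply: Ck_onM => //; try exact: Ck_on_cst.
- by apply: Ck_onM => //; exact: Ck_on_cst.
- exact: HG.
Qed.

(** Second derivatives commute, and the Christoffel terms are symmetric because the torsion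
    vanishes. *)
Lemma hessian_sym u i j x : smooth_on O u -> O x ->
  nabla G (differential u) i j x = nabla G (differential u) j i x.
Proof.
move=> Hu Ox; rewrite /nabla (partialC i j oO (Hu 2%N) Ox); congr (_ - _).
apply: eq_bigr => l _; congr (_ * _).
by have := connection_torsion oO symG i j l Ox; rewrite !mxE; apply.
Qed.

(** With a = d_i d_l V, b = d_i V and c = d_l V, this is the commutation of nabla_i and nabla_l on
    the vector field V. The term Gamma_l (nabla_i V), which belongs to nabla_l nabla_i V, has been
    moved to the left. *)
Lemma covariant_commutator_algebra (a b c v : 'cV[R]_n) (Gi Gl dGi dGl : 'M[R]_n) i :
  (a + dGl *m v + Gl *m b) i 0 + (Gi *m (c + Gl *m v)) i 0 - (Gl *m (b + Gi *m v)) i 0 =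
  (a + dGi *m v + Gi *m c) i 0 + ((dGl - dGi + Gi *m Gl - Gl *m Gi) *m v) i 0.
Proof.
rewrite !mulmxDr !mulmxDl !mulNmx !mulmxA.
move: (dGl *m v) (Gl *m b) (Gi *m c) (Gi *m Gl *m v) (Gl *m Gi *m v) (dGi *m v) => p q r s t u.
by rewrite !mxE; ring.
Qed.

(* The contracted Ricci identity nabla_i nabla_l V^i - nabla_l nabla_i V^i = Ric_lj V^j,
   with B^i_k = nabla_k V^i. *)
Lemma trace_covariant_commutator (V : 'rV[R]_n -> 'cV[R]_n) l x :
  (forall k, Ck_mx O k V) -> O x ->
  let B := fun y => \matrix_(i, k) (partial_mx k V y + Gam k y *m V y) i 0 in
  \sum_i (partial_mx i B x + Gam i x *m B x - B x *m Gam i x) i l =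
  partial l (fun y => \sum_i (partial_mx i V y + Gam i y *m V y) i 0) x
  + \sum_j ricci G l j x * V x j 0.
Proof.
move=> HV Ox B.
have HC k i : Ck_mx O k (fun y => partial_mx i V y + Gam i y *m V y).
  apply: Ck_mxD => //; first exact: Ck_partial_mx.
  by apply: Ck_mx_mul => //; exact: CGam.
have dC i k : partial_mx i (fun y => partial_mx k V y + Gam k y *m V y) x =
    partial_mx i (partial_mx k V) x + partial_mx i (Gam k) x *m V x
    + Gam k x *m partial_mx i V x.
  rewrite (@partial_mxD _ _ O) //; last by apply: Ck_mx_mul => //; exact: CGam.
    by rewrite (partial_mxM oO) ?addrA //; exact: CGam.
  exact: Ck_partial_mx.
have dB i : partial_mx i B x i l = (partial_mx i (fun y => partial_mx l V y + Gam l y *m V y) x) i 0.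
  by rewrite !mxE; congr (partial i _ x); apply/funext => y; rewrite mxE.
have GB i : (Gam i x *m B x) i l = (Gam i x *m (partial_mx l V x + Gam l x *m V x)) i 0.
  by rewrite !mxE; apply: eq_bigr => k _; congr (_ * _); rewrite [LHS]mxE.
(* Vanishing torsion replaces Gamma^k_{il} by Gamma^k_{li}, turning the sum into a trace of a
   product with the single matrix Gamma_l, whose factors may be exchanged. *)
have BG : \sum_i (B x *m Gam i x) i l =
    \sum_i (Gam l x *m (partial_mx i V x + Gam i x *m V x)) i 0.
  transitivity (\tr (B x *m Gam l x)).
    apply: eq_bigr => i _; rewrite !mxE; apply: eq_bigr => k _; congr (_ * _).
    exact: (connection_torsion oO).
  rewrite mxtrace_mulC; apply: eq_bigr => i _; rewrite !mxE; apply: eq_bigr => k _.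
  by congr (_ * _); rewrite [LHS]mxE.
have E1 i : (partial_mx i B x + Gam i x *m B x - B x *m Gam i x) i l =
   partial_mx i B x i l + (Gam i x *m B x) i l - (B x *m Gam i x) i l.
  by rewrite mxE [X in X + _]mxE [X in _ + X]mxE.
under eq_bigr do rewrite E1.
rewrite sumrB BG.
have -> : partial l (fun y => \sum_i (partial_mx i V y + Gam i y *m V y) i 0) x =
   \sum_i partial_mx l (fun y => partial_mx i V y + Gam i y *m V y) x i 0.
  rewrite (partial_sum oO) // => [|i]; last exact: HC.
  by apply: eq_bigr => i _; rewrite [RHS]mxE.
have ric : \sum_j ricci G l j x * V x j 0 = \sum_i ((partial_mx i (Gam l) x - partial_mx l (Gam i) x
   + Gam i x *m Gam l x - Gam l x *m Gam i x) *m V x) i 0.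
  rewrite /ricci; under eq_bigr do rewrite mulr_suml.
  rewrite exchange_big; apply: eq_bigr => i _ /=; rewrite mxE; apply: eq_bigr => j _.
  by rewrite riemannE.
rewrite ric -!sumrB -!big_split /=; apply: eq_bigr => i _.
rewrite dB GB !dC.
have -> : partial_mx l (partial_mx i V) x = partial_mx i (partial_mx l V) x.
  have E2 c d a b : partial_mx c (partial_mx d V) x a b = partial c (partial d (fun y => V y a b)) x.
    by rewrite mxE; congr (partial c _ x); apply/funext => y; rewrite mxE.
  apply/matrixP => a b.
  have H := partialC l i oO (HV 2%N a b) Ox.
  exact: (etrans (E2 l i a b) (etrans H (esym (E2 i l a b)))).
exact: covariant_commutator_algebra.
Qed.

(** Leibniz rule nabla_i (B z) = (nabla_i B) z + B (nabla_i z) for a field of endomorphisms B, whose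
    covariant derivative is dB plus a commutator with Gamma_i. *)
Lemma covariant_product_algebra (B dB Gi : 'M[R]_n) (z dz : 'cV[R]_n) i :
  (dB *m z + B *m dz + Gi *m (B *m z)) i 0 =
  ((dB + Gi *m B - B *m Gi) *m z) i 0 + (B *m (dz + Gi *m z)) i 0.
Proof.
rewrite !mulmxDr !mulmxDl !mulNmx !mulmxA.
move: (dB *m z) (B *m dz) (Gi *m B *m z) (B *m Gi *m z) => p q r s.
by rewrite !mxE; ring.
Qed.

(* Bochner's formula in bilinear form.  Since every term but the Ricci term is visibly
   invariant under coordinate changes, it also shows that Ric is a tensor, without
   any symmetry of Ric or transformation law for the curvature. *)
Lemma bochner u h x : smooth_on O u -> smooth_on O h -> O x ->
  inner1 G (differential h) (Defs.contract G (ricci G) (differential u)) x =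
  divergence G (Defs.contract G (nabla G (differential u)) (differential h)) x
  - inner2 G (nabla G (differential u)) (nabla G (differential h)) x
  - inner1 G (differential h) (differential (laplacian G u)) x.
Proof.
move=> Hu Hh Ox.
have Hdu k i : Ck_on k O (differential u i) by exact: (Ck_on_partial i (Hu k.+1)).
have Hdh k i : Ck_on k O (differential h i) by exact: (Ck_on_partial i (Hh k.+1)).
pose V := raise G (differential u); pose Z := raise G (differential h).
have CV k : Ck_mx O k V by apply: (Ck_raise oO) => // i; exact: Hdu.
have CZ k : Ck_mx O k Z by apply: (Ck_raise oO) => // i; exact: Hdh.
pose B y := \matrix_(i, k) (partial_mx k V y + Gam k y *m V y) i 0.
pose C y := \matrix_(i, k) (partial_mx k Z y + Gam k y *m Z y) i 0.
have CB k : Ck_mx O k B.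
  move=> a b; under eq_fun do rewrite mxE.
  apply: Ck_mxD => //; first exact: Ck_partial_mx.
  by apply: Ck_mx_mul => //; exact: CGam.
have BE y : O y -> B y = A y *m (tensor_mx (nabla G (differential u)) y)^T.
  move=> Oy; apply/matrixP => i k; rewrite [LHS]mxE (covariant_derivative_raise oO) // !mxE.
  by apply: eq_bigr => j _; rewrite !mxE.
have CE y : O y -> C y = A y *m (tensor_mx (nabla G (differential h)) y)^T.
  move=> Oy; apply/matrixP => i k; rewrite [LHS]mxE (covariant_derivative_raise oO) // !mxE.
  by apply: eq_bigr => j _; rewrite !mxE.
have symN v y : smooth_on O v -> O y ->
    (tensor_mx (nabla G (differential v)) y)^T = tensor_mx (nabla G (differential v)) y.
  by move=> Hv Oy; apply/matrixP => i j; rewrite !mxE hessian_sym.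
have RE y : O y -> raise G (Defs.contract G (nabla G (differential u)) (differential h)) y = B y *m Z y.
  by move=> Oy; rewrite {1}/raise contractE BE // symN // mulmxA.
have LE y : O y -> laplacian G u y = \sum_i (partial_mx i V y + Gam i y *m V y) i 0.
  by move=> Oy; rewrite /laplacian (divergence_raise oO).
have innerZ (z : 'I_n -> 'rV[R]_n -> R) : inner1 G (differential h) z x = \sum_l z l x * Z x l 0.
  rewrite inner1E -[(form_col _ x)^T *m _]trmxK trmx_mul trmxK.
  rewrite (sym_cometric symG) // mxE; apply: eq_bigr => l _; by rewrite !mxE mulrC.
have -> : inner2 G (nabla G (differential u)) (nabla G (differential h)) x = \tr (B x *m C x).
  rewrite inner2E BE // CE // !symN // (sym_cometric symG) //.
  by rewrite -mulmxA [LHS]mxtrace_mulC.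
rewrite (divergence_raise oO) //; last first.
  by move=> j; apply: Ck_contract => // a b; exact: Ck_nabla.
have dR i : partial_mx i (raise G (Defs.contract G (nabla G (differential u)) (differential h))) x
    = partial_mx i B x *m Z x + B x *m partial_mx i Z x.
  by rewrite (partial_mx_ext oO i RE Ox) (partial_mxM oO).
(* B and C are the two Hessians with one index raised. In div(BZ) = (div B) Z + tr(BC), the trace
   cancels the inner product of the Hessians, and the Ricci identity expands div B. *)
have key i : (partial_mx i (raise G (Defs.contract G (nabla G (differential u)) (differential h))) x
     + Gam i x *m raise G (Defs.contract G (nabla G (differential u)) (differential h)) x) i 0 =
   ((partial_mx i B x + Gam i x *m B x - B x *m Gam i x) *m Z x) i 0 + (B x *m C x) i i.
  have -> : (B x *m C x) i i = (B x *m (partial_mx i Z x + Gam i x *m Z x)) i 0.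
    by rewrite !mxE; apply: eq_bigr => k _; congr (_ * _); rewrite [LHS]mxE.
  rewrite dR RE //; exact: covariant_product_algebra.
under eq_bigr do rewrite key.
rewrite big_split /= -[X in _ = _ + X - _ - _]/(\tr (B x *m C x)) addrK !innerZ.
under [X in _ = X - _]eq_bigr do rewrite mxE.
rewrite exchange_big /=.
under [X in _ = X - _]eq_bigr do rewrite -mulr_suml (trace_covariant_commutator _ CV Ox) mulrDl.
rewrite big_split /=.
have -> : \sum_l differential (laplacian G u) l x * Z x l 0 =
    \sum_l partial l (fun y => \sum_i (partial_mx i V y + Gam i y *m V y) i 0) x * Z x l 0.
  by apply: eq_bigr => l _; rewrite /differential (partial_ext l oO LE Ox).
rewrite addrAC subrr add0r; apply: eq_bigr => l _; congr (_ * _).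
have := contractE G (ricci G) (differential u) x => /matrixP/(_ l 0).
rewrite mxE => ->; rewrite mxE; apply: eq_bigr => j _; by rewrite mxE.
Qed.

End Bochner.

(** * Change of coordinates *)

Lemma continuous_rV (R : realType) (T : topologicalType) n (phi : T -> 'rV[R]_n) (x : T) :
  (forall l, {for x, continuous (fun y => phi y ord0 l)}) -> {for x, continuous phi}.
Proof.
move=> H; apply/cvgrPdist_le => e e0.
have nP l : \forall y \near x, `|phi x ord0 l - phi y ord0 l| <= e.
  by have /cvgrPdist_le/(_ _ e0) := H l.
have nQ := filter_forall (@nbhs_filter _ x) nP.
apply: filterS nQ => y Hy; apply: rV_norm_le; first exact: ltW.
by move=> j; rewrite !mxE; exact: Hy.
Qed.

Lemma is_derive_coord (R : realType) n (x v : 'rV[R]_n) (k : 'I_n) :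
  is_derive x v (fun y : 'rV[R]_n => y ord0 k) (v ord0 k).
Proof.
apply: is_derive_of_line.
have -> : (fun t : R => (x + t *: v) ord0 k) = (cst (x ord0 k) + (fun t => t * v ord0 k)).
  by apply/funext => t; rewrite !mxE.
have H : is_derive (0 : R) (1 : R) (fun t : R => t * v ord0 k) (v ord0 k).
  split; first exact/derivableM/derivable_cst/derivable_id.
  by rewrite deriveMr ?derive_id //; rewrite /GRing.scale /= mulr1.
by apply: is_derive_eq; rewrite add0r.
Qed.

Lemma partial_coord (R : realType) n (i k : 'I_n) (x : 'rV[R]_n) :
  partial i (fun y : 'rV[R]_n => y ord0 k) x = (k == i)%:R.
Proof.
have [_] := is_derive_coord x (delta_mx ord0 i) k.
by rewrite mxE eqxx.
Qed.

Lemma smooth_on_coord (R : realType) n (O : set 'rV[R]_n) (k : 'I_n) :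
  open O -> smooth_on O (fun y : 'rV[R]_n => y ord0 k).
Proof.
move=> oO; case=> [|j] /=; first by move=> x _; exact: coord_continuous.
move=> i; split.
  by move=> x Ox; apply: ex_derive; exact: is_derive_coord.
rewrite (_ : partial i _ = fun=> (delta_mx ord0 i : 'rV[R]_n) ord0 k); first exact: Ck_on_cst.
by apply/funext => x; apply: derive_val; exact: is_derive_coord.
Qed.

(** * Matrix identities behind the transformation laws *)

Section MatrixAlgebra.
Context {R : comNzRingType} {n : nat}.

Lemma trmx_sumZ (c : 'I_n -> R) (M : 'I_n -> 'M[R]_n) :
  (\sum_l c l *: M l)^T = \sum_l c l *: (M l)^T.
Proof. by rewrite linear_sum; apply: eq_bigr => l _; rewrite linearZ. Qed.

Lemma trilinear_sym (J : 'M[R]_n) (L : 'I_n -> 'M[R]_n) a b c :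
  (forall l d e, L l d e = L e d l) ->
  (J *m (\sum_l J a l *: L l) *m J^T) c b = (J *m (\sum_l J b l *: L l) *m J^T) c a.
Proof.
move=> symL.
have E a' b' : (J *m (\sum_l J a' l *: L l) *m J^T) c b' =
    \sum_d \sum_e \sum_l J c d * J b' e * J a' l * L l d e.
  rewrite mxE exchange_big /=.
  apply: eq_bigr => e _.
  rewrite mxE mulr_suml; apply: eq_bigr => d _.
  rewrite summxE mulr_sumr mulr_suml.
  apply: eq_bigr => l _; rewrite !mxE; ring.
rewrite !E; apply: eq_bigr => d _; rewrite exchange_big /=.
apply: eq_bigr => l _; apply: eq_bigr => e _; rewrite symL; ring.
Qed.

(** For J a Jacobian matrix and L a torsion-free lowered connection, the transported connection is
    torsion-free; the symmetry asked of dJ is that of the second derivatives of the change of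
    coordinates. *)
Lemma torsion_algebra (J G : 'M[R]_n) (L dJ : 'I_n -> 'M[R]_n) :
  (forall l d e, L l d e = L e d l) -> (forall a b d, dJ a b d = dJ b a d) -> forall a b c,
  (J *m (\sum_l J a l *: L l) *m J^T + J *m G *m (dJ a)^T) c b =
  (J *m (\sum_l J b l *: L l) *m J^T + J *m G *m (dJ b)^T) c a.
Proof.
move=> symL symdJ a b c; rewrite mxE [RHS]mxE; congr (_ + _); first exact: trilinear_sym.
by rewrite mxE [RHS]mxE; apply: eq_bigr => d _; rewrite ![_^T _ _]mxE symdJ.
Qed.

Lemma compat_algebra (J dJ G S : 'M[R]_n) : G^T = G ->
  J *m S *m J^T + J *m G *m dJ^T + (J *m S *m J^T + J *m G *m dJ^T)^T =
  (dJ *m G + J *m (S + S^T)) *m J^T + J *m G *m dJ^T.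
Proof.
move=> symG.
rewrite linearD /= !trmx_mul !trmxK symG mulmxDl mulmxDr mulmxDl !mulmxA.
move: (J *m S *m J^T) (J *m G *m dJ^T) (J *m S^T *m J^T) (dJ *m G *m J^T) => p q r s.
by apply/matrixP => i j; rewrite !mxE; ring.
Qed.

(** The hypothesis is the transformation law of the connection matrices: its inhomogeneous term dJ
    cancels the derivative of J produced by differentiating the pulled-back form. *)
Lemma nabla_algebra (J dJ C C' : 'M[R]_n) (w dw : 'cV[R]_n) :
  J^T *m C' = C *m J^T + dJ^T ->
  dJ *m w + J *m dw - C'^T *m (J *m w) = J *m (dw - C^T *m w).
Proof.
move=> /(congr1 trmx); rewrite linearD /= !trmx_mul !trmxK => E.
rewrite mulmxA E mulmxDl mulmxBr opprD mulmxA.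
move: (dJ *m w) (J *m dw) (J *m C^T *m w) => p q r.
by apply/matrixP => i j; rewrite !mxE; ring.
Qed.

End MatrixAlgebra.

Section MatrixAlgebra2.
Context {R : comNzRingType} {n : nat}.

Lemma inner2_algebra (J A' T S : 'M[R]_n) :
  \tr (A' *m (J *m S *m J^T) *m A'^T *m (J *m T *m J^T)^T) =
  \tr (J^T *m A' *m J *m S *m (J^T *m A' *m J)^T *m T^T).
Proof. by rewrite !trmx_mul !trmxK -!mulmxA [RHS]mxtrace_mulC !mulmxA. Qed.

Lemma tensor_algebra (J T S : 'M[R]_n) (a b : R) :
  a *: (J *m T *m J^T) - b *: (J *m S *m J^T) = J *m (a *: T - b *: S) *m J^T.
Proof. by rewrite mulmxBr mulmxBl -!scalemxAr -!scalemxAl. Qed.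

Lemma trace_algebra (J A' T : 'M[R]_n) :
  \tr (A' *m (J *m T *m J^T)^T) = \tr (J^T *m A' *m J *m T^T).
Proof. by rewrite !trmx_mul !trmxK -!mulmxA [RHS]mxtrace_mulC !mulmxA. Qed.

End MatrixAlgebra2.

Section MatrixAlgebraUnit.
Context {R : comUnitRingType} {n : nat}.

Lemma connection_algebra (J dJ G A' S : 'M[R]_n) : J^T *m A' *m J = invmx G ->
  G \in unitmx ->
  J^T *m (A' *m (J *m S *m J^T + J *m G *m dJ^T)) = invmx G *m S *m J^T + dJ^T.
Proof. by move=> E uG; rewrite !mulmxDr !mulmxA E mulVmx // mul1mx. Qed.

Lemma bilinear_ext (M1 M2 : 'M[R]_n) :
  (forall p q : 'cV[R]_n, (q^T *m M1 *m p) 0 0 = (q^T *m M2 *m p) 0 0) -> M1 = M2.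
Proof.
have E (M : 'M[R]_n) i j :
    ((delta_mx i 0 : 'cV[R]_n)^T *m M *m (delta_mx j 0 : 'cV[R]_n)) 0 0 = M i j.
  by rewrite -colE mxE trmx_delta -rowE mxE.
by move=> H; apply/matrixP => i j; rewrite -!E.
Qed.

(** Two bilinear forms agreeing on all pairs of covectors have the same matrix, from which the
    invertible factors J and A' are then cancelled. *)
Lemma ricci_algebra (J A' A S' S : 'M[R]_n) :
  J \in unitmx -> A' \in unitmx -> J^T *m A' *m J = A ->
  (forall p q : 'cV[R]_n, (q^T *m J^T *m A' *m S' *m A' *m J *m p) 0 0 =
     (q^T *m A *m S *m A *m p) 0 0) ->
  S' = J *m S *m J^T.
Proof.
move=> uJ uA' <- H.
have uT : J^T \in unitmx by rewrite unitmx_tr.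
have : J^T *m A' *m S' *m A' *m J = J^T *m A' *m (J *m S *m J^T) *m A' *m J.
  by apply: bilinear_ext => p q; rewrite !mulmxA H !mulmxA.
move/(can_inj (mulmxK uJ))/(can_inj (mulmxK uA')).
by rewrite -!mulmxA => /(can_inj (mulKmx uT))/(can_inj (mulKmx uA')).
Qed.

End MatrixAlgebraUnit.

(** * Transformation laws of the local expressions *)

Section ChangeOfCoordinates.
Context {R : realType} {n : nat} (O O' : set 'rV[R]_n) (oO : open O) (oO' : open O').
Variables (phi : 'rV[R]_n -> 'rV[R]_n) (G G' : 'rV[R]_n -> 'M[R]_n).
Hypothesis phiO : forall x, O x -> O' (phi x).
Hypothesis Cphi : forall l, smooth_on O (fun y => phi y ord0 l).
Hypothesis HG : forall k, Ck_mx O' k G.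
Hypothesis symG : forall x, O' x -> (G x)^T = G x.
Hypothesis uG : forall x, O' x -> G x \in unitmx.
Hypothesis HG' : forall k, Ck_mx O k G'.
Hypothesis symG' : forall x, O x -> (G' x)^T = G' x.
Hypothesis uG' : forall x, O x -> G' x \in unitmx.

(** Rows are indexed by the direction of differentiation, the transpose of the usual Jacobian:
    columns of components of 1-forms pull back by left multiplication by J, and covariant 2-tensors
    by T |-> J T J^T. *)
Definition jacobian_mx x : 'M[R]_n := \matrix_(a, k) partial a (fun y => phi y ord0 k) x.
Notation J := jacobian_mx.
Hypothesis GE : forall x, O x -> G' x = J x *m G (phi x) *m (J x)^T.

Implicit Types (w z : 'I_n -> 'rV[R]_n -> R)
  (T : 'I_n -> 'I_n -> 'rV[R]_n -> R) (x : 'rV[R]_n) (i j l a b : 'I_n).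

Let phic x : O x -> {for x, continuous phi}.
Proof. by move=> Ox; apply: continuous_rV => l; exact: (Cphi l 0). Qed.

Let CJ k : Ck_mx O k J.
Proof. by move=> a l; under eq_fun do rewrite mxE; exact: (Ck_on_partial a (Cphi l k.+1)). Qed.

Lemma partial_pullback f x a : Ck_on 1 O' f -> O x ->
  partial a (f \o phi) x = \sum_l J x a l * partial l f (phi x).
Proof.
move=> Hf Ox; rewrite (partial_comp oO' Hf (phiO Ox)).
  by apply: eq_bigr => l _; rewrite mxE.
by move=> l; have [+ _] := Cphi l 1%N a; exact.
Qed.

Lemma partial_mx_pullback p q (T : 'rV[R]_n -> 'M[R]_(p, q)) x a : Ck_mx O' 1 T -> O x ->
  partial_mx a (fun y => T (phi y)) x = \sum_l J x a l *: partial_mx l T (phi x).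
Proof.
move=> HT Ox; apply/matrixP => c d; rewrite mxE summxE.
rewrite (partial_pullback a (HT c d) Ox).
by apply: eq_bigr => l _; rewrite !mxE.
Qed.

Lemma Ck_pullback k f : Ck_on k O' f -> Ck_on k O (f \o phi).
Proof. by move=> Hf; apply: Ck_on_comp Hf => // l; exact: Cphi. Qed.

Lemma Ck_mx_pullback k p q (T : 'rV[R]_n -> 'M[R]_(p, q)) :
  Ck_mx O' k T -> Ck_mx O k (fun y => T (phi y)).
Proof. by move=> HT a b; exact: (Ck_pullback (HT a b)). Qed.

Lemma jacobian_unit x : O x -> J x \in unitmx.
Proof. by move=> Ox; have := uG' Ox; rewrite GE // !unitmx_mul => /andP[/andP[]]. Qed.

(** In this arrangement no inverse of J appears, and the right-hand side can be replaced by the left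
    one inside any contraction. *)
Lemma cometric_pullback x : O x -> (J x)^T *m invmx (G' x) *m J x = invmx (G (phi x)).
Proof.
move=> Ox; have uJ := jacobian_unit Ox; have uT : (J x)^T \in unitmx by rewrite unitmx_tr.
have E : (J x)^T *m invmx (G' x) *m J x *m G (phi x) = 1%:M.
  apply: (can_inj (mulmxK uT)).
  by rewrite -!mulmxA (mulmxA (J x)) -GE // mulVmx ?uG' // mulmx1 mul1mx.
by rewrite -[LHS](mulmxK (uG (phiO Ox))) E mul1mx.
Qed.

(* Uniqueness of the Levi-Civita connection (X a is the lowered connection matrix in
   direction a): it spares the direct computation of the pulled-back Christoffel symbols. *)
Lemma lowered_connection_unique x (X : 'I_n -> 'M[R]_n) : O x ->
  (forall a b c, X a c b = X b c a) ->
  (forall a, X a + (X a)^T = partial_mx a G' x) ->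
  forall a, X a = lowered_connection_mx G' a x.
Proof.
move=> Ox tX cX a; apply/matrixP => c b.
have D e f d : partial e (fun y => G' y f d) x = X e f d + X e d f.
  by have /matrixP/(_ f d) := cX e; rewrite !mxE.
rewrite mxE !D (tX b a c) (tX a c b) (tX b c a); lra.
Qed.

(** The right-hand side is torsion-free, by Schwarz for the term in the derivative of J, and
    compatible with G', by differentiating G' = J G J^T; uniqueness concludes. *)
Lemma lowered_connection_pullback x a : O x ->
  lowered_connection_mx G' a x =
  J x *m (\sum_l J x a l *: lowered_connection_mx G l (phi x)) *m (J x)^T
  + J x *m G (phi x) *m (partial_mx a J x)^T.
Proof.
move=> Ox.
pose X a := J x *m (\sum_l J x a l *: lowered_connection_mx G l (phi x)) *m (J x)^T
  + J x *m G (phi x) *m (partial_mx a J x)^T.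
suff : forall a, X a = lowered_connection_mx G' a x by move/(_ a).
apply: lowered_connection_unique => //.
  apply: (@torsion_algebra _ _ (J x) (G (phi x)) (fun l => lowered_connection_mx G l (phi x))
    (fun c => partial_mx c J x)) => [l d e|c b d].
    exact: (lowered_connection_torsion oO' symG l e d (phiO Ox)).
  have E c' d' e : partial_mx c' J x d' e = partial c' (partial d' (fun y => phi y ord0 e)) x.
    by rewrite mxE; congr (partial c' _ x); apply/funext => y; rewrite mxE.
  exact: (etrans (E c b d) (etrans (partialC c b oO (Cphi d 2%N) Ox) (esym (E b c d)))).
move=> {}a; rewrite (partial_mx_ext oO a GE Ox).
have CGphi := Ck_mx_pullback (HG 1).
rewrite (partial_mxM oO a (Ck_mx_mul oO (CJ 1) CGphi) (Ck_mx_tr (CJ 1)) Ox).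
rewrite (partial_mxM oO a (CJ 1) CGphi Ox) partial_mx_tr (partial_mx_pullback a (HG 1) Ox).
have -> : \sum_l J x a l *: partial_mx l G (phi x) =
    \sum_l J x a l *: lowered_connection_mx G l (phi x) +
    (\sum_l J x a l *: lowered_connection_mx G l (phi x))^T.
  rewrite trmx_sumZ -big_split /=; apply: eq_bigr => l _.
  by rewrite -(lowered_connection_compat oO' symG l (phiO Ox)) scalerDr.
rewrite /X; apply: compat_algebra; exact: (symG (phiO Ox)).
Qed.

(** The usual law of the Christoffel symbols, left multiplied by the transpose of J so as to contain
    no inverse; this is the form that [nabla_algebra] consumes. *)
Lemma connection_pullback x a : O x ->
  (J x)^T *m connection_mx G' a x =
  (\sum_l J x a l *: connection_mx G l (phi x)) *m (J x)^T + (partial_mx a J x)^T.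
Proof.
move=> Ox; rewrite connection_mxE lowered_connection_pullback //.
have -> : \sum_l J x a l *: connection_mx G l (phi x) =
    invmx (G (phi x)) *m \sum_l J x a l *: lowered_connection_mx G l (phi x).
  by rewrite mulmx_sumr; apply: eq_bigr => l _; rewrite connection_mxE scalemxAr.
exact: (connection_algebra _ _ (cometric_pullback Ox) (uG (phiO Ox))).
Qed.

(** A relation rather than an operation: on the manifold the components in both charts are given,
    and it is their compatibility that has to be propagated through each construction. *)
Definition pullback1 w' w :=
  forall x, O x -> form_col w' x = J x *m form_col w (phi x).
Definition pullback2 T' T :=
  forall x, O x -> tensor_mx T' x = J x *m tensor_mx T (phi x) *m (J x)^T.

Lemma pullback_differential f' f : (forall x, O x -> f' x = f (phi x)) -> Ck_on 1 O' f ->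
  pullback1 (differential f') (differential f).
Proof.
move=> ff Hf x Ox; apply/matrixP => a c; rewrite mxE [RHS]mxE.
rewrite /differential (partial_ext a oO ff Ox).
rewrite [LHS](partial_pullback a Hf Ox); apply: eq_bigr => l _.
by rewrite [form_col _ _ _ _]mxE.
Qed.

Lemma pullback_nabla w' w : pullback1 w' w -> (forall i, Ck_on 1 O' (w i)) ->
  pullback2 (nabla G' w') (nabla G w).
Proof.
move=> ww Hw x Ox.
have HW : Ck_mx O' 1 (form_col w) by exact: Ck_form_col.
have row_ a : \col_j nabla G' w' a j x =
   J x *m \sum_l J x a l *: \col_j nabla G w l j (phi x).
  have -> : \col_j nabla G' w' a j x =
      partial_mx a (form_col w') x - (connection_mx G' a x)^T *m form_col w' x.
    by apply/matrixP => j c; rewrite ord1 mxE nablaE.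
  rewrite (ww _ Ox) (partial_mx_ext oO a ww Ox).
  have HWphi := Ck_mx_pullback HW.
  rewrite (partial_mxM oO a (CJ 1) HWphi Ox) (partial_mx_pullback a HW Ox).
  have -> : \sum_l J x a l *: \col_j nabla G w l j (phi x) =
    \sum_l J x a l *: partial_mx l (form_col w) (phi x) -
    (\sum_l J x a l *: connection_mx G l (phi x))^T *m form_col w (phi x).
    rewrite trmx_sumZ mulmx_suml -sumrB; apply: eq_bigr => l _.
    rewrite -scalemxAl -scalerBr; congr (_ *: _).
    by apply/matrixP => j c; rewrite ord1 mxE nablaE.
  exact: nabla_algebra (connection_pullback a Ox).
apply/matrixP => a b; rewrite mxE.
have /matrixP/(_ b 0) := row_ a; rewrite mxE => ->.
rewrite mxE [RHS]mxE; apply: eq_bigr => c _.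
rewrite summxE mulr_sumr [(_ *m _) a c]mxE mulr_suml.
by apply: eq_bigr => d _; rewrite !mxE; ring.
Qed.

Lemma pullback_inner1 w' w z' z x : pullback1 w' w -> pullback1 z' z -> O x ->
  inner1 G' w' z' x = inner1 G w z (phi x).
Proof.
move=> ww zz Ox; rewrite !inner1E (ww _ Ox) (zz _ Ox) -(cometric_pullback Ox).
by rewrite trmx_mul !mulmxA.
Qed.

Lemma pullback_inner2 T' T (S' S : 'I_n -> 'I_n -> 'rV[R]_n -> R) x :
  pullback2 T' T -> pullback2 S' S -> O x ->
  inner2 G' T' S' x = inner2 G T S (phi x).
Proof.
move=> TT SS Ox; rewrite !inner2E (TT _ Ox) (SS _ Ox) -(cometric_pullback Ox).
exact: inner2_algebra.
Qed.

Lemma pullback_trace T' T x : pullback2 T' T -> O x ->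
  \sum_i \sum_j cometric G' i j x * T' i j x =
  \sum_i \sum_j cometric G i j (phi x) * T i j (phi x).
Proof.
have E (H : 'rV[R]_n -> 'M[R]_n) S y : \sum_i \sum_j cometric H i j y * S i j y =
    \tr (invmx (H y) *m (tensor_mx S y)^T).
  rewrite /mxtrace; apply: eq_bigr => i _; rewrite mxE; apply: eq_bigr => j _.
  by rewrite /cometric !mxE.
move=> TT Ox; rewrite !E (TT _ Ox) -(cometric_pullback Ox).
exact: trace_algebra.
Qed.

Lemma pullback_contract T' T w' w : pullback2 T' T -> pullback1 w' w ->
  pullback1 (Defs.contract G' T' w') (Defs.contract G T w).
Proof.
move=> TT ww x Ox; rewrite !contractE (TT _ Ox) /raise (ww _ Ox) -(cometric_pullback Ox).
by rewrite !mulmxA.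
Qed.

Lemma pullback_divergence w' w x : pullback1 w' w -> (forall i, Ck_on 1 O' (w i)) -> O x ->
  divergence G' w' x = divergence G w (phi x).
Proof. by move=> ww Hw Ox; apply: pullback_trace => //; exact: pullback_nabla. Qed.

Lemma pullback_laplacian f' f x : (forall y, O y -> f' y = f (phi y)) -> Ck_on 2 O' f -> O x ->
  laplacian G' f' x = laplacian G f (phi x).
Proof.
move=> ff Hf Ox; apply: pullback_divergence => //.
  by apply: pullback_differential => //; exact: Ck_on_pred.
by move=> i; exact: Ck_on_partial.
Qed.

(** Bochner's formula is applied in both charts to linear functions of the target coordinates, whose
    differentials are arbitrary constant covectors p and q. All its other terms are already known to
    be invariant, so the Ricci terms agree for every p and q. *)
Lemma pullback_ricci : pullback2 (ricci G') (ricci G).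
Proof.
move=> x Ox; have O'x := phiO Ox.
pose u (p : 'rV[R]_n) (y : 'rV[R]_n) := \sum_k p ord0 k * y ord0 k.
have Hu p : smooth_on O' (u p).
  apply: smooth_on_sum => // k; apply: smooth_onM => //; first exact: smooth_on_cst.
  exact: smooth_on_coord.
have Hu' p : smooth_on O (u p \o phi) by move=> k; apply: Ck_pullback; exact: Hu.
have du p y : O' y -> form_col (differential (u p)) y = p^T.
  move=> Oy; apply/matrixP => i j; rewrite ord1 !mxE /differential /u.
  rewrite (partial_sum oO') //; last first.
    by move=> k; apply: Ck_onM => //; [exact: Ck_on_cst|exact: smooth_on_coord].
  under eq_bigr => k _ do rewrite (partialZ _ _ (smooth_on_coord k oO' 1%N) Oy)
    partial_coord.
  rewrite (bigD1 i) //= eqxx mulr1 big1 ?addr0 // => k ki.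
  by rewrite (negbTE ki) mulr0.
have pd p : pullback1 (differential (u p \o phi)) (differential (u p)).
  by apply: pullback_differential => //; exact: (Hu p 1%N).
have pn p : pullback2 (nabla G' (differential (u p \o phi))) (nabla G (differential (u p))).
  by apply: pullback_nabla => // i; exact: (Ck_on_partial i (Hu p 2%N)).
have Hlap p : Ck_on 1 O' (laplacian G (u p)) by exact: (smooth_laplacian oO' HG uG (Hu p) 1%N).
have key p q : inner1 G' (differential (u q \o phi))
     (Defs.contract G' (ricci G') (differential (u p \o phi))) x =
   inner1 G (differential (u q)) (Defs.contract G (ricci G) (differential (u p))) (phi x).
  apply: (etrans (bochner oO HG' symG' uG' (Hu' p) (Hu' q) Ox)).
  apply: (etrans _ (esym (bochner oO' HG symG uG (Hu p) (Hu q) O'x))).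
  have E1 : divergence G' (Defs.contract G' (nabla G' (differential (u p \o phi)))
        (differential (u q \o phi))) x =
      divergence G (Defs.contract G (nabla G (differential (u p))) (differential (u q))) (phi x).
    apply: pullback_divergence => //; first exact: pullback_contract.
    move=> i; apply: (Ck_contract oO' HG uG) => [a b|a].
      by apply: (Ck_nabla oO' HG uG) => c; exact: (Ck_on_partial c (Hu p 3%N)).
    exact: (Ck_on_partial a (Hu q 2%N)).
  have E3 : inner1 G' (differential (u q \o phi)) (differential (laplacian G' (u p \o phi))) x =
      inner1 G (differential (u q)) (differential (laplacian G (u p))) (phi x).
    have pl y : O y -> laplacian G' (u p \o phi) y = laplacian G (u p) (phi y).
      by move=> Oy; exact: (pullback_laplacian (fun _ _ => erefl) (Hu p 2%N) Oy).
    exact: (pullback_inner1 (pd q) (pullback_differential pl (Hlap p)) Ox).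
  by rewrite E1 E3 (pullback_inner2 (pn p) (pn q) Ox).
apply: (@ricci_algebra _ _ (J x) (invmx (G' x)) (invmx (G (phi x)))).
- exact: jacobian_unit.
- by rewrite unitmx_inv uG'.
- exact: cometric_pullback.
- move=> p q; have := key p^T q^T.
  rewrite inner1E [in RHS]inner1E contractE [in RHS]contractE /raise.
  rewrite (pd p^T x Ox) (pd q^T x Ox) (du _ _ O'x) (du _ _ O'x) !trmxK.
  by rewrite trmx_mul !mulmxA.
Qed.

Lemma pullback_scalar_curv x : O x -> scalar_curv G' x = scalar_curv G (phi x).
Proof. by apply: pullback_trace; exact: pullback_ricci. Qed.

Lemma pullback_local_Q x : O x -> local_Q G' x = local_Q G (phi x).
Proof.
move=> Ox; rewrite /local_Q (pullback_scalar_curv Ox).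
rewrite (pullback_laplacian pullback_scalar_curv _ Ox); last exact: (smooth_scalar_curv oO' HG uG).
by have := pullback_inner2 pullback_ricci pullback_ricci Ox => /= E; congr (_ - _ * _).
Qed.

Lemma pullback_paneitz_tensor : pullback2 (paneitz_tensor G') (paneitz_tensor G).
Proof.
move=> x Ox.
have E (H : 'rV[R]_n -> 'M[R]_n) y : tensor_mx (paneitz_tensor H) y =
    (@paneitz_a R n * scalar_curv H y) *: H y - @paneitz_b R n *: tensor_mx (ricci H) y.
  by apply/matrixP => i j; rewrite !mxE.
rewrite !E (pullback_ricci Ox) (pullback_scalar_curv Ox) (GE Ox).
exact: tensor_algebra.
Qed.

Lemma pullback_local_paneitz v' v x : (forall y, O y -> v' y = v (phi y)) ->
  smooth_on O' v -> O x -> local_paneitz G' v' x = local_paneitz G v (phi x).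
Proof.
move=> vv Hv Ox; have O'x := phiO Ox.
have Hlap := smooth_laplacian oO' HG uG Hv.
have pl y : O y -> laplacian G' v' y = laplacian G v (phi y).
  by move=> Oy; apply: pullback_laplacian => //; exact: (Hv 2%N).
rewrite /local_paneitz (pullback_laplacian pl _ Ox); last exact: (Hlap 2%N).
have -> : local_Q G' x = local_Q G (phi x) by exact: pullback_local_Q.
have -> : v' x = v (phi x) by exact: vv.
have pv := pullback_differential vv (Hv 1%N).
rewrite (pullback_divergence (pullback_contract pullback_paneitz_tensor pv) _ Ox) // => i.
apply: (Ck_contract oO' HG uG) => [a b|a]; last exact: (Ck_on_partial a (Hv 2%N)).
exact: (smooth_paneitz_tensor oO' HG uG).
Qed.

End ChangeOfCoordinates.

(** * Positive definite matrices and the local Paneitz identity *)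

Section PositiveDefinite.
Context {R : realType}.

Definition posdef_mx n (G : 'M[R]_n) :=
  forall v : 'rV[R]_n, v != 0 -> 0 < (v *m G *m v^T) 0 0.

Lemma posdef_unit n (G : 'M[R]_n) : posdef_mx G -> G \in unitmx.
Proof.
move=> pG; rewrite unitmxE unitfE; apply/negP => /det0P[v v0 vG].
by have := pG v v0; rewrite vG mul0mx mxE ltxx.
Qed.

(** Induction on the size through the Schur complement S of the first diagonal entry. The
    factorization gives both the sign of the determinant and that of the squared norm of a
    2-tensor. *)
Lemma posdef_cholesky n (G : 'M[R]_n) : G^T = G -> posdef_mx G -> exists B : 'M[R]_n, G = B *m B^T.
Proof.
elim: n G => [|n IH] G symG pG; first by exists 0; apply/matrixP => -[].
move: G symG pG; rewrite -[n.+1]/(1 + n)%N => G symG pG.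
pose a := G 0 0; pose b : 'cV[R]_n := dlsubmx G; pose D := drsubmx G.
have ulE : ulsubmx G = a%:M.
  by apply/matrixP => i j; rewrite !ord1 !mxE mulr1n; congr (G _ _); exact/val_inj.
have urE : ursubmx G = b^T by rewrite /b trmx_dlsub symG.
have GE : G = block_mx a%:M b^T b D by rewrite -ulE -urE submxK.
have DE : D^T = D by rewrite /D trmx_drsub symG.
have a0 : 0 < a.
  have := pG (row_mx 1%:M 0).
  rewrite GE tr_row_mx mul_row_block mul_row_col !trmx0 !mul0mx !mul1mx !addr0 mulmx0 addr0.
  rewrite trmx1 mulmx1 mxE mulr1n; apply.
  apply/eqP => /(congr1 lsubmx); rewrite row_mxKl => /matrixP/(_ 0 0).
  by rewrite linear0 !mxE /=; move/eqP; rewrite oner_eq0.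
have aN : a != 0 by rewrite gt_eqF.
pose S := D - a^-1 *: (b *m b^T).
have symS : S^T = S.
  by rewrite /S linearB linearZ /= trmx_mul trmxK DE.
have pS : posdef_mx S.
  (* This t minimizes the quadratic form of G over the vectors (t, v), and the minimum is the value
     at v of the form of S. *)
  move=> v v0; pose t := - a^-1 * (v *m b) 0 0.
  have := pG (row_mx t%:M v); rewrite GE tr_row_mx mul_row_block mul_row_col.
  have vb : v *m b = ((v *m b) 0 0)%:M by rewrite [LHS]mx11_scalar.
  have bv : b^T *m v^T = ((v *m b) 0 0)%:M by rewrite -trmx_mul {1}vb tr_scalar_mx.
  move=> H; have {}H := H _.
  have E : (v *m S *m v^T) 0 0 = (((t%:M *m a%:M + v *m b) *m (t%:M : 'M[R]_1)^T + (t%:M *m b^T + v *m D) *m v^T)) 0 0.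
    rewrite /S mulmxBr mulmxBl -scalemxAr -scalemxAl mulmxA -[v *m b *m b^T *m v^T]mulmxA bv vb.
    rewrite [(t%:M *m b^T + _) *m _]mulmxDl -[t%:M *m b^T *m v^T]mulmxA bv tr_scalar_mx.
    rewrite mulmxDl -!scalar_mxM.
    move: (v *m D *m v^T) => Q; rewrite /t; move: ((v *m b) 0 0) => c.
    rewrite !mxE !mulr1n. by field.
  rewrite E; apply: H; apply/eqP => /(congr1 rsubmx); rewrite row_mxKr linear0.
  by move/eqP; exact/negP.
have [C SE] := IH S symS pS.
exists (block_mx (Num.sqrt a)%:M 0 ((Num.sqrt a)^-1 *: b) C).
have sa : Num.sqrt a != 0 by rewrite gt_eqF // sqrtr_gt0.
rewrite tr_block_mx mulmx_block !trmx0 !mul0mx !mulmx0 !addr0 tr_scalar_mx -scalar_mxM.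
rewrite -expr2 sqr_sqrtr ?ltW // {1}GE; congr block_mx.
- by rewrite linearZ /= mul_scalar_mx scalerA divff // scale1r.
- by rewrite mul_mx_scalar scalerA divff // scale1r.
- rewrite -SE linearZ /= -scalemxAr -scalemxAl scalerA -invfM -expr2 sqr_sqrtr ?ltW //.
  by rewrite /S addrC subrK.
Qed.

Lemma posdef_det n (G : 'M[R]_n) : G^T = G -> posdef_mx G -> 0 < \det G.
Proof.
move=> symG pG; have [B E] := posdef_cholesky symG pG.
have := posdef_unit pG; rewrite unitmxE unitfE E det_mulmx det_tr -expr2 sqrf_eq0 => B0.
by rewrite lt_def sqr_ge0 sqrf_eq0 B0.
Qed.

Lemma posdef_inv n (G : 'M[R]_n) : G^T = G -> posdef_mx G -> posdef_mx (invmx G).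
Proof.
move=> symG pG v v0; have uG := posdef_unit pG.
have := pG (v *m invmx G); rewrite mulmxKV // trmx_mul trmx_inv symG mulmxA; apply.
by apply: contra_neq v0 => /(congr1 (mulmx^~ G)); rewrite mulmxKV // mul0mx.
Qed.

Lemma frobenius_ge0 m n (T : 'M[R]_(m, n)) : 0 <= \tr (T *m T^T).
Proof.
apply: sumr_ge0 => i _; rewrite mxE; apply: sumr_ge0 => j _.
by rewrite mxE -expr2 sqr_ge0.
Qed.

End PositiveDefinite.

Section ScalarComposition.
Context {R : realType} {n : nat}.

Lemma is_derive_comp1 (h : R -> R) (f : 'rV[R]_n -> R) x v (d : R) :
  derivable f x v -> is_derive (f x) (1 : R) h d ->
  is_derive x v (fun y => h (f y)) (d * 'D_v f x).
Proof.
move=> df dh; apply: is_derive_of_line.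
have dl : is_derive (0 : R) (1 : R) (fun t => f (x + t *: v)) ('D_v f x).
  have := is_derive_line (s := 0) (x := x) (v := v) (f := f).
  by rewrite scale0r addr0; apply.
have dh' : is_derive (f (x + 0 *: v)) (1 : R) h d by rewrite scale0r addr0.
exact: (is_derive1_comp dh' dl).
Qed.

(** It serves for the density sqrt(det g) and for the cutoffs, which are differentiated only
    once. *)
Lemma Ck1_comp1 (O : set 'rV[R]_n) (h h' : R -> R) (f : 'rV[R]_n -> R) : open O -> Ck_on 1 O f ->
  (forall x, O x -> is_derive (f x) (1 : R) h (h' (f x))) ->
  (forall x, O x -> {for f x, continuous h'}) -> Ck_on 1 O (fun y => h (f y)).
Proof.
move=> oO Hf dh ch i; have [df pf] := Hf i; split.
  by move=> x Ox; apply: ex_derive; apply: is_derive_comp1; [exact: df|exact: dh].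
have C0 : Ck_on 0 O (fun y => h' (f y) * partial i f y).
  apply: Ck_onM => // x Ox; apply: continuous_comp; last exact: ch.
  exact: (Ck1_continuous oO Hf Ox).
apply: Ck_on_ext oO _ C0 => x Ox; apply/esym; apply: derive_val.
by apply: is_derive_comp1; [exact: df|exact: dh].
Qed.

Lemma Ck1_sqrt (O : set 'rV[R]_n) (f : 'rV[R]_n -> R) : open O -> Ck_on 1 O f ->
  (forall x, O x -> 0 < f x) -> Ck_on 1 O (fun y => Num.sqrt (f y)).
Proof.
move=> oO Hf f0; apply: (Ck1_comp1 (h' := fun t => (2 * Num.sqrt t)^-1) oO Hf) => x Ox.
  exact: is_derive1_sqrt (f0 x Ox).
apply: cvgV; first by rewrite mulf_neq0 // gt_eqF // sqrtr_gt0 f0.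
by apply: cvgMl_tmp; exact: sqrt_continuous.
Qed.

End ScalarComposition.

(** * The pointwise Paneitz identity and the divergence in density form *)

Section LocalIdentities.
Context {R : realType} {n : nat} (O : set 'rV[R]_n) (oO : open O).
Variable G : 'rV[R]_n -> 'M[R]_n.
Hypothesis HG : forall k, Ck_mx O k G.
Hypothesis symG : forall x, O x -> (G x)^T = G x.
Hypothesis pG : forall x, O x -> posdef_mx (G x).
Implicit Types (w z : 'I_n -> 'rV[R]_n -> R) (f u : 'rV[R]_n -> R)
  (T : 'I_n -> 'I_n -> 'rV[R]_n -> R) (x : 'rV[R]_n) (i j l : 'I_n).

Let uG x (Ox : O x) : G x \in unitmx := posdef_unit (pG Ox).

Lemma divergenceD w z x : (forall i, Ck_on 1 O (w i)) -> (forall i, Ck_on 1 O (z i)) -> O x ->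
  divergence G (fun i y => w i y + z i y) x = divergence G w x + divergence G z x.
Proof.
move=> Hw Hz Ox; rewrite /divergence -big_split; apply: eq_bigr => i _ /=.
rewrite -big_split; apply: eq_bigr => j _ /=; rewrite -mulrDr; congr (_ * _).
rewrite /nabla (partialD i (Hw j) (Hz j) Ox).
under eq_bigr do rewrite mulrDr.
by rewrite big_split /=; ring.
Qed.

Lemma divergenceM f w x : Ck_on 1 O f -> (forall i, Ck_on 1 O (w i)) -> O x ->
  divergence G (fun i y => f y * w i y) x = inner1 G (differential f) w x + f x * divergence G w x.
Proof.
move=> Hf Hw Ox; rewrite /divergence /inner1 mulr_sumr -big_split; apply: eq_bigr => i _ /=.
rewrite mulr_sumr -big_split; apply: eq_bigr => j _ /=.
rewrite /nabla (partialM i Hf (Hw j) Ox) /differential.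
have -> : \sum_k christoffel G k i j x * (f x * w k x) =
    f x * \sum_k christoffel G k i j x * w k x.
  by rewrite mulr_sumr; apply: eq_bigr => k _; rewrite mulrCA.
ring.
Qed.

Lemma divergenceZ (c : R) w x : (forall i, Ck_on 1 O (w i)) -> O x ->
  divergence G (fun i y => c * w i y) x = c * divergence G w x.
Proof.
move=> Hw Ox; rewrite (divergenceM (Ck_on_cst 1 O c) Hw Ox) /inner1 big1 ?add0r // => i _.
by rewrite big1 // => j _; rewrite /differential partial_cst mulr0 mul0r.
Qed.

Lemma inner1C w z x : O x -> inner1 G w z x = inner1 G z w x.
Proof.
move=> Ox; rewrite /inner1 exchange_big; apply: eq_bigr => i _; apply: eq_bigr => j _ /=.
have /matrixP/(_ i j) := sym_cometric symG Ox; rewrite mxE /cometric => ->; ring.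
Qed.

Lemma inner1_paneitz_tensor w x : O x ->
  inner1 G w (Defs.contract G (paneitz_tensor G) w) x =
  @paneitz_a R n * scalar_curv G x * inner1 G w w x
  - @paneitz_b R n * inner1 G w (Defs.contract G (ricci G) w) x.
Proof.
move=> Ox; rewrite !inner1E !contractE /raise.
have -> : tensor_mx (paneitz_tensor G) x =
    (@paneitz_a R n * scalar_curv G x) *: G x - @paneitz_b R n *: tensor_mx (ricci G) x.
  by apply/matrixP => i j; rewrite !mxE.
move: (tensor_mx _ x) (form_col w x) (_ * scalar_curv G x) (@paneitz_b R n) => S v a b.
rewrite mulmxBl -!scalemxAl mulKVmx ?uG // mulmxBr -!scalemxAr.
by rewrite mxE [X in X + _]mxE [X in _ + X]mxE [X in _ - X]mxE.
Qed.

(* The 1-form W = u d(Lap u) + (b - 1) Lap u du - u T(du) - b Hess u(du), with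
   T = a R g - b Ric: its divergence is what integration by parts discards. *)
Definition paneitz_flux u i : 'rV[R]_n -> R := fun y =>
  u y * differential (laplacian G u) i y
  + ((@paneitz_b R n - 1) * (laplacian G u y * differential u i y)
  + ((-1) * (u y * Defs.contract G (paneitz_tensor G) (differential u) i y)
  + (- @paneitz_b R n) * Defs.contract G (nabla G (differential u)) (differential u) i y)).

Definition paneitz_energy u : 'rV[R]_n -> R := fun y =>
  (1 - @paneitz_b R n) * laplacian G u y ^+ 2
  + @paneitz_b R n * sqnorm2 G (nabla G (differential u)) y
  + @paneitz_a R n * scalar_curv G y * sqnorm1 G (differential u) y
  + (n%:R - 4) / 2 * local_Q G y * u y ^+ 2.

Lemma smooth_paneitz_flux u i : smooth_on O u -> smooth_on O (paneitz_flux u i).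
Proof.
move=> Hu; have Hl := smooth_laplacian oO HG uG Hu.
have Hdu j : smooth_on O (differential u j) by exact: smooth_on_partial.
have Hc T j : (forall a b, smooth_on O (T a b)) -> smooth_on O (Defs.contract G T (differential u) j).
  move=> HT k; apply: (Ck_contract oO HG uG) => [a b|a]; [exact: HT|exact: Hdu].
have HP := smooth_paneitz_tensor oO HG uG.
have HN a b : smooth_on O (nabla G (differential u) a b).
  by move=> k; apply: (Ck_nabla oO HG uG) => c; exact: (Hdu c k.+1).
have cst c := smooth_on_cst O c.
apply: smooth_onD => //; first by apply: smooth_onM => //; exact: smooth_on_partial.
apply: smooth_onD => //; first by apply: smooth_onM => //; exact: smooth_onM.
apply: smooth_onD => //; apply: smooth_onM => //; first by apply: smooth_onM => //; exact: Hc.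
exact: Hc.
Qed.

(** Leibniz expands the divergence of the flux, and Bochner with [h = u] replaces Ric(du,du). The
    products of du and d(Lap u) then occur with coefficients 1, b - 1 and - b, which sum to zero;
    this explains the coefficient b - 1 in the flux. *)
Lemma paneitz_identity u x : smooth_on O u -> O x ->
  u x * local_paneitz G u x = paneitz_energy u x + divergence G (paneitz_flux u) x.
Proof.
move=> Hu Ox; have Hl := smooth_laplacian oO HG uG Hu.
have Hdu j : smooth_on O (differential u j) by exact: smooth_on_partial.
have Hdl j : smooth_on O (differential (laplacian G u) j) by exact: smooth_on_partial.
have HT j : smooth_on O (Defs.contract G (paneitz_tensor G) (differential u) j).
  move=> k; apply: (Ck_contract oO HG uG) => [a b|a]; last exact: Hdu.
  exact: (smooth_paneitz_tensor oO HG uG).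
have HN j : smooth_on O (Defs.contract G (nabla G (differential u)) (differential u) j).
  move=> k; apply: (Ck_contract oO HG uG) => [a b|a]; last exact: Hdu.
  by apply: (Ck_nabla oO HG uG) => c; exact: (Hdu c k.+1).
pose w1 i y := u y * differential (laplacian G u) i y.
pose w2 i y := laplacian G u y * differential u i y.
pose w3 i y := u y * Defs.contract G (paneitz_tensor G) (differential u) i y.
pose w4 := Defs.contract G (nabla G (differential u)) (differential u).
have H1 i : smooth_on O (w1 i) by exact: smooth_onM.
have H2 i : smooth_on O (w2 i) by exact: smooth_onM.
have H3 i : smooth_on O (w3 i) by exact: smooth_onM.
have Z (c : R) (w : 'I_n -> 'rV[R]_n -> R) i :
    smooth_on O (w i) -> smooth_on O (fun y => c * w i y).
  by move=> Hw; apply: smooth_onM => //; exact: smooth_on_cst.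
have E : divergence G (paneitz_flux u) x = divergence G w1 x
    + ((@paneitz_b R n - 1) * divergence G w2 x
    + ((-1) * divergence G w3 x + (- @paneitz_b R n) * divergence G w4 x)).
  have Z2 i : smooth_on O (fun y => (@paneitz_b R n - 1) * w2 i y) by exact: Z.
  have Z3 i : smooth_on O (fun y => (-1) * w3 i y) by exact: Z.
  have Z4 i : smooth_on O (fun y => (- @paneitz_b R n) * w4 i y) by exact: (Z _ w4).
  have Z34 i := smooth_onD oO (Z3 i) (Z4 i).
  have Z234 i := smooth_onD oO (Z2 i) (Z34 i).
  rewrite -(divergenceZ _ (fun i => HN i 1%N) Ox) -(divergenceZ _ (fun i => H3 i 1%N) Ox).
  rewrite -(divergenceZ _ (fun i => H2 i 1%N) Ox).
  rewrite -(divergenceD (fun i => Z3 i 1%N) (fun i => Z4 i 1%N) Ox).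
  rewrite -(divergenceD (fun i => Z2 i 1%N) (fun i => Z34 i 1%N) Ox).
  by rewrite -(divergenceD (fun i => H1 i 1%N) (fun i => Z234 i 1%N) Ox).
rewrite E {E}.
rewrite (divergenceM (Hu 1%N) (fun i => Hdl i 1%N) Ox).
rewrite (divergenceM (Hl 1%N) (fun i => Hdu i 1%N) Ox).
rewrite (divergenceM (Hu 1%N) (fun i => HT i 1%N) Ox).
have B := bochner oO HG symG uG Hu Hu Ox.
rewrite (inner1_paneitz_tensor _ Ox) B -/w4.
rewrite [inner1 G (differential (laplacian G u)) _ x]inner1C //.
rewrite /paneitz_energy /local_paneitz.
rewrite -[sqnorm2 _ _ _]/(inner2 G (nabla G (differential u)) (nabla G (differential u)) x).
rewrite -[sqnorm1 _ _ _]/(inner1 G (differential u) (differential u) x).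
rewrite -/(paneitz_tensor G) -[divergence G (differential (laplacian G u)) x]/(laplacian G (laplacian G u) x).
rewrite -[divergence G (differential u) x]/(laplacian G u x).
move: (divergence G w4 x) (inner1 G _ (differential (laplacian G u)) x) (inner2 _ _ _ x)
  (inner1 G _ (differential u) x) (local_Q G x) (laplacian G (laplacian G u) x)
  (laplacian G u x) (scalar_curv G x) => d4 i1 h2 g1 q ll l s.
move: (divergence G (Defs.contract G (paneitz_tensor G) (differential u)) x) => dT.
ring.
Qed.

Lemma Ck1_sqrt_det : Ck_on 1 O (fun y => Num.sqrt (\det (G y))).
Proof.
apply: Ck1_sqrt => //; first by apply: Ck_det => //; exact: HG.
by move=> x Ox; apply: posdef_det; [exact: symG|exact: pG].
Qed.

(** By Jacobi's formula the logarithmic derivative of det G is the trace of G^-1 d_i G, and metric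
    compatibility makes it twice the trace of Gamma_i; the square root removes the 2. *)
Lemma partial_sqrt_det i x : O x ->
  partial i (fun y => Num.sqrt (\det (G y))) x =
  Num.sqrt (\det (G x)) * \tr (connection_mx G i x).
Proof.
move=> Ox; have d0 := posdef_det (symG Ox) (pG Ox); have uGx := uG Ox.
have dd : derivable (fun y => \det (G y)) x (delta_mx ord0 i).
  by have [+ _] := Ck_det oO (HG 1) i; exact.
rewrite [LHS](derive_val (is_derive := is_derive_comp1 dd (is_derive1_sqrt d0))).
rewrite -[X in _ * X]/(partial i (fun y => \det (G y)) x).
have -> : partial i (fun y => \det (G y)) x = \det (G x) * (2 * \tr (connection_mx G i x)).
  rewrite (partial_det oO i (HG 1) Ox) (metric_compat oO symG uG i Ox).
  have -> : \adj (G x) = \det (G x) *: invmx (G x).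
    by rewrite /invmx uGx scalerA divff ?scale1r // gt_eqF.
  rewrite -scalemxAl mxtraceZ; congr (_ * _).
  rewrite mulmxDr mxtraceD mulKmx // [X in _ + X]mxtrace_mulC mulmxK // mxtrace_tr.
  by rewrite mulr2n mulrDl mul1r.
have s0 : Num.sqrt (\det (G x)) != 0 by rewrite gt_eqF // sqrtr_gt0.
rewrite -{2}(sqr_sqrtr (ltW d0)); move: (Num.sqrt _) s0 => s s0.
by field.
Qed.

(** The density contributes Gamma^l_{il} V^i and the covariant divergence Gamma^i_{il} V^l; the two
    coincide because the torsion vanishes. *)
Lemma sqrt_det_divergence w x : (forall i, Ck_on 1 O (w i)) -> O x ->
  Num.sqrt (\det (G x)) * divergence G w x =
  \sum_i partial i (fun y => Num.sqrt (\det (G y)) * raise G w y i 0) x.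
Proof.
move=> Hw Ox; have CV := Ck_raise oO HG uG Hw.
rewrite (divergence_raise oO HG symG uG Hw Ox).
under [RHS]eq_bigr => i _ do rewrite (partialM i Ck1_sqrt_det (CV i 0) Ox) (partial_sqrt_det i Ox) -mulrA -mulrDr.
rewrite -mulr_sumr; congr (_ * _).
under eq_bigr do rewrite mxE.
rewrite !big_split /= addrC; congr (_ + _); last by apply: eq_bigr => i _; rewrite mxE.
under eq_bigr do rewrite mxE.
rewrite exchange_big /=; apply: eq_bigr => l _; rewrite -mulr_suml; congr (_ * _).
by apply: eq_bigr => i _; exact: (connection_torsion oO symG i l i Ox).
Qed.

End LocalIdentities.

(** * The iterated integral of compactly supported functions *)

Definition supported_in {R : realType} {V : normedModType R} (B : R) (f : V -> R) :=
  forall x, B < `|x| -> f x = 0.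

Lemma continuousMl (R : realType) (T : topologicalType) (c : R) (f : T -> R) :
  continuous f -> continuous (fun x => c * f x).
Proof. by move=> cf x; exact: (continuousM (@cst_continuous _ _ c x) (cf x)). Qed.

Lemma continuous_add (R : realType) (T : topologicalType) (f g : T -> R) :
  continuous f -> continuous g -> continuous (fun x => f x + g x).
Proof. by move=> cf cg x; exact: (continuousD (cf x) (cg x)). Qed.

Section CompactSupportLine.
Context {R : realType}.
Notation mu := (@lebesgue_measure R).
Implicit Types (f : R -> R) (B c : R).

Let out_supp B f : supported_in (V := R) B f -> f = f \_ `[- B, B].
Proof.
move=> sf; apply/funext => t; rewrite patchE; case: ifPn => //.
rewrite notin_setE /= in_itv /= => tB; rewrite sf //.
by rewrite ltNge ler_norml; apply/negP.
Qed.

Lemma compact_support_integrable B f : continuous f -> supported_in (V := R) B f ->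
  mu.-integrable setT (EFin \o f).
Proof.
move=> cf sf; rewrite (out_supp sf) -restrict_EFin.
have mI : measurable (`[- B, B] : set R) by [].
apply/(@integrable_mkcond _ _ _ mu _ (EFin \o f) mI).
apply: continuous_compact_integrable; first exact: segment_compact.
exact: continuous_subspaceT.
Qed.

Lemma compact_support_Rintegral B f : supported_in (V := R) B f ->
  \int[mu]_t f t = \int[mu]_(t in `[- B, B]) f t.
Proof. by move=> sf; rewrite {1}(out_supp sf) -Rintegral_mkcond. Qed.

Lemma compact_support_Rintegral_le B c f : 0 <= B -> continuous f -> supported_in (V := R) B f ->
  (forall t, `|f t| <= c) -> `|\int[mu]_t f t| <= c * (2 * B).
Proof.
move=> B0 cf sf fc; rewrite (compact_support_Rintegral sf).
have int_f : mu.-integrable `[- B, B] (EFin \o f).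
  apply: continuous_compact_integrable; first exact: segment_compact.
  exact: continuous_subspaceT.
have Hle := le_normr_Rintegral _ int_f.
apply: (le_trans (Hle _)) => //.
have -> : c * (2 * B) = \int[mu]_(t in `[- B, B]) c.
  rewrite Rintegral_cst //; congr (_ * _).
  have -> : 2 * B = fine (if (- B)%:E < B%:E then B%:E - (- B)%:E else 0)%E.
    rewrite lte_fin; case: ltgtP => H /=; lra.
  exact: (congr1 fine (esym (lebesgue_measure_itv `[- B, B]))).
apply: le_Rintegral => //; first exact: (integrable_norm int_f).
apply: continuous_compact_integrable; first exact: segment_compact.
by apply: continuous_subspaceT => x; exact: cst_continuous.
Qed.

Lemma Rintegral_derivative0 B (F f : R -> R) : 0 <= B -> continuous f ->
  (forall t, is_derive t (1 : R) F (f t)) -> supported_in (V := R) B F ->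
  supported_in (V := R) B f -> \int[mu]_t f t = 0.
Proof.
move=> B0 cf dF sF sf.
(* The support condition is silent at |t| = B, and B may be 0; on the enlarged interval F vanishes
   at both endpoints and the endpoints are distinct. *)
have sf' : supported_in (V := R) (B + 1) f.
  by move=> t Bt; apply: sf; apply: lt_trans Bt; rewrite ltrDl.
rewrite (compact_support_Rintegral sf') /Rintegral.
have cF t : {for t, continuous F}.
  by apply/differentiable_continuous/derivable1_diffP; case: (dF t).
have B1 : - (B + 1) < B + 1 by lra.
rewrite (continuous_FTC2 (F := F) B1) //=.
- rewrite !sF ?subrr // ?normrN ger0_norm; lra.
- exact: continuous_subspaceT.
- split => [t _||].
  + by case: (dF t).
  + by apply: cvg_at_right_filter; exact: cF.
  + by apply: cvg_at_left_filter; exact: cF.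
- by move=> t _; rewrite derive1E; case: (dF t).
Qed.

End CompactSupportLine.

Section UniformContinuity.
Context {R : realType} {n : nat}.

Lemma compact_support_unif_continuous B (f : 'rV[R]_n -> R) (e : R) :
  continuous f -> supported_in B f -> 0 < e ->
  exists2 d : R, 0 < d & forall x y, `|x - y| < d -> `|f x - f y| < e.
Proof.
move=> cf sf e0.
pose K := [set x : 'rV[R]_n | `|x| <= B + 1].
have cK : compact K.
  apply: bounded_closed_compact.
    by exists (B + 1); split => [|r Br x /= xB]; [exact: num_real|exact: le_trans xB (ltW Br)].
  apply: (@closed_comp _ _ (fun x : 'rV[R]_n => `|x|) [set r | r <= B + 1]).
    by move=> x _; exact: norm_continuous.
  exact: closed_le.
pose P (d : R) (x : 'rV[R]_n) := forall y, `|x - y| < d -> `|f x - f y| < e.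
have cov : forall x, K x -> \forall x' \near x & d \near 0^'+, P d x'.
  move=> x Kx.
  have e2 : 0 < e / 2 by rewrite divr_gt0.
  have /nbhs_ballP[r /= r0 Hr] : \forall z \near x, `|f x - f z| < e / 2.
    by have /cvgrPdist_lt /(_ _ e2) := cf x.
  have r2 : 0 < r / 2 by rewrite divr_gt0.
  exists (ball x (r / 2), [set d | d < r / 2]) => /=.
    by split; [exact: nbhsx_ballx|exact: nbhs_right_lt].
  move=> [x' d] /= [Bx dr] y xy.
  have H1 : ball x r x' by apply: le_ball Bx; rewrite ler_pdivrMr // ler_pMr // ler1n.
  have H2 : ball x r y.
    rewrite [r]splitr; apply: ball_triangle Bx _.
    by rewrite -ball_normE /=; exact: lt_trans dr.
  have := Hr _ H1; have := Hr _ H2 => A1 A2.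
  apply: le_lt_trans (ler_distD (f x) _ _) _.
  by rewrite [e]splitr ltrD // distrC.
have /compact_near_coveringP/(_ R 0^'+ P _ cov) [d /= d0 Hd] := cK.
(* The bound by 1 handles x outside the ball of radius B + 1: then y is outside the ball of radius B
   and both values vanish. *)
exists (Num.min (d / 2) 1); first by rewrite lt_min divr_gt0 //= ltr01.
move=> x y; rewrite lt_min => /andP[xd x1].
have [xK|xK] := leP `|x| (B + 1).
  apply: (Hd (d / 2)) => //=; last by rewrite divr_gt0.
  rewrite /ball_ /= sub0r normrN gtr0_norm ?divr_gt0 //.
  by rewrite ltr_pdivrMr // ltr_pMr // ltr1n.
rewrite !sf ?subrr ?normr0 //; last by apply: lt_trans xK; rewrite ltrDl.
rewrite -(ltrD2r 1); apply: (lt_le_trans xK).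
have -> : x = y + (x - y) by rewrite addrC subrK.
by rewrite (le_trans (ler_normD _ _)) // lerD2l ltW.
Qed.

End UniformContinuity.

(** * Iterated integrals: linearity, bounds and partial derivatives *)

Section IteratedIntegral.
Context {R : realType}.
Notation mu := (@lebesgue_measure R).

Definition slice {n} (f : 'rV[R]_n.+1 -> R) (t : R) : 'rV[R]_n -> R :=
  fun x => f (row_mx (t%:M : 'rV[R]_1) x).

Lemma integral_rVS n (f : 'rV[R]_n.+1 -> R) :
  integral_rV f = \int[mu]_t integral_rV (slice f t).
Proof. by []. Qed.

Lemma norm_slice_ge n (t : R) (x : 'rV[R]_n) :
  `|t| <= `|row_mx (t%:M : 'rV[R]_1) x| /\ `|x| <= `|row_mx (t%:M : 'rV[R]_1) x|.
Proof.
split.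
  have := normr_rV_le (row_mx (t%:M : 'rV[R]_1) x) (lshift n 0).
  by rewrite row_mxEl mxE eqxx.
apply: rV_norm_le => // j.
by have := normr_rV_le (row_mx (t%:M : 'rV[R]_1) x) (rshift 1 j); rewrite row_mxEr.
Qed.

Lemma norm_slice_le n (t : R) (x : 'rV[R]_n) c : `|t| <= c -> `|x| <= c ->
  `|row_mx (t%:M : 'rV[R]_1) x| <= c.
Proof.
move=> tc xc; apply: rV_norm_le => [|j]; first exact: le_trans tc.
case: (split_ordP j) => k ->.
  by rewrite row_mxEl (ord1 k) mxE.
by rewrite row_mxEr; exact: le_trans (normr_rV_le _ _) xc.
Qed.

Lemma norm_slice_lt n (t : R) (x : 'rV[R]_n) c : `|t| < c -> `|x| < c ->
  `|row_mx (t%:M : 'rV[R]_1) x| < c.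
Proof.
move=> tc xc; apply: (@le_lt_trans _ _ (Num.max `|t| `|x|)); last by rewrite gt_max tc.
by apply: norm_slice_le; rewrite le_max lexx // orbT.
Qed.

Lemma slice_supported n B (f : 'rV[R]_n.+1 -> R) t : supported_in B f -> supported_in B (slice f t).
Proof. by move=> sf x Bx; apply: sf; apply: lt_le_trans Bx _; have [] := norm_slice_ge t x. Qed.

Lemma slice_out n B (f : 'rV[R]_n.+1 -> R) t : supported_in B f -> B < `|t| -> slice f t = fun=> 0.
Proof.
move=> sf Bt; apply/funext => x; apply: sf; apply: lt_le_trans Bt _.
by have [] := norm_slice_ge t x.
Qed.

Lemma row_mx_sub n (s t : R) (x y : 'rV[R]_n) :
  row_mx (s%:M : 'rV[R]_1) x - row_mx (t%:M : 'rV[R]_1) y = row_mx ((s - t)%:M : 'rV[R]_1) (x - y).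
Proof. by rewrite opp_row_mx add_row_mx raddfB. Qed.

Lemma slice_continuous n (f : 'rV[R]_n.+1 -> R) t : continuous f -> continuous (slice f t).
Proof.
move=> cf x; apply: continuous_comp; last exact: cf.
apply/(@cvgrPdist_lt _ _ _ (nbhs x)) => e e0; apply/nbhs_ballP; exists e => //= y.
rewrite -ball_normE /= => xy.
rewrite row_mx_sub subrr; apply: le_lt_trans xy; apply: norm_slice_le => //.
by rewrite normr0.
Qed.

(** The three properties are carried through one induction: together they make the inner integral
    continuous in the outer variable, hence integrable, and this is what each of them needs in the
    next dimension. *)
Definition integral_rV_spec n :=
  [/\ forall B (f g : 'rV[R]_n -> R), 0 <= B -> continuous f -> continuous g ->
        supported_in B f -> supported_in B g ->
        integral_rV (fun x => f x + g x) = integral_rV f + integral_rV g,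
      forall B (c : R) (f : 'rV[R]_n -> R), 0 <= B -> continuous f -> supported_in B f ->
        integral_rV (fun x => c * f x) = c * integral_rV f &
      forall B c (f : 'rV[R]_n -> R), 0 <= B -> continuous f -> supported_in B f ->
        (forall x, `|f x| <= c) -> `|integral_rV f| <= c * (2 * B) ^+ n].

Lemma integral_rV0_of_spec n : integral_rV_spec n -> integral_rV (fun _ : 'rV[R]_n => 0) = 0.
Proof.
move=> [_ IZ _].
rewrite -[RHS](mul0r (integral_rV (fun _ : 'rV[R]_n => 0))) -(IZ 0) //.
  by congr integral_rV; apply/funext => x; rewrite mulr0.
by move=> x; exact: cst_continuous.
Qed.

Lemma integral_rV_dist n B c (f g : 'rV[R]_n -> R) : integral_rV_spec n ->
  0 <= B -> continuous f -> continuous g -> supported_in B f -> supported_in B g ->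
  (forall x, `|f x - g x| <= c) -> `|integral_rV f - integral_rV g| <= c * (2 * B) ^+ n.
Proof.
move=> [ID IZ IB] B0 cf cg sf sg fg.
have cg' : continuous (fun x => (-1) * g x) by exact: continuousMl.
have sg' : supported_in B (fun x => (-1) * g x) by move=> x Bx; rewrite (sg x Bx) mulr0.
rewrite -mulN1r -(IZ B) // -(ID B) //; apply: IB => //.
- exact: continuous_add.
- by move=> x Bx; rewrite (sf x Bx) (sg' x Bx) addr0.
- by move=> x; rewrite mulN1r.
Qed.

(** Uniform continuity makes nearby slices uniformly close, and the sup bound passes this closeness
    to their integrals. *)
Lemma integral_slice_continuous n B (f : 'rV[R]_n.+1 -> R) : integral_rV_spec n ->
  0 <= B -> continuous f -> supported_in B f ->
  continuous (fun t => integral_rV (slice f t)).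
Proof.
move=> Hn B0 cf sf t; apply/cvgrPdist_le => e e0.
pose c := (2 * B) ^+ n + 1.
have c0 : 0 < c by rewrite ltr_wpDl // exprn_ge0 // mulr_ge0.
have [d d0 Hd] := compact_support_unif_continuous cf sf (divr_gt0 e0 c0).
apply/nbhs_ballP; exists d => //= s ts.
apply: le_trans (integral_rV_dist (c := e / c) Hn B0 _ _ (slice_supported t sf)
  (slice_supported s sf) _) _.
- exact: slice_continuous.
- exact: slice_continuous.
- move=> x; apply/ltW/Hd; rewrite row_mx_sub subrr.
  by apply: le_lt_trans ts; apply: norm_slice_le => //; rewrite normr0.
- by rewrite mulrAC ler_pdivrMr // ler_pM2l // /c lerDl.
Qed.

Lemma integral_slice_supported n B (f : 'rV[R]_n.+1 -> R) : integral_rV_spec n ->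
  supported_in B f -> supported_in (V := R) B (fun t => integral_rV (slice f t)).
Proof. by move=> Hn sf t Bt; rewrite (slice_out sf Bt) integral_rV0_of_spec. Qed.

Lemma integral_rV_linear n : integral_rV_spec n.
Proof.
elim: n => [|n Hn].
  by split => //= B c f B0 cf sf fc; rewrite mulr1; exact: fc.
have IC := integral_slice_continuous Hn; have IS := integral_slice_supported Hn.
have [ID IZ IB] := Hn; split.
- move=> B f g B0 cf cg sf sg; rewrite !integral_rVS.
  rewrite -(RintegralD (mu := mu)) //; last 2 first.
  + exact: compact_support_integrable (IC _ _ B0 cf sf) (IS _ _ sf).
  + exact: compact_support_integrable (IC _ _ B0 cg sg) (IS _ _ sg).
  congr Rintegral; apply/funext => t.
  by rewrite -(ID B) //; [exact: slice_continuous|exact: slice_continuous|exact: slice_supported|exact: slice_supported].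
- move=> B c f B0 cf sf; rewrite !integral_rVS.
  rewrite -(RintegralZl (mu := mu)) //; last exact: compact_support_integrable (IC _ _ B0 cf sf) (IS _ _ sf).
  congr Rintegral; apply/funext => t.
  by rewrite -(IZ B) //; [exact: slice_continuous|exact: slice_supported].
- move=> B c f B0 cf sf fc; rewrite integral_rVS.
  apply: le_trans (compact_support_Rintegral_le (c := c * (2 * B) ^+ n) B0 (IC _ _ B0 cf sf) (IS _ _ sf) _) _.
    by move=> t; apply: IB => // [||x]; [exact: slice_continuous|exact: slice_supported|exact: fc].
  by rewrite -mulrA -exprSr.
Qed.

Lemma integral_rV0 n : integral_rV (fun _ : 'rV[R]_n => 0) = 0.
Proof. exact: integral_rV0_of_spec (integral_rV_linear n). Qed.

Lemma integral_rV_sum n B (I : Type) (r : seq I) (f : I -> 'rV[R]_n -> R) : 0 <= B ->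
  (forall i, continuous (f i)) -> (forall i, supported_in B (f i)) ->
  integral_rV (fun x => \sum_(i <- r) f i x) = \sum_(i <- r) integral_rV (f i).
Proof.
move=> B0 cf sf; have [ID _ _] := integral_rV_linear n.
elim: r => [|i r IH].
  by rewrite big_nil; under eq_fun do rewrite big_nil; exact: integral_rV0.
rewrite big_cons -IH -(ID B) //.
- by congr integral_rV; apply/funext => x; rewrite big_cons.
- by move=> x; apply: (@cvg_sumr _ _ _ (nbhs x)) => j; exact: cf.
- by move=> x Bx; rewrite big1 // => j _; exact: sf.
Qed.

Lemma row_mx_line n (t h : R) (x : 'rV[R]_n) :
  row_mx (t%:M : 'rV[R]_1) x + h *: delta_mx ord0 (lshift n 0) = row_mx ((t + h)%:M : 'rV[R]_1) x.
Proof.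
apply/rowP => j; rewrite mxE [X in _ + X]mxE [X in h * X]mxE.
case: (split_ordP j) => k ->; rewrite ?row_mxEl ?row_mxEr.
  by rewrite (ord1 k) !eqxx mulr1 !mxE /=.
by rewrite eq_rlshift andbF mulr0 addr0.
Qed.

Lemma row_mx_delta n (t h : R) (x : 'rV[R]_n) (j : 'I_n) :
  row_mx (t%:M : 'rV[R]_1) x + h *: delta_mx ord0 (rshift 1 j) =
  row_mx (t%:M : 'rV[R]_1) (x + h *: delta_mx ord0 j).
Proof.
apply/rowP => l; rewrite mxE [X in _ + X]mxE [X in h * X]mxE.
case: (split_ordP l) => k ->; rewrite ?row_mxEl ?row_mxEr.
  by rewrite eq_lrshift andbF mulr0 addr0.
by rewrite !mxE eq_rshift.
Qed.

Lemma partial_slice n (f : 'rV[R]_n.+1 -> R) (j : 'I_n) t x :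
  derivable f (row_mx (t%:M : 'rV[R]_1) x) (delta_mx ord0 (rshift 1 j)) ->
  is_derive x (delta_mx ord0 j) (slice f t)
    (partial (rshift 1 j) f (row_mx (t%:M : 'rV[R]_1) x)).
Proof.
move=> df; apply: is_derive_of_line.
have := is_derive_line (s := 0) (x := row_mx (t%:M : 'rV[R]_1) x)
  (v := delta_mx ord0 (rshift 1 j)) (f := f).
rewrite scale0r addr0 => /(_ df).
by under eq_fun do rewrite row_mx_delta.
Qed.

Lemma partial_supported n B (f : 'rV[R]_n -> R) i : supported_in B f -> supported_in B (partial i f).
Proof.
move=> sf x Bx.
have oO : open [set y : 'rV[R]_n | B < `|y|].
  apply: (@open_comp _ _ (fun x : 'rV[R]_n => `|x|) [set r | B < r]); last exact: open_gt.
  by move=> y _; exact: norm_continuous.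
by rewrite (partial_ext (g := fun=> 0) i oO) // partial_cst.
Qed.

(** Differentiation under the integral sign. The mean value theorem makes the difference quotient a
    value of the partial derivative at a point shifted by at most |h|, so uniform continuity makes
    it converge uniformly in x. *)
Lemma is_derive_integral_slice n (B : R) (f : 'rV[R]_n.+1 -> R) (t : R) : 0 <= B -> continuous f ->
  (forall x, derivable f x (delta_mx ord0 (lshift n (0 : 'I_1)))) ->
  continuous (partial (lshift n (0 : 'I_1)) f) -> supported_in B f ->
  is_derive t (1 : R) (fun s => integral_rV (slice f s))
    (integral_rV (slice (partial (lshift n (0 : 'I_1)) f) t)).
Proof.
set i0 := lshift n (0 : 'I_1); move=> B0 cf df cdf sf.
have Hn := integral_rV_linear n; have [ID IZ _] := Hn.
have sdf : supported_in B (partial i0 f) := partial_supported i0 sf.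
have key : (fun h : R => h^-1 *: (integral_rV (slice f (h *: (1 : R) + t)) - integral_rV (slice f t)))
    @ 0^' --> integral_rV (slice (partial i0 f) t).
  apply/cvgrPdist_le => e e0.
  pose c := (2 * B) ^+ n + 1.
  have c0 : 0 < c by rewrite ltr_wpDl // exprn_ge0 // mulr_ge0.
  have [d d0 Hd] := compact_support_unif_continuous cdf sdf (divr_gt0 e0 c0).
  apply/nbhs_ballP; exists d => //= h; rewrite -ball_normE /= sub0r normrN => hd h0.
  rewrite [h%:A]mulr1 [h + t]addrC.
  pose q (x : 'rV[R]_n) : R := (h : R)^-1 * (slice f (t + h) x + (-1) * slice f t x).
  have cf1 := slice_continuous (t := t + h) cf; have cf2 := slice_continuous (t := t) cf.
  have sf1 := slice_supported (t + h) sf; have sf2 := slice_supported t sf.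
  have cf3 : continuous (fun x => (-1) * slice f t x) by exact: continuousMl.
  have sf3 : supported_in B (fun x => (-1) * slice f t x).
    by move=> x Bx; rewrite (sf2 x Bx) mulr0.
  have cf4 : continuous (fun x => slice f (t + h) x + (-1) * slice f t x).
    exact: continuous_add.
  have sf4 : supported_in B (fun x => slice f (t + h) x + (-1) * slice f t x).
    by move=> x Bx; rewrite (sf1 x Bx) (sf3 x Bx) addr0.
  have -> : h^-1 *: (integral_rV (slice f (t + h)) - integral_rV (slice f t)) = integral_rV q.
    by rewrite /q (IZ B) // (ID B) // (IZ B) // mulN1r.
  apply: le_trans (integral_rV_dist (c := e / c) Hn B0 _ _ (slice_supported t sdf) (_ : supported_in B q) _) _.
  - exact: slice_continuous.
  - exact: continuousMl.
  - by move=> x Bx; rewrite /q (sf4 x Bx) mulr0.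
  - move=> x.
    have [s sh E] : exists2 s : R, `|s| <= `|h| &
        f (row_mx (t%:M : 'rV[R]_1) x + h *: delta_mx ord0 i0) - f (row_mx (t%:M : 'rV[R]_1) x) =
        h * 'D_(delta_mx ord0 i0) f (row_mx (t%:M : 'rV[R]_1) x + s *: delta_mx ord0 i0).
      by apply: MVT_line => s _; exact: df.
    rewrite /q /slice mulN1r -row_mx_line E mulKf // row_mx_line.
    apply/ltW/Hd; rewrite row_mx_sub subrr opprD addrA subrr sub0r.
    apply: norm_slice_lt; last by rewrite normr0.
    by rewrite normrN; exact: le_lt_trans hd.
  - by rewrite mulrAC ler_pdivrMr // ler_pM2l // /c lerDl.
split; first by apply/cvg_ex; eexists; exact: key.
exact: cvg_lim key.
Qed.

(** A derivative in the first variable comes out of the inner integral and is annihilated by the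
    outer one; for any other variable the inner integral vanishes by induction. *)
Lemma integral_rV_partial n B (f : 'rV[R]_n -> R) i : 0 <= B -> continuous f ->
  (forall x, derivable f x (delta_mx ord0 i)) -> continuous (partial i f) ->
  supported_in B f -> integral_rV (partial i f) = 0.
Proof.
elim: n B f i => [|n IH] B f i B0 cf df cdf sf; first by case: i df cdf.
have sdf := partial_supported i sf.
rewrite integral_rVS; move: (i) df cdf sdf; rewrite -[n.+1]/(1 + n)%N => {}i.
case: (split_ordP i) => k -> df cdf sdf; last first.
  have E t : slice (partial (rshift 1 k) f) t = partial k (slice f t).
    by apply/funext => x; apply/esym/derive_val; exact: partial_slice.
  under eq_Rintegral => t _ do rewrite E.
  rewrite (_ : (fun t => integral_rV (partial k (slice f t))) = fun=> 0).
    by rewrite Rintegral_cst // mul0r.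
  apply/funext => t; apply: (IH B) => //.
  - exact: slice_continuous.
  - by move=> x; apply: ex_derive; exact: partial_slice.
  - by rewrite -E; exact: slice_continuous.
  - exact: slice_supported.
rewrite (ord1 k) in df cdf sdf *.
have Hn := integral_rV_linear n.
apply: (@Rintegral_derivative0 _ B (fun t => integral_rV (slice f t))) => //.
- exact: integral_slice_continuous Hn B0 cdf sdf.
- by move=> t; exact: is_derive_integral_slice cf df cdf sf.
- exact: integral_slice_supported Hn sf.
- exact: integral_slice_supported Hn sdf.
Qed.
End IteratedIntegral.

(** * Fields on the manifold *)

Section Flux.
Context {R : realType} {n : nat} (O O' : set 'rV[R]_n) (oO : open O) (oO' : open O').
Variables (phi : 'rV[R]_n -> 'rV[R]_n) (G G' : 'rV[R]_n -> 'M[R]_n).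
Hypothesis phiO : forall x, O x -> O' (phi x).
Hypothesis Cphi : forall l, smooth_on O (fun y => phi y ord0 l).
Hypothesis HG : forall k, Ck_mx O' k G.
Hypothesis symG : forall x, O' x -> (G x)^T = G x.
Hypothesis uG : forall x, O' x -> G x \in unitmx.
Hypothesis HG' : forall k, Ck_mx O k G'.
Hypothesis symG' : forall x, O x -> (G' x)^T = G' x.
Hypothesis uG' : forall x, O x -> G' x \in unitmx.
Hypothesis GE : forall x, O x -> G' x = jacobian_mx phi x *m G (phi x) *m (jacobian_mx phi x)^T.
Implicit Types (w z : 'I_n -> 'rV[R]_n -> R).

Lemma pullback1D w' w z' z : pullback1 O phi w' w -> pullback1 O phi z' z ->
  pullback1 O phi (fun i y => w' i y + z' i y) (fun i y => w i y + z i y).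
Proof.
have E (a b : 'I_n -> 'rV[R]_n -> R) y :
  form_col (fun i y => a i y + b i y) y = form_col a y + form_col b y.
  by apply/matrixP => i j; rewrite !mxE.
by move=> ww zz x Ox; rewrite !E (ww x Ox) (zz x Ox) mulmxDr.
Qed.

Lemma pullback1M (f' f : 'rV[R]_n -> R) w' w : (forall x, O x -> f' x = f (phi x)) ->
  pullback1 O phi w' w -> pullback1 O phi (fun i y => f' y * w' i y) (fun i y => f y * w i y).
Proof.
have E (a : 'rV[R]_n -> R) (b : 'I_n -> 'rV[R]_n -> R) y :
  form_col (fun i y => a y * b i y) y = a y *: form_col b y.
  by apply/matrixP => i j; rewrite !mxE.
by move=> ff ww x Ox; rewrite !E (ww x Ox) (ff x Ox) -scalemxAr.
Qed.

Lemma pullback_paneitz_flux v' v : (forall y, O y -> v' y = v (phi y)) -> smooth_on O' v ->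
  pullback1 O phi (paneitz_flux G' v') (paneitz_flux G v).
Proof.
move=> vv Hv; have Hlap := smooth_laplacian oO' HG uG Hv.
have pl y : O y -> laplacian G' v' y = laplacian G v (phi y).
  move=> Oy; exact: (pullback_laplacian oO oO' phiO Cphi HG symG uG uG' GE vv (Hv 2%N) Oy).
have pdv := pullback_differential oO oO' phiO Cphi vv (Hv 1%N).
have pdl := pullback_differential oO oO' phiO Cphi pl (Hlap 1%N).
have pN := pullback_nabla oO oO' phiO Cphi HG symG uG uG' GE pdv
  (fun i => Ck_on_partial i (Hv 2%N)).
have pT := pullback_paneitz_tensor oO oO' phiO Cphi HG symG uG HG' symG' uG' GE.
have pc (c : R) w' w : pullback1 O phi w' w ->
    pullback1 O phi (fun i y => c * w' i y) (fun i y => c * w i y).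
  exact: (pullback1M (f' := fun=> c) (f := fun=> c) (fun _ _ => erefl)).
apply: pullback1D; first exact: pullback1M.
apply: pullback1D; first exact: (pc _ _ _ (pullback1M pl pdv)).
apply: pullback1D.
  exact: (pc _ _ _ (pullback1M vv (pullback_contract phiO uG uG' GE pT pdv))).
exact: (pc _ _ _ (pullback_contract phiO uG uG' GE pN pdv)).
Qed.

End Flux.

(** * Charts, transition maps and functions defined chart by chart *)

Section Charts.
Context {R : realType} {n : nat} {M : ptopologicalType}.
Variables (A : smooth_atlas R n M) (g : riemannian_metric A).
Implicit Types (i j : chart A) (p : M) (x : 'rV[R]_n) (F : chart A -> 'rV[R]_n -> R).

Definition chart_codom i : set 'rV[R]_n := Defs.coord A i @` dom A i.
Definition overlap i j : set 'rV[R]_n := Defs.coord A i @` (dom A i `&` dom A j).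
Definition transition i j x : 'rV[R]_n := Defs.coord A j (param A i x).

Lemma open_chart_codom i : open (chart_codom i). Proof. exact: codom_open. Qed.

Lemma coordKx i x : chart_codom i x -> Defs.coord A i (param A i x) = x.
Proof. by move=> [p dp <-]; rewrite coordK. Qed.

Lemma param_dom i x : chart_codom i x -> dom A i (param A i x).
Proof. by move=> [p dp <-]; rewrite coordK. Qed.

Lemma codom_coord i p : dom A i p -> chart_codom i (Defs.coord A i p).
Proof. by move=> dp; exists p. Qed.

Lemma overlapP i j x : overlap i j x <-> chart_codom i x /\ dom A j (param A i x).
Proof.
split=> [[p [di dj] <-]|[ci dj]]; first by rewrite coordK //; split => //; exists p.
by exists (param A i x); [split => //; exact: param_dom|rewrite coordKx].
Qed.

Lemma open_preimage_param i (U : set M) : open U ->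
  open [set x | chart_codom i x /\ U (param A i x)].
Proof.
move=> oU; rewrite openE => x [ci Ux].
have n1 : nbhs x (chart_codom i) by apply: open_nbhs_nbhs; split => //; exact: open_chart_codom.
have n2 : nbhs x (param A i @^-1` U).
  by apply: (param_continuous ci); apply: open_nbhs_nbhs.
exact: filterI n1 n2.
Qed.

Lemma open_overlap i j : open (overlap i j).
Proof.
have -> : overlap i j = [set x | chart_codom i x /\ dom A j (param A i x)].
  by apply/seteqP; split => x /overlapP.
by apply: open_preimage_param; exact: dom_open.
Qed.

Lemma transition_codom i j x : overlap i j x -> chart_codom j (transition i j x).
Proof. by move=> /overlapP[_ dj]; exact: codom_coord. Qed.

Lemma param_transition i j x : overlap i j x -> param A j (transition i j x) = param A i x.
Proof. by move=> /overlapP[_ dj]; rewrite /transition coordK. Qed.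

Lemma Ck_coeff i k : Ck_mx (chart_codom i) k (coeff g i).
Proof. by move=> a b; exact: (coeff_smooth g i a b k). Qed.

Lemma sym_coeff i x : chart_codom i x -> (coeff g i x)^T = coeff g i x.
Proof. by move=> [p dp <-]; exact: coeff_sym. Qed.

Lemma posdef_coeff i x : chart_codom i x -> posdef_mx (coeff g i x).
Proof. by move=> [p dp <-] v v0; exact: coeff_posdef. Qed.

Lemma unit_coeff i x : chart_codom i x -> coeff g i x \in unitmx.
Proof. by move=> cx; exact: posdef_unit (posdef_coeff cx). Qed.

Lemma overlap_codom i j x : overlap i j x -> chart_codom i x.
Proof. by move=> /overlapP[]. Qed.

Lemma coeff_pullback i j x : overlap i j x ->
  coeff g i x = jacobian_mx (transition i j) x *m coeff g j (transition i j x)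
                *m (jacobian_mx (transition i j) x)^T.
Proof.
move=> [p [di dj] <-]; apply/matrixP => a b.
rewrite (coeff_transition g a b di dj) mxE exchange_big /=; apply: eq_bigr => d _.
rewrite mxE mulr_suml; apply: eq_bigr => c _; rewrite !mxE.
by rewrite /transition coordK // mulrAC.
Qed.

(** Since [chart_at] may jump from point to point, regularity of [from_charts F] is accessible only
    under this condition, which allows F to be evaluated in one fixed chart near a point. *)
Definition chart_invariant F :=
  forall i j x, overlap i j x -> F i x = F j (transition i j x).

Lemma from_chartsE F i p : chart_invariant F -> dom A i p ->
  from_charts F p = F i (Defs.coord A i p).
Proof.
move=> inv dp; rewrite /from_charts; set j := @chart_at _ _ _ A p.
have dj : dom A j p by rewrite /j /chart_at; case: (cid _).
have ov : overlap i j (Defs.coord A i p) by exists p.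
by rewrite (inv i j _ ov) /transition coordK.
Qed.

Lemma chart_at_dom p : dom A (@chart_at _ _ _ A p) p.
Proof. by rewrite /chart_at; case: (cid _). Qed.

Lemma from_charts_param F i x : chart_invariant F -> chart_codom i x ->
  from_charts F (param A i x) = F i x.
Proof. by move=> inv cx; rewrite (from_chartsE inv (param_dom cx)) coordKx. Qed.

Lemma continuous_in_charts (u : M -> R) :
  (forall i, Ck_on 0 (chart_codom i) (u \o param A i)) -> continuous u.
Proof.
move=> Hu p; pose i := @chart_at _ _ _ A p; have dp : dom A i p := chart_at_dom p.
have nd : nbhs p (dom A i) by apply: open_nbhs_nbhs; split => //; exact: dom_open.
have c1 : {for p, continuous ((u \o param A i) \o Defs.coord A i)}.
  apply: continuous_comp; first exact: Defs.coord_continuous.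
  exact: (Hu i _ (codom_coord dp)).
have E : {near p, (u \o param A i) \o Defs.coord A i =1 u}.
  by apply: filterS nd => q dq /=; rewrite coordK.
rewrite /continuous_at -{2}(coordK dp).
exact: cvg_trans (near_eq_cvg E) c1.
Qed.

Lemma from_charts_continuous F : chart_invariant F ->
  (forall i, Ck_on 0 (chart_codom i) (F i)) -> continuous (from_charts F).
Proof.
move=> inv HF; apply: continuous_in_charts => i.
have E y : chart_codom i y -> F i y = (from_charts F \o param A i) y.
  by move=> cy; rewrite /= from_charts_param.
exact: (Ck_on_ext (@open_chart_codom i) E (HF i)).
Qed.

Lemma smooth_fun_invariant u : chart_invariant (fun i => u \o param A i).
Proof. by move=> i j x ov; rewrite /= param_transition. Qed.

End Charts.

(** * Chart invariance and regularity of the geometric fields *)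

Section GeometricFields.
Context {R : realType} {n : nat} {M : ptopologicalType}.
Variables (A : smooth_atlas R n M) (g : riemannian_metric A).
Implicit Types (i j : chart A) (p : M) (x : 'rV[R]_n) (u : M -> R).

Let oOv i j := @open_overlap R n M A i j.
Let oC i := @open_chart_codom R n M A i.
Let tC i j := @transition_codom R n M A i j.
Let Ctr i j l : smooth_on (overlap i j) (fun y => transition i j y ord0 l).
Proof. exact: transition_smooth. Qed.
Let HG i k := @Ck_coeff R n M A g i k.
Let symG i := @sym_coeff R n M A g i.
Let uG i := @unit_coeff R n M A g i.
Let pG i := @posdef_coeff R n M A g i.
Let HGo i j k : Ck_mx (overlap i j) k (coeff g i).
Proof. by move=> a b; apply: (Ck_on_sub _ (@HG i k a b)) => x; exact: overlap_codom. Qed.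
Let symGo i j x (ov : overlap i j x) := symG (overlap_codom ov).
Let uGo i j x (ov : overlap i j x) := uG (overlap_codom ov).
Let GE i j := @coeff_pullback R n M A g i j.

Definition chart_form (w : chart A -> 'I_n -> 'rV[R]_n -> R) :=
  forall i j, pullback1 (overlap i j) (transition i j) (w i) (w j).

Lemma chart_invariant_scalar_curv : chart_invariant (fun i => scalar_curv (coeff g i)).
Proof.
move=> i j x ov.
exact: (pullback_scalar_curv (@oOv i j) (@oC j) (@tC i j) (@Ctr i j)
  (@HG j) (@symG j) (@uG j) (@HGo i j) (@symGo i j) (@uGo i j) (@GE i j) ov).
Qed.

Lemma chart_invariant_Q : chart_invariant (fun i => local_Q (coeff g i)).
Proof.
move=> i j x ov.
exact: (pullback_local_Q (@oOv i j) (@oC j) (@tC i j) (@Ctr i j)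
  (@HG j) (@symG j) (@uG j) (@HGo i j) (@symGo i j) (@uGo i j) (@GE i j) ov).
Qed.

Lemma chart_invariant_divergence w : chart_form w ->
  (forall i a, Ck_on 1 (chart_codom i) (w i a)) ->
  chart_invariant (fun i => divergence (coeff g i) (w i)).
Proof.
move=> iw Hw i j x ov.
exact: (pullback_divergence (@oOv i j) (@oC j) (@tC i j) (@Ctr i j)
  (@HG j) (@symG j) (@uG j) (@uGo i j) (@GE i j) (iw i j) (Hw j) ov).
Qed.

Section Function.
Variables (u : M -> R) (Hu : smooth_fun A u).

Let uu i j x : overlap i j x -> (u \o param A i) x = (u \o param A j) (transition i j x).
Proof. exact: smooth_fun_invariant. Qed.

Let Hdu i a : smooth_on (chart_codom i) (differential (u \o param A i) a).
Proof. exact: smooth_on_partial (Hu i). Qed.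

Let pdu i j := pullback_differential (@oOv i j) (@oC j) (@tC i j) (@Ctr i j)
  (@uu i j) (Hu j 1%N).

Lemma chart_invariant_paneitz :
  chart_invariant (fun i => local_paneitz (coeff g i) (u \o param A i)).
Proof.
move=> i j x ov.
exact: (pullback_local_paneitz (@oOv i j) (@oC j) (@tC i j) (@Ctr i j)
  (@HG j) (@symG j) (@uG j) (@HGo i j) (@symGo i j) (@uGo i j) (@GE i j) (@uu i j) (Hu j) ov).
Qed.

Lemma chart_invariant_grad :
  chart_invariant (fun i => sqnorm1 (coeff g i) (differential (u \o param A i))).
Proof.
move=> i j x ov.
exact: (pullback_inner1 (@tC i j) (@uG j) (@uGo i j) (@GE i j)
  (@pdu i j) (@pdu i j) ov).
Qed.

Lemma chart_invariant_hess :
  chart_invariant (fun i => sqnorm2 (coeff g i)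
     (nabla (coeff g i) (differential (u \o param A i)))).
Proof.
move=> i j x ov.
have pn := pullback_nabla (@oOv i j) (@oC j) (@tC i j) (@Ctr i j)
  (@HG j) (@symG j) (@uG j) (@uGo i j) (@GE i j) (@pdu i j) (fun a => Hdu j a 1%N).
exact: (pullback_inner2 (@tC i j) (@uG j) (@uGo i j) (@GE i j) pn pn ov).
Qed.

Lemma chart_form_flux : chart_form (fun i => paneitz_flux (coeff g i) (u \o param A i)).
Proof.
move=> i j.
exact: (pullback_paneitz_flux (@oOv i j) (@oC j) (@tC i j) (@Ctr i j)
  (@HG j) (@symG j) (@uG j) (@HGo i j) (@symGo i j) (@uGo i j) (@GE i j) (@uu i j) (Hu j)).
Qed.

Lemma smooth_flux i a : smooth_on (chart_codom i) (paneitz_flux (coeff g i) (u \o param A i) a).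
Proof. exact: (smooth_paneitz_flux (@oC i) (@HG i) (@pG i) a (Hu i)). Qed.

Lemma paneitz_identity_chart i x : chart_codom i x ->
  (u \o param A i) x * local_paneitz (coeff g i) (u \o param A i) x =
  paneitz_energy (coeff g i) (u \o param A i) x +
  divergence (coeff g i) (paneitz_flux (coeff g i) (u \o param A i)) x.
Proof.
by move=> cx; exact: (paneitz_identity (@oC i) (@HG i) (@symG i) (@pG i) (Hu i) cx).
Qed.

(** The energy is u P u minus the divergence of the flux, and both of these are already known to be
    invariant. *)
Lemma chart_invariant_energy :
  chart_invariant (fun i => paneitz_energy (coeff g i) (u \o param A i)).
Proof.
move=> i j x ov.
have E1 := paneitz_identity_chart (overlap_codom ov).
have E2 := paneitz_identity_chart (tC ov).
rewrite -(uu ov) -(chart_invariant_paneitz ov) E1 in E2.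
have E3 := chart_invariant_divergence chart_form_flux (fun i a => @smooth_flux i a 1%N) ov.
by rewrite E3 in E2; exact: addIr E2.
Qed.

Lemma smooth_grad i : smooth_on (chart_codom i)
  (sqnorm1 (coeff g i) (differential (u \o param A i))).
Proof.
move=> k; apply: (Ck_inner1 (@oC i) (@HG i) (@uG i)) => a; exact: (Hdu i a k).
Qed.

Lemma smooth_hess i : smooth_on (chart_codom i)
  (sqnorm2 (coeff g i) (nabla (coeff g i) (differential (u \o param A i)))).
Proof.
move=> k; apply: (Ck_inner2 (@oC i) (@HG i) (@uG i)) => a b;
  by apply: (Ck_nabla (@oC i) (@HG i) (@uG i)) => c; exact: (Hdu i c k.+1).
Qed.

Lemma smooth_Q i : smooth_on (chart_codom i) (local_Q (coeff g i)).
Proof.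
have oCi := @oC i; have HGi := @HG i; have uGi := @uG i.
have Hs := smooth_scalar_curv oCi HGi uGi.
have Hr : smooth_on (chart_codom i) (sqnorm2 (coeff g i) (ricci (coeff g i))).
  by move=> k; apply: (Ck_inner2 oCi HGi uGi) => a b; exact: (smooth_ricci oCi HGi uGi).
have cst c := smooth_on_cst (chart_codom i) c.
apply: smooth_onB => //; last exact: smooth_onM.
apply: smooth_onD => //.
  by apply: smooth_onM => //; exact: (smooth_laplacian oCi HGi uGi Hs).
by apply: smooth_onM => //; rewrite /GRing.exp /=; exact: smooth_onM.
Qed.

Lemma smooth_energy i : smooth_on (chart_codom i) (paneitz_energy (coeff g i) (u \o param A i)).
Proof.
have oCi := @oC i; have HGi := @HG i; have uGi := @uG i.
have Hs := smooth_scalar_curv oCi HGi uGi.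
have Hl := smooth_laplacian oCi HGi uGi (Hu i).
have cst c := smooth_on_cst (chart_codom i) c.
have Hg := smooth_grad i; have Hh := smooth_hess i; have HQ := smooth_Q i; have Hui := Hu i.
apply: smooth_onD => //.
  apply: smooth_onD => //.
    apply: smooth_onD => //; last exact: smooth_onM.
    by apply: smooth_onM => //; exact: smooth_onM.
  by apply: smooth_onM => //; exact: smooth_onM.
apply: smooth_onM => //; first exact: smooth_onM.
exact: smooth_onM.
Qed.

End Function.
End GeometricFields.

(** * Cutoff functions and the divergence theorem *)

Lemma Ck_on_local (R : realType) n k (O : set 'rV[R]_n) (f : 'rV[R]_n -> R) :
  (forall x, O x -> exists U, [/\ open U, U x & Ck_on k U f]) -> Ck_on k O f.
Proof.
elim: k f => [|k IH] f Hf.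
  by move=> x /Hf [U [_ Ux cf]]; exact: cf.
move=> i; split.
  by move=> x /Hf [U [_ Ux cf]]; have [df _] := cf i; exact: df.
apply: IH => x /Hf [U [oU Ux cf]]; exists U; split => //.
exact: Ck_on_partial.
Qed.

Section Bump.
Context {R : realType}.

(* Cutoffs of class C^1 are enough here: the divergence theorem differentiates them once. *)
Definition ramp (t : R) : R := Num.max 0 t ^+ 2.

Lemma ramp_ge0 t : 0 <= ramp t. Proof. exact: sqr_ge0. Qed.

Lemma ramp_gt0 t : (0 < ramp t) = (0 < t).
Proof.
rewrite /ramp; case: (ltP 0 t) => t0; first by rewrite exprn_gt0.
by rewrite expr0n /= ltxx.
Qed.

Lemma is_derive_ramp (t : R) : is_derive t (1 : R) ramp (2 * Num.max 0 t).
Proof.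
(* A quadratic error bound valid across the kink at 0, checked in the four sign cases of t and t +
   h. *)
have bd h : `|ramp (t + h) - ramp t - 2 * Num.max 0 t * h| <= h ^+ 2.
  rewrite /ramp ler_norml.
  by case: (leP 0 (t + h)); case: (leP 0 t) => t0 th0; apply/andP; split; nra.
have key : (fun h : R => h^-1 *: (ramp (h *: (1 : R) + t) - ramp t)) @ 0^' --> 2 * Num.max 0 t.
  apply/cvgrPdist_le => e e0; apply/nbhs_ballP; exists e => //= h.
  rewrite -ball_normE /= sub0r normrN => he h0; rewrite [h%:A]mulr1 [h + t]addrC.
  have -> : 2 * Num.max 0 t - h^-1 *: (ramp (t + h) - ramp t) =
      - (h^-1 * (ramp (t + h) - ramp t - 2 * Num.max 0 t * h)).
    by rewrite /GRing.scale /=; field.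
  rewrite normrN normrM normfV ler_pdivrMl ?normr_gt0 //.
  apply: le_trans (bd h) _; rewrite -real_normK ?num_real // expr2.
  by rewrite ler_wpM2l // ltW.
split; first by apply/cvg_ex; eexists; exact: key.
exact: cvg_lim key.
Qed.

Context {n : nat}.
Implicit Types (c x : 'rV[R]_n) (r : R).

(** Balls of the max norm are cubes, so a product over the coordinates is positive inside the ball
    and of class C^1, although the norm itself is not. *)
Definition cube_bump c r x : R := \prod_(k < n) ramp (r ^+ 2 - (x ord0 k - c ord0 k) ^+ 2).

Lemma Ck1_cube_bump c r (O : set 'rV[R]_n) : open O -> Ck_on 1 O (cube_bump c r).
Proof.
move=> oO; apply: Ck_on_prod => // k.
apply: (@Ck1_comp1 _ _ _ ramp (fun t => 2 * Num.max 0 t)) => //.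
- apply: Ck_onB => //; first exact: Ck_on_cst.
  have Hk : Ck_on 1 O (fun x => x ord0 k - c ord0 k).
    by apply: Ck_onB => //; [exact: smooth_on_coord|exact: Ck_on_cst].
  exact: Ck_onM.
- by move=> x _; exact: is_derive_ramp.
- move=> x _; apply: cvgMl_tmp; apply: (@continuous_max _ _ (fun=> 0) id) => //.
  exact: cst_continuous.
Qed.

Lemma cube_bump_ge0 c r x : 0 <= cube_bump c r x.
Proof. by apply: prodr_ge0 => k _; exact: ramp_ge0. Qed.

Lemma cube_bump_gt0 c r x : `|x - c| < r -> 0 < cube_bump c r x.
Proof.
move=> xr; apply: prodr_gt0 => k _; rewrite ramp_gt0 subr_gt0.
have := normr_rV_le (x - c) k; rewrite !mxE => /le_lt_trans/(_ xr) H.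
by rewrite -real_normK ?num_real // ltr_pXn2r // nnegrE ?normr_ge0 // (le_trans _ (ltW H)).
Qed.

Lemma cube_bump_support c r x : 0 < r -> r < `|x - c| -> cube_bump c r x = 0.
Proof.
move=> r0 xr; apply/eqP; apply: contraTT xr => b0; rewrite -leNgt.
apply: rV_norm_le => [|k]; first exact: ltW.
rewrite leNgt; apply: contra_neqN b0; rewrite !mxE => H.
rewrite /cube_bump (bigD1 k) //= [X in X * _](_ : _ = 0) ?mul0r //.
apply/eqP; rewrite eq_le ramp_ge0 andbT leNgt ramp_gt0 -leNgt subr_le0.
by rewrite -[leRHS]real_normK ?num_real // ler_pXn2r // ?nnegrE ?ltW // (lt_trans r0).
Qed.

End Bump.

(** * Cutoff functions on the manifold *)

Section Cutoff.
Context {R : realType} {n : nat} {M : ptopologicalType}.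
Hypothesis M_hausdorff : hausdorff_space M.
Variable A : smooth_atlas R n M.
Implicit Types (i j : chart A) (p q : M) (c x : 'rV[R]_n) (r : R).

Definition cball c r := [set x : 'rV[R]_n | `|x - c| <= r].

Lemma continuous_dist c : continuous (fun x : 'rV[R]_n => `|x - c|).
Proof.
move=> x; apply: (@continuous_comp _ _ _ (fun x => x - c) (fun x => `|x|)); last exact: norm_continuous.
exact: (@cvgB _ _ _ (nbhs x) _ id (cst c) x c cvg_id (cvg_cst c)).
Qed.

Lemma closed_cball c r : closed (cball c r).
Proof.
apply: (@closed_comp _ _ (fun x : 'rV[R]_n => `|x - c|) [set s | s <= r]); last exact: closed_le.
by move=> x _; exact: continuous_dist.
Qed.

Lemma compact_cball c r : compact (cball c r).
Proof.
apply: bounded_closed_compact; last exact: closed_cball.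
exists (`|c| + r); split => [|s rs x /= xr]; first exact: num_real.
rewrite -(subrK c x) (le_trans (ler_normD _ _)) // (le_trans _ (ltW rs)) // addrC lerD2l.
by [].
Qed.

Lemma compact_param_cball i c r : cball c r `<=` chart_codom i ->
  compact (param A i @` cball c r).
Proof.
move=> sub; apply: continuous_compact; last exact: compact_cball.
apply: continuous_in_subspaceT => x /set_mem xc.
exact: (param_continuous (sub _ xc)).
Qed.

Definition cutoff i c r p : R :=
  if `[< dom A i p >] then cube_bump c r (Defs.coord A i p) else 0.

Lemma cutoff_ge0 i c r p : 0 <= cutoff i c r p.
Proof. by rewrite /cutoff; case: ifP => // _; exact: cube_bump_ge0. Qed.

Lemma cutoff_support i c r p : 0 < r -> ~ (param A i @` cball c r) p -> cutoff i c r p = 0.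
Proof.
move=> r0 np; rewrite /cutoff; case: asboolP => // dp.
apply: cube_bump_support => //; rewrite ltNge; apply/negP => H; apply: np.
by exists (Defs.coord A i p) => //; rewrite coordK.
Qed.

Definition Ck_fun k (u : M -> R) := forall i, Ck_on k (chart_codom i) (u \o param A i).

(** In another chart the cutoff is a bump composed with a transition map where the domains overlap,
    and zero away from the image of the closed ball. That image is compact, hence closed as M is
    Hausdorff, so every point has a neighborhood of one of the two kinds. *)
Lemma Ck1_cutoff i c r : 0 < r -> cball c r `<=` chart_codom i -> Ck_fun 1 (cutoff i c r).
Proof.
move=> r0 sub j; apply: Ck_on_local => x cx.
have clK := compact_closed M_hausdorff (compact_param_cball sub).
have [dx|ndx] := pselect (dom A i (param A j x)).
  have ov : overlap j i x by apply/overlapP.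
  exists (overlap j i); split => //; first exact: open_overlap.
  have oU := @open_overlap _ _ _ A j i.
  have H : Ck_on 1 (overlap j i) (cube_bump c r \o transition j i).
    apply: (@Ck_on_comp _ _ _ 1 (overlap j i) (chart_codom i)) => //.
    - exact: open_chart_codom.
    - exact: transition_codom.
    - by move=> l; exact: (@transition_smooth _ _ _ A j i l 1%N).
    - move=> y oy; apply: continuous_rV => l; exact: (@transition_smooth _ _ _ A j i l 0%N).
    - by apply: Ck1_cube_bump; exact: open_chart_codom.
  apply: (Ck_on_ext oU _ H) => y /overlapP[cy dy].
  by rewrite /= /cutoff asboolT.
exists [set y | chart_codom j y /\ (~` (param A i @` cball c r)) (param A j y)].
have oU : open [set y | chart_codom j y /\ (~` (param A i @` cball c r)) (param A j y)].
  by apply: open_preimage_param; exact: closed_openC.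
split => //.
  split => // -[y yc E]; apply: ndx; rewrite -E; apply: param_dom; exact: sub.
apply: (Ck_on_ext oU _ (Ck_on_cst 1 _ 0)) => y [cy ny].
by rewrite /= cutoff_support.
Qed.

Lemma chart_radius p : exists r, 0 < r /\
  cball (Defs.coord A (@chart_at _ _ _ A p) p) r `<=` chart_codom (@chart_at _ _ _ A p).
Proof.
set i := chart_at p; set c := Defs.coord A i p.
have cc : chart_codom i c by apply: codom_coord; exact: chart_at_dom.
have /nbhs_ballP[e /= e0 He] : nbhs c (chart_codom i).
  by apply: open_nbhs_nbhs; split => //; exact: open_chart_codom.
exists (e / 2); split; first by rewrite divr_gt0.
move=> x /= xc; apply: He; rewrite -ball_normE /= distrC (le_lt_trans xc) //.
by rewrite ltr_pdivrMr // ltr_pMr // ltr1n.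
Qed.

Definition cutoff_radius p : R := projT1 (cid (chart_radius p)).
Definition cutoff_center p := Defs.coord A (@chart_at _ _ _ A p) p.

Lemma cutoff_radius_gt0 p : 0 < cutoff_radius p.
Proof. by rewrite /cutoff_radius; case: cid => r []. Qed.

Lemma cball_cutoff_radius p : cball (cutoff_center p) (cutoff_radius p) `<=` chart_codom (@chart_at _ _ _ A p).
Proof. by rewrite /cutoff_radius; case: cid => r []. Qed.

Definition chart_cutoff p := cutoff (@chart_at _ _ _ A p) (cutoff_center p) (cutoff_radius p).

(** Each point lies in the open set where its own cutoff is positive; compactness extracts finitely
    many, and the other terms of the sum are nonnegative. *)
Lemma chart_cutoff_cover : compact [set: M] ->
  exists s : seq M, forall q, 0 < \sum_(p <- s) chart_cutoff p q.
Proof.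
rewrite compact_cover => /(_ M setT
  (fun p => [set q | dom A (@chart_at _ _ _ A p) q /\
       `|Defs.coord A (@chart_at _ _ _ A p) q - cutoff_center p| < cutoff_radius p])) [].
- move=> p _; rewrite openE => q [dq qr]; set i := chart_at p.
  have n1 : nbhs q (dom A i) by apply: open_nbhs_nbhs; split => //; exact: dom_open.
  have n2 : \forall q' \near q, `|Defs.coord A i q' - cutoff_center p| < cutoff_radius p.
    have oB : open [set x : 'rV[R]_n | `|x - cutoff_center p| < cutoff_radius p].
      apply: (@open_comp _ _ (fun x : 'rV[R]_n => `|x - cutoff_center p|) [set s | s < cutoff_radius p]); last exact: open_lt.
      by move=> x _; exact: continuous_dist.
    have nB : nbhs (Defs.coord A i q) [set x : 'rV[R]_n | `|x - cutoff_center p| < cutoff_radius p].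
      by apply: open_nbhs_nbhs.
    exact: (@Defs.coord_continuous _ _ _ A i q dq _ nB).
  exact: filterI n1 n2.
- move=> q _; exists q => //; split; first exact: chart_at_dom.
  by rewrite subrr normr0 cutoff_radius_gt0.
move=> D _ cov; exists (enum_fset D) => q.
have [p pD [dq qr]] := cov q I.
have c0 : 0 < chart_cutoff p q by rewrite /chart_cutoff /cutoff asboolT // cube_bump_gt0.
have pD' : p \in enum_fset D by [].
rewrite (big_rem p) //=; apply: ltr_pwDl => //.
by apply: sumr_ge0 => p' _; exact: cutoff_ge0.
Qed.

End Cutoff.

Section BorelIntegral.
Context {R : realType} {M : ptopologicalType}.
Variable mu : {measure set (borel M) -> \bar R}.

Lemma borel_measurable (f : M -> R) : continuous f -> measurable_fun setT (f : borel M -> R).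
Proof.
move=> cf; apply: (measurability _ (RGenOInfty.measurableE R)) => _ [_ [x ->] <-].
rewrite setTI; apply: sub_sigma_algebra => /=.
by apply: (continuousP f).1 => //; exact: interval_open.
Qed.

Lemma continuous_bounded_compact (f : M -> R) : compact [set: M] -> continuous f ->
  exists c, forall p, `|f p| <= c.
Proof.
move=> cM cf.
have cn : {within [set: M], continuous (fun p => `|f p|)}.
  apply: continuous_subspaceT => p; apply: continuous_comp; first exact: cf.
  exact: norm_continuous.
have [p _ Hp] := compact_EVT_max (ex_intro _ point I) cM cn.
by exists `|f p| => q; apply: Hp; exact: mem_set.
Qed.

Lemma borel_integrable (f : M -> R) : compact [set: M] -> (mu setT < +oo)%E -> continuous f ->
  mu.-integrable setT (EFin \o f).
Proof.
move=> cM fin cf; apply: measurable_bounded_integrable => //; first exact: borel_measurable.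
have [c Hc] := continuous_bounded_compact cM cf.
by exists c; split => [|d cd p _ /=]; [exact: num_real|exact: le_trans (Hc p) (ltW cd)].
Qed.

End BorelIntegral.

Section DivergenceZero.
Context {R : realType} {n : nat} (O : set 'rV[R]_n) (oO : open O).
Variable G : 'rV[R]_n -> 'M[R]_n.

Lemma divergence_ext (w z : 'I_n -> 'rV[R]_n -> R) x : (forall y a, O y -> w a y = z a y) -> O x ->
  divergence G w x = divergence G z x.
Proof.
move=> wz Ox; apply: eq_bigr => i _; apply: eq_bigr => j _; congr (_ * _).
rewrite /nabla (partial_ext i oO (fun y => @wz y j) Ox); congr (_ - _).
by apply: eq_bigr => k _; rewrite wz.
Qed.

Lemma divergence0 x : divergence G (fun _ _ => 0) x = 0.
Proof.
rewrite /divergence big1 // => i _; rewrite big1 // => j _.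
by rewrite /nabla partial_cst big1 ?subr0 ?mulr0 // => k _; rewrite mulr0.
Qed.

End DivergenceZero.

(** * The divergence theorem and finiteness of the volume *)

Section DivergenceTheorem.
Context {R : realType} {n : nat} {M : ptopologicalType}.
Hypothesis M_hausdorff : hausdorff_space M.
Hypothesis M_compact : compact [set: M].
Variables (A : smooth_atlas R n M) (g : riemannian_metric A).
Variable dV : {measure set (borel M) -> \bar R}.
Hypothesis hdV : is_volume_measure g dV.
Implicit Types (i j : chart A) (p q : M) (c x : 'rV[R]_n) (r : R).

Let oC i := @open_chart_codom R n M A i.

Section Localized.
Variables (chi : M -> R) (i : chart A) (c : 'rV[R]_n) (r : R).
Hypothesis cball_codom : cball c r `<=` chart_codom i.
Hypothesis r_ge0 : 0 <= r.
Hypothesis Cchi : Ck_fun A 1 chi.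
Hypothesis chi_support : forall p, ~ (param A i @` cball c r) p -> chi p = 0.
Variable w : chart A -> 'I_n -> 'rV[R]_n -> R.
Hypothesis inv_w : chart_form w.
Hypothesis Cw : forall j a, Ck_on 1 (chart_codom j) (w j a).

Definition localize j a y := chi (param A j y) * w j a y.

Lemma Ck1_localize j a : Ck_on 1 (chart_codom j) (localize j a).
Proof. by apply: (Ck_onM (@oC j)); [exact: Cchi|exact: Cw]. Qed.

Lemma chart_form_localize : chart_form localize.
Proof.
move=> j k; apply: (pullback1M (f' := chi \o param A j) (f := chi \o param A k)) => //.
exact: smooth_fun_invariant.
Qed.

Definition div_localize := from_charts (fun j => divergence (coeff g j) (localize j)).

Lemma inv_div_localize : chart_invariant (fun j => divergence (coeff g j) (localize j)).
Proof. exact: (chart_invariant_divergence g chart_form_localize Ck1_localize). Qed.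

Lemma continuous_div_localize : continuous div_localize.
Proof.
apply: from_charts_continuous; first exact: inv_div_localize.
move=> j; apply: (Ck_divergence (@oC j) (@Ck_coeff _ _ _ _ g j) (@unit_coeff _ _ _ _ g j)) => a.
exact: Ck1_localize.
Qed.

Lemma div_localize_support p : ~ (param A i @` cball c r) p -> div_localize p = 0.
Proof.
move=> np; rewrite /div_localize /from_charts; set j := chart_at p.
have clK := compact_closed M_hausdorff (compact_param_cball cball_codom).
have oU : open [set y | chart_codom j y /\ (~` (param A i @` cball c r)) (param A j y)].
  by apply: open_preimage_param; exact: closed_openC.
have Ux : [set y | chart_codom j y /\ (~` (param A i @` cball c r)) (param A j y)] (Defs.coord A j p).
  split; first by apply: codom_coord; exact: chart_at_dom.
  by rewrite coordK //; exact: chart_at_dom.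
rewrite (divergence_ext (z := fun _ _ => 0) oU _ _ Ux) ?divergence0 // => y a [cy ny].
by rewrite /localize chi_support // mul0r.
Qed.

(** Component a of the density times the vector field dual to the localized form, extended by zero
    to all of R^n. *)
Let flux a x : R := patch (fun=> 0) (chart_codom i)
  (fun y => Num.sqrt (\det (coeff g i y)) * raise (coeff g i) (localize i) y a 0) x.

Let fluxE a x : chart_codom i x ->
  flux a x = Num.sqrt (\det (coeff g i x)) * raise (coeff g i) (localize i) x a 0.
Proof. by move=> cx; rewrite /flux patchE mem_set. Qed.

Let flux_out a x : (~` cball c r) x -> flux a x = 0.
Proof.
move=> nx; have [cx|ncx] := pselect (chart_codom i x); last by rewrite /flux patchE memNset.
rewrite fluxE //.
have -> : raise (coeff g i) (localize i) x = 0.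
  rewrite /raise (_ : form_col _ _ = 0) ?mulmx0 //.
  apply/matrixP => b d; rewrite !mxE /localize chi_support ?mul0r // => -[y yc E].
  by apply: nx; rewrite -(coordKx cx) -E coordKx //; exact: cball_codom.
by rewrite mxE mulr0.
Qed.

Let oball : open (~` cball c r).
Proof. by apply: closed_openC; exact: closed_cball. Qed.

Let Cflux a : Ck_on 1 setT (flux a).
Proof.
(* The open chart codomain and the complement of the closed ball cover R^n; the flux is given by its
   formula on the first and vanishes on the second. *)
apply: Ck_on_local => x _.
have [cx|ncx] := pselect (chart_codom i x).
  exists (chart_codom i); split; [exact: open_chart_codom|exact: cx|].
  have H : Ck_on 1 (chart_codom i) (fun y => Num.sqrt (\det (coeff g i y)) *
      raise (coeff g i) (localize i) y a 0).
    apply: (Ck_onM (@oC i)).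
      exact: (Ck1_sqrt_det (@oC i) (@Ck_coeff _ _ _ _ g i) (@sym_coeff _ _ _ _ g i) (@posdef_coeff _ _ _ _ g i)).
    exact: (Ck_raise (@oC i) (@Ck_coeff _ _ _ _ g i) (@unit_coeff _ _ _ _ g i) (Ck1_localize i)).
  by apply: (Ck_on_ext (@oC i) _ H) => y cy; rewrite fluxE.
exists (~` cball c r); split; [exact: oball|by move=> xc; apply: ncx; exact: cball_codom|].
by apply: (Ck_on_ext oball _ (Ck_on_cst 1 _ 0)) => y ny; rewrite flux_out.
Qed.

Let flux_supported a : supported_in (`|c| + r) (flux a).
Proof.
move=> x xr; apply: flux_out => /= xc; move: xr; rewrite ltNge => /negP; apply.
by rewrite -(subrK c x) (le_trans (ler_normD _ _)) // addrC lerD2l.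
Qed.

(** Read in the chart i, the divergence times the density is the Euclidean divergence of [flux], a
    compactly supported C^1 field on all of R^n. *)
Lemma integral_div_localize : \int[dV]_p div_localize p = 0.
Proof.
have KK := compact_param_cball cball_codom.
have Kdom : param A i @` cball c r `<=` dom A i.
  by move=> _ [x xc <-]; apply: param_dom; exact: cball_codom.
have E := hdV continuous_div_localize KK Kdom div_localize_support.
rewrite /Rintegral E /=.
have Cp a : continuous (partial a (flux a)).
  by move=> x; have [_ /(_ x I)] := Cflux a a.
have -> : patch (fun=> 0) (Defs.coord A i @` dom A i)
    (fun x => div_localize (param A i x) * Num.sqrt (\det (coeff g i x))) =
    (fun x => \sum_a partial a (flux a) x).
  apply/funext => x; rewrite -/(chart_codom i).
  have [cx|ncx] := pselect (chart_codom i x).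
    rewrite patchE mem_set // /div_localize (from_charts_param inv_div_localize cx) mulrC.
    rewrite (sqrt_det_divergence (@oC i) (@Ck_coeff _ _ _ _ g i) (@sym_coeff _ _ _ _ g i)
      (@posdef_coeff _ _ _ _ g i) (Ck1_localize i) cx).
    apply: eq_bigr => a _; apply: partial_ext (@oC i) _ cx => y cy.
    by rewrite fluxE.
  rewrite patchE memNset // big1 // => a _.
  have nx : (~` cball c r) x by move=> xc; apply: ncx; exact: cball_codom.
  by rewrite (partial_ext (g := fun=> 0) a oball (@flux_out a) nx) partial_cst.
have B0 : 0 <= `|c| + r by rewrite addr_ge0.
rewrite (integral_rV_sum _ B0) //; last by move=> a; exact: partial_supported.
rewrite big1 // => a _; apply: (integral_rV_partial (B := `|c| + r)) => //.
- by move=> x; apply: (Ck1_continuous openT (Cflux a)).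
- by move=> x; have [df _] := Cflux a a; exact: df.
Qed.

End Localized.

Section Partition.
Variable s : seq M.
Hypothesis s_cover : forall q, 0 < \sum_(p <- s) chart_cutoff A p q.

Definition partition p q : R := chart_cutoff A p q / \sum_(p' <- s) chart_cutoff A p' q.

Lemma partition_ge0 p q : 0 <= partition p q.
Proof. by rewrite divr_ge0 ?cutoff_ge0 // ltW. Qed.

Lemma sum_partition q : \sum_(p <- s) partition p q = 1.
Proof. by rewrite -mulr_suml mulfV // gt_eqF. Qed.

Lemma Ck1_partition p : Ck_fun A 1 (partition p).
Proof.
have C1 p' : Ck_fun A 1 (chart_cutoff A p').
  by apply: Ck1_cutoff => //; [exact: cutoff_radius_gt0|exact: cball_cutoff_radius].
move=> i; apply: (Ck_onM (@oC i)); first exact: C1.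
apply: (Ck_onV (@oC i)); first by move=> x _; rewrite gt_eqF.
by apply: (Ck_on_sum _ (@oC i)) => p'; exact: C1.
Qed.

Lemma partition_support p q :
  ~ (param A (@chart_at _ _ _ A p) @` cball (cutoff_center A p) (cutoff_radius A p)) q -> partition p q = 0.
Proof. by move=> nq; rewrite /partition /chart_cutoff cutoff_support ?mul0r //; exact: cutoff_radius_gt0. Qed.

Lemma continuous_partition p : continuous (partition p).
Proof.
apply: (continuous_in_charts (A := A)) => i; exact: (Ck_on_pred (@oC i) (@Ck1_partition p i)).
Qed.

(** The total mass is the sum of the integrals of the partition functions, and [is_volume_measure]
    equates each of these with a real number. *)
Lemma finite_volume_of_cover : (dV setT < +oo)%E.
Proof.
have -> : dV setT = (\int[dV]_q (\sum_(p <- s) (partition p q)%:E))%E.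
  under eq_integral => q _ do rewrite sumEFin sum_partition.
  by rewrite integral_cst // mul1e.
rewrite ge0_integral_sum //; last 2 first.
- by move=> p; apply/measurable_EFinP; exact: (borel_measurable (@continuous_partition p)).
- by move=> p q _; rewrite lee_fin partition_ge0.
apply: lte_sum_pinfty => p _.
have sub := cball_cutoff_radius (p := p) (A := A).
have Kdom : param A (chart_at p) @` cball (cutoff_center A p) (cutoff_radius A p) `<=`
    dom A (chart_at p).
  by move=> _ [x xc <-]; apply: param_dom; exact: sub.
have E := hdV (@continuous_partition p) (compact_param_cball sub) Kdom (@partition_support p).
by rewrite E ltry.
Qed.

Variable w : chart A -> 'I_n -> 'rV[R]_n -> R.
Hypothesis inv_w : chart_form w.
Hypothesis Cw : forall j a, Ck_on 1 (chart_codom j) (w j a).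

(** By Leibniz the terms carrying derivatives of the cutoffs add up to the inner product of w with
    the differential of the constant 1. *)
Lemma sum_div_localize q :
  \sum_(p <- s) div_localize (partition p) w q =
  from_charts (fun i => divergence (coeff g i) (w i)) q.
Proof.
rewrite /div_localize /from_charts; set i := chart_at q; set x := Defs.coord A i q.
have cx : chart_codom i x by apply: codom_coord; exact: chart_at_dom.
have E p : divergence (coeff g i) (localize (partition p) w i) x =
    inner1 (coeff g i) (differential (partition p \o param A i)) (w i) x +
    partition p (param A i x) * divergence (coeff g i) (w i) x.
  exact: (divergenceM _ (@Ck1_partition p i) (Cw i) cx).
under eq_bigr do rewrite E.
rewrite big_split /= -mulr_suml sum_partition mul1r.
suff -> : \sum_(p <- s) inner1 (coeff g i) (differential (partition p \o param A i)) (w i) x = 0.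
  by rewrite add0r.
rewrite /inner1 exchange_big big1 // => a _ /=; rewrite exchange_big big1 // => b _ /=.
rewrite -mulr_suml -mulr_sumr /differential.
rewrite -(partial_sum (@oC i) _ _ (fun p => @Ck1_partition p i) cx).
under [X in partial a X]eq_fun do rewrite /= sum_partition.
by rewrite partial_cst mulr0 mul0r.
Qed.

Lemma integral_divergence_of_cover :
  \int[dV]_p from_charts (fun i => divergence (coeff g i) (w i)) p = 0.
Proof.
have D0 p : \int[dV]_q div_localize (partition p) w q = 0.
  apply: (integral_div_localize (i := chart_at p) (c := cutoff_center A p) (r := cutoff_radius A p)) => //.
  - exact: cball_cutoff_radius.
  - exact: ltW (cutoff_radius_gt0 _ _).
  - exact: Ck1_partition.
  - exact: partition_support.
have cD p : continuous (div_localize (partition p) w).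
  by apply: continuous_div_localize => //; exact: Ck1_partition.
have H (r : seq M) : \int[dV]_q (\sum_(p <- r) div_localize (partition p) w q) = 0.
  elim: r => [|p r IH].
    by under eq_Rintegral do rewrite big_nil; rewrite Rintegral_cst // mul0r.
  under eq_Rintegral do rewrite big_cons.
  rewrite RintegralD //; first by rewrite D0 IH addr0.
  - exact: borel_integrable finite_volume_of_cover (cD p).
  - apply: borel_integrable finite_volume_of_cover _ => //.
    by move=> q; apply: (@cvg_sumr _ _ _ (nbhs q)) => p'; exact: cD.
by rewrite -(H s); apply: eq_Rintegral => q _; rewrite sum_div_localize.
Qed.

End Partition.

Lemma finite_volume : (dV setT < +oo)%E.
Proof. by have [s Hs] := chart_cutoff_cover A M_compact; exact: finite_volume_of_cover Hs. Qed.

Theorem integral_divergence (w : chart A -> 'I_n -> 'rV[R]_n -> R) : chart_form w ->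
  (forall j a, Ck_on 1 (chart_codom j) (w j a)) ->
  \int[dV]_p from_charts (fun i => divergence (coeff g i) (w i)) p = 0.
Proof.
move=> iw Cw; have [s Hs] := chart_cutoff_cover A M_compact.
exact: (integral_divergence_of_cover Hs iw Cw).
Qed.

End DivergenceTheorem.

(** * Coercivity *)

Section Nonnegativity.
Context {R : realType} {n : nat}.
Variables (G : 'rV[R]_n -> 'M[R]_n) (x : 'rV[R]_n).
Hypothesis symG : (G x)^T = G x.
Hypothesis pG : posdef_mx (G x).

Lemma sqnorm1_ge0 w : 0 <= sqnorm1 G w x.
Proof.
rewrite -[sqnorm1 G w x]/(inner1 G w w x) inner1E.
have [v0|v0] := eqVneq (form_col w x)^T 0; first by rewrite v0 !mul0mx mxE.
by have := posdef_inv symG pG v0; rewrite trmxK => /ltW.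
Qed.

(** Writing the cometric as B B^T turns the squared norm of T into the Frobenius norm squared of B^T
    T B. *)
Lemma sqnorm2_ge0 T : 0 <= sqnorm2 G T x.
Proof.
rewrite -[sqnorm2 G T x]/(inner2 G T T x) inner2E.
have symA : (invmx (G x))^T = invmx (G x) by rewrite trmx_inv symG.
have [B E] := posdef_cholesky symA (posdef_inv symG pG).
rewrite symA E; move: (tensor_mx T x) => S.
have -> : \tr (B *m B^T *m S *m (B *m B^T) *m S^T) = \tr ((B^T *m S *m B) *m (B^T *m S *m B)^T).
  by rewrite !trmx_mul !trmxK -!mulmxA mxtrace_mulC !mulmxA.
exact: frobenius_ge0.
Qed.

End Nonnegativity.

(** * Integrated identity and lower bound on the energy *)

Section Coercivity.
Context {R : realType} {n : nat} {M : ptopologicalType}.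
Hypothesis M_hausdorff : hausdorff_space M.
Hypothesis M_compact : compact [set: M].
Variables (A : smooth_atlas R n M) (g : riemannian_metric A).
Variable dV : {measure set (borel M) -> \bar R}.
Hypothesis hdV : is_volume_measure g dV.

Lemma coord_chart_at (p : M) : chart_codom (@chart_at _ _ _ A p) (Defs.coord A (chart_at p) p).
Proof. by apply: codom_coord; exact: chart_at_dom. Qed.

Lemma grad_sqnorm_ge0 u p : 0 <= grad_sqnorm g u p.
Proof.
by apply: sqnorm1_ge0; [apply: sym_coeff|apply: posdef_coeff]; exact: coord_chart_at.
Qed.

Lemma hess_sqnorm_ge0 u p : 0 <= hess_sqnorm g u p.
Proof.
by apply: sqnorm2_ge0; [apply: sym_coeff|apply: posdef_coeff]; exact: coord_chart_at.
Qed.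

Lemma positive_lower_bound (f : M -> R) : continuous f -> (forall p, 0 < f p) ->
  exists2 c, 0 < c & forall p, c <= f p.
Proof.
move=> cf f0.
have [p _ Hp] := compact_EVT_min (ex_intro _ point I) M_compact (continuous_subspaceT cf).
by exists (f p) => // q; apply: Hp; exact: mem_set.
Qed.

Lemma continuous_scalar_curvature : continuous (scalar_curvature g).
Proof.
apply: from_charts_continuous; first exact: chart_invariant_scalar_curv.
move=> i; exact: (smooth_scalar_curv (@open_chart_codom _ _ _ A i) (@Ck_coeff _ _ _ _ g i)
  (@unit_coeff _ _ _ _ g i) 0%N).
Qed.

Lemma continuous_Q_curvature : continuous (Q_curvature g).
Proof.
apply: from_charts_continuous; first exact: chart_invariant_Q.
by move=> i; exact: (@smooth_Q _ _ _ _ g i 0%N).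
Qed.

Section Function.
Variables (u : M -> R) (Hu : smooth_fun A u).

Definition energy : M -> R := from_charts (fun i => paneitz_energy (coeff g i) (u \o param A i)).

Lemma continuous_energy : continuous energy.
Proof.
apply: from_charts_continuous; first exact: chart_invariant_energy.
by move=> i; exact: (smooth_energy g Hu i 0%N).
Qed.

Lemma continuous_u2 : continuous (fun p => `|u p| ^+ 2).
Proof.
have cu : continuous u by apply: (continuous_in_charts (A := A)) => i; exact: (Hu i 0%N).
have -> : (fun q => `|u q| ^+ 2) = (fun q => u q * u q).
  by apply/funext => q; rewrite real_normK ?num_real // expr2.
by move=> p; exact: (continuousM (cu p) (cu p)).
Qed.

Lemma continuous_grad_sqnorm : continuous (grad_sqnorm g u).
Proof.
apply: from_charts_continuous; first exact: chart_invariant_grad.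
by move=> i; exact: (smooth_grad g Hu i 0%N).
Qed.

Lemma continuous_hess_sqnorm : continuous (hess_sqnorm g u).
Proof.
apply: from_charts_continuous; first exact: chart_invariant_hess.
by move=> i; exact: (smooth_hess g Hu i 0%N).
Qed.

Lemma integral_paneitz : \int[dV]_p (u p * paneitz g u p) = \int[dV]_p energy p.
Proof.
have fin := finite_volume M_hausdorff M_compact hdV.
pose D : M -> R := from_charts (fun i => divergence (coeff g i)
  (paneitz_flux (coeff g i) (u \o param A i))).
have Cf i a : Ck_on 1 (chart_codom i) (paneitz_flux (coeff g i) (u \o param A i) a).
  exact: (@smooth_flux _ _ _ A g u Hu i a 1%N).
have cD : continuous D.
  apply: from_charts_continuous.
    exact: (chart_invariant_divergence g (chart_form_flux g Hu) Cf).
  move=> i; apply: (Ck_divergence (@open_chart_codom _ _ _ A i) (@Ck_coeff _ _ _ _ g i)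
    (@unit_coeff _ _ _ _ g i)) => a; exact: Cf.
have D0 : \int[dV]_p D p = 0.
  exact: (integral_divergence M_hausdorff M_compact hdV (chart_form_flux g Hu) Cf).
have E p : u p * paneitz g u p = energy p + D p.
  have := paneitz_identity_chart g Hu (coord_chart_at p).
  by rewrite /= coordK //; exact: chart_at_dom.
under eq_Rintegral do rewrite E.
rewrite RintegralD ?D0 ?addr0 //.
- exact: borel_integrable M_compact fin continuous_energy.
- exact: borel_integrable M_compact fin cD.
Qed.

(** Each summand of the H^2 density is dominated by the matching term of the energy; the term in
    (Lap u)^2, nonnegative because b <= 1, is discarded. *)
Lemma energy_ge (c R0 Q0 : R) p :
  @paneitz_b R n <= 1 -> 0 <= @paneitz_a R n -> 4 <= n%:R :> R ->
  R0 <= scalar_curvature g p -> Q0 <= Q_curvature g p ->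
  c <= @paneitz_b R n -> c <= @paneitz_a R n * R0 -> c <= (n%:R - 4) / 2 * Q0 ->
  c * (`|u p| ^+ 2 + grad_sqnorm g u p + hess_sqnorm g u p) <= energy p.
Proof.
move=> b1 a0 n4 RR QQ cb ca cq.
have H1 := grad_sqnorm_ge0 u p; have H2 := hess_sqnorm_ge0 u p.
rewrite /energy /from_charts /paneitz_energy /=.
rewrite -/(scalar_curvature g p) -/(Q_curvature g p).
rewrite -[sqnorm1 _ _ _]/(grad_sqnorm g u p) -[sqnorm2 _ _ _]/(hess_sqnorm g u p).
rewrite -[scalar_curv _ _]/(scalar_curvature g p) -[local_Q _ _]/(Q_curvature g p).
rewrite coordK; last exact: chart_at_dom.
rewrite real_normK ?num_real //.
have l2 := sqr_ge0 (laplacian (coeff g (chart_at p)) (u \o param A (chart_at p))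
  (Defs.coord A (chart_at p) p)).
move: (laplacian _ _ _) l2 => l l2.
have u2 := sqr_ge0 (u p).
have T1 : 0 <= (1 - @paneitz_b R n) * l ^+ 2 by rewrite mulr_ge0 // subr_ge0.
have T2 : c * hess_sqnorm g u p <= @paneitz_b R n * hess_sqnorm g u p by rewrite ler_wpM2r.
have T3 : c * grad_sqnorm g u p <= @paneitz_a R n * scalar_curvature g p * grad_sqnorm g u p.
  by rewrite ler_wpM2r // (le_trans ca) // ler_wpM2l.
have T4 : c * u p ^+ 2 <= (n%:R - 4) / 2 * Q_curvature g p * u p ^+ 2.
  by rewrite ler_wpM2r // (le_trans cq) // ler_wpM2l // divr_ge0 // subr_ge0.
lra.
Qed.

End Function.
End Coercivity.

Theorem proposition1p5 (R : realType) (N : nat) (hN : (6 <= N)%N)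
  (M : ptopologicalType) (M_hausdorff : hausdorff_space M)
  (M_compact : compact [set: M])
  (A : smooth_atlas R N M) (g : riemannian_metric A)
  (dV : {measure set (borel M) -> \bar R}) (hdV : is_volume_measure g dV)
  (Q_gt0 : forall p : M, 0 < Q_curvature g p)
  (R_gt0 : forall p : M, 0 < scalar_curvature g p) :
  coercive g dV (paneitz g).
Proof.
have [R0 R0_gt0 HR] := positive_lower_bound M_compact (@continuous_scalar_curvature _ _ _ _ g) R_gt0.
have [Q0 Q0_gt0 HQ] := positive_lower_bound M_compact (@continuous_Q_curvature _ _ _ _ g) Q_gt0.
have N6 : 6 <= N%:R :> R by rewrite (ler_nat R 6 N).
have b0 : 0 < @paneitz_b R N by rewrite /paneitz_b divr_gt0 //; lra.
(* The dimension bound is used in full here: 4 <= N - 2. The other signs only require N > 4. *)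
have b1 : @paneitz_b R N <= 1 by rewrite /paneitz_b ler_pdivrMr ?mul1r; lra.
have a0 : 0 < @paneitz_a R N.
  rewrite /paneitz_a divr_gt0 //; first by rewrite ltr_wpDl ?sqr_ge0.
  by rewrite mulr_gt0 ?mulr_gt0 //; lra.
have q0 : 0 < (N%:R - 4) / 2 * Q0 by rewrite mulr_gt0 // divr_gt0 //; lra.
(* The least of the coefficients of |Hess u|^2, |du|^2 and u^2 in the energy, with R and Q replaced
   by their lower bounds. *)
pose c := Num.min (@paneitz_b R N) (Num.min (@paneitz_a R N * R0) ((N%:R - 4) / 2 * Q0)).
have c0 : 0 < c by rewrite !lt_min b0 q0 mulr_gt0.
exists c => // u Hu.
have fin := finite_volume M_hausdorff M_compact hdV.
have int (f : M -> R) : continuous f -> dV.-integrable setT (EFin \o f).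
  by move=> cf; exact: (borel_integrable M_compact fin cf).
have iu := int _ (continuous_u2 Hu); have ig := int _ (continuous_grad_sqnorm (g := g) Hu).
have ih := int _ (continuous_hess_sqnorm (g := g) Hu); have iE := int _ (continuous_energy (g := g) Hu).
rewrite integral_paneitz // /H2_norm sqr_sqrtr; last first.
  rewrite !addr_ge0 //; apply: Rintegral_ge0 => p _;
    [exact: sqr_ge0|exact: grad_sqnorm_ge0|exact: hess_sqnorm_ge0].
have cug : continuous (fun p => `|u p| ^+ 2 + grad_sqnorm g u p).
  by apply: continuous_add; [exact: continuous_u2 Hu|exact: continuous_grad_sqnorm].
have cugh : continuous (fun p => `|u p| ^+ 2 + grad_sqnorm g u p + hess_sqnorm g u p).
  by apply: continuous_add => //; exact: continuous_hess_sqnorm.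
rewrite -RintegralD // -RintegralD //; last exact: int cug.
rewrite -RintegralZl //; last exact: int cugh.
apply: le_Rintegral => //.
- by apply: int; exact: continuousMl.
- move=> p _; apply: (@energy_ge _ _ _ _ _ u c R0 Q0 p) => //.
  + exact: ltW.
  + lra.
  + by rewrite /c ge_min lexx.
  + by rewrite /c !ge_min lexx orbT.
  + by rewrite /c !ge_min lexx !orbT.
Qed.
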